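(* Let $n\ge 3$ be an odd integer and let $\mu\ge 0$, $\nu^2\ge 0$ be constants. Assume $f\in\mathcal{C}^{\frac{n+1}{2}}([0,\infty)\times\mathbb{R}^n)$, $u_0\in\mathcal{C}^{\frac{n+1}{2}+1}(\mathbb{R}^n)$ and $u_1\in\mathcal{C}^{\frac{n+1}{2}}(\mathbb{R}^n)$. Then a representation formula for the (classical) solution $u$ of the Cauchy problem $$\begin{cases} u_{tt}-\Delta u+\frac{\mu}{1+t}u_t+\frac{\nu^2}{(1+t)^2}u=f(t,x), & x\in\mathbb{R}^n,\ t>0,\\ u(0,x)=u_0(x), & x\in\mathbb{R}^n,\\ u_t(0,x)=u_1(x), & x\in\mathbb{R}^n,\end{cases}$$ is given by $$\begin{aligned} u(t,x)&=(1+t)^{-\frac{\mu}{2}}w[u_0](t,x)+\frac{1}{2^{\sqrt{\delta}-1}}\int_0^t w[u_0](s,x)\,K_0(t,0;s;\mu,\nu^2)\,\mathrm{d}s\\ &\quad+\frac{1}{2^{\sqrt{\delta}-1}}\int_0^t w[u_1+\mu\,u_0](s,x)\,K_1(t,0;s;\mu,\nu^2)\,\mathrm{d}s\\ &\quad+\frac{1}{2^{\sqrt{\delta}-1}}\int_0^t\int_0^{t-b}w[f](s,x;b)\,E(t,0;b,s;\mu,\nu^2)\,\mathrm{d}s\,\mathrm{d}b,\end{aligned}$$ that is, the function $u$ defined by this formula is the solution of the Cauchy problem. Here, for a function $\varphi=\varphi(x)$ on $\mathbb{R}^n$ and for $f=f(t,x)$, $$w[\varphi](t,x)=\frac{1}{(n-2)!!}\,\frac{\partial}{\partial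 t}\Big(\frac1t\frac{\partial}{\partial t}\Big)^{\frac{n-3}{2}}\left(t^{n-2}\,\frac{1}{|\partial B_t(x)|}\int_{\partial B_t(x)}\varphi(z)\,\mathrm{d}\sigma_z\right),\qquad w[f](t,x;b)=w[f(b,\cdot)](t,x).$$
   Context: Set $\delta=(\mu-1)^2-4\nu^2$; if $\delta<0$, $\sqrt{\delta}$ means $i\sqrt{-\delta}$, and powers of positive reals with complex exponents are $a^{c}=e^{c\log a}$. $\mathsf{F}(\alpha,\beta;\gamma;z)$ denotes Gauss' hypergeometric function (power series for $|z|<1$). For $t,b\ge 0$ and $x,y\in\mathbb{R}$ (real scalars, with $|y-x|<t+b+2$), the kernels are $$E(t,x;b,y;\mu,\nu^2)=(1+t)^{-\frac{\mu}{2}+\frac{1-\sqrt{\delta}}{2}}(1+b)^{\frac{\mu}{2}+\frac{1-\sqrt{\delta}}{2}}\big((t+b+2)^2-(y-x)^2\big)^{\frac{\sqrt{\delta}-1}{2}}\,\mathsf{F}\Big(\tfrac{1-\sqrt{\delta}}{2},\tfrac{1-\sqrt{\delta}}{2};1;\tfrac{(t-b)^2-(y-x)^2}{(t+b+2)^2-(y-x)^2}\Big),$$ $$K_0(t,x;y;\mu,\nu^2)=-\frac{\partial}{\partial b}E(t,x;b,y;\mu,\nu^2)\Big|_{b=0},\qquad K_1(t,x;y;\mu,\nu^2)=E(t,x;0,y;\mu,\nu^2).$$ $B_t(x)$ is the ball of radius $t$ centred at $x$ in $\mathbb{R}^n$, $\mathrm{d}\sigma$ is surface measure, $|\partial B_t(x)|$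 the surface measure of the sphere, and $j!!=j(j-2)\cdots1$ for odd $j\ge1$. The function $w[\varphi]$ is the solution of the free wave equation $w_{tt}-\Delta w=0$ with data $w(0,x)=\varphi(x)$, $w_t(0,x)=0$; the formula for it holds for $t>0$ and $w[\varphi](0,x)=\varphi(x)$. Solutions are understood in the classical (pointwise) sense. *)

(* Defs.v *)
From Stdlib Require Import Reals.
From Coquelicot Require Import Coquelicot.
From mathcomp Require Import ssreflect ssrfun ssrbool eqtype ssrnat seq fintype bigop.

Set Implicit Arguments.
Unset Strict Implicit.
Unset Printing Implicit Defensive.

Local Open Scope R_scope.

(** * Complex-valued calculus in a real variable *)

Definition cexp (z : C) : C :=
  (exp (Re z) * cos (Im z), exp (Re z) * sin (Im z)).

(** [a ^ c = e ^ (c log a)], meaningful for [0 < a]. *)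
Definition cpower (a : R) (c : C) : C := cexp (c * RtoC (ln a))%C.

(** [i sqrt (- d)] for negative [d]. *)
Definition csqrt (d : R) : C :=
  if Rle_dec 0 d then RtoC (sqrt d) else (0, sqrt (- d)).

(** [Derive] and [Series] are only available for real values. *)
Definition CDerive (g : R -> C) (t : R) : C :=
  (Derive (fun s => Re (g s)) t, Derive (fun s => Im (g s)) t).

Definition CSeries (a : nat -> C) : C :=
  (Series (fun k => Re (a k)), Series (fun k => Im (a k))).

Definition CRInt (g : R -> C) (a b : R) : C :=
  RInt (V := C_R_CompleteNormedModule) g a b.

(** * Gauss' hypergeometric function, as a power series for [|z| < 1] *)

Fixpoint pochhammer (a : C) (k : nat) : C :=
  match k with
  | O => RtoC 1
  | S j => (pochhammer a j * (a + RtoC (INR j)))%C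
  end.

Definition hypergeom (alpha beta gamma z : C) : C :=
  CSeries (fun k =>
    (pochhammer alpha k * pochhammer beta k
       / (pochhammer gamma k * RtoC (INR (k`!)%N)) * Cpow z k)%C).

(** * The kernels; [nu2] stands for the constant written nu^2 *)

Definition delta (mu nu2 : R) : R := (mu - 1) ^ 2 - 4 * nu2.

Definition kernelE (t x b y mu nu2 : R) : C :=
  let sd := csqrt (delta mu nu2) in
  let a := ((1 - sd) / 2)%C in
  (cpower (1 + t) (- RtoC mu / 2 + a)
   * cpower (1 + b) (RtoC mu / 2 + a)
   * cpower ((t + b + 2) ^ 2 - (y - x) ^ 2)%R ((sd - 1) / 2)
   * hypergeom a a 1
       (RtoC (((t - b) ^ 2 - (y - x) ^ 2) / ((t + b + 2) ^ 2 - (y - x) ^ 2))))%C.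

Definition kernelK0 (t x y mu nu2 : R) : C :=
  (- CDerive (fun b => kernelE t x b y mu nu2) 0)%C.

Definition kernelK1 (t x y mu nu2 : R) : C := kernelE t x 0 y mu nu2.

(** * Spheres in R^n; vectors are functions ['I_n -> R], whose uniform
    structure in Coquelicot is that of the sup norm *)

Definition vcons (m : nat) (a : R) (v : 'I_m -> R) : 'I_m.+1 -> R :=
  fun i => if unlift ord0 i is Some j then v j else a.

(** Integral over the unit sphere S^(n-1) of R^n with respect to surface
    measure, in spherical coordinates
      omega = (cos theta, sin theta * omega'),  0 <= theta <= PI,
      d sigma_(n-1)(omega) = (sin theta)^(n-2) d theta d sigma_(n-2)(omega'),
    down to the counting measure on S^0 = {1, -1}. *)
Fixpoint unit_sphere_int (n : nat) : (('I_n -> R) -> R) -> R :=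
  match n with
  | O => fun _ => 0
  | S m => fun g =>
      if m == O then g (fun _ => 1) + g (fun _ => -1)
      else RInt (fun theta =>
             sin theta ^ m.-1
             * unit_sphere_int (fun omega : 'I_m -> R =>
                 g (vcons (cos theta) (fun j => sin theta * omega j))))
             0 PI
  end.

Definition sphere_int (n : nat) (x : 'I_n -> R) (r : R)
    (phi : ('I_n -> R) -> R) : R :=
  r ^ n.-1 * unit_sphere_int (fun omega => phi (fun i => x i + r * omega i)).

Definition sphere_area (n : nat) (x : 'I_n -> R) (r : R) : R :=
  sphere_int x r (fun _ => 1).

Definition sphere_mean (n : nat) (x : 'I_n -> R) (r : R)
    (phi : ('I_n -> R) -> R) : R :=
  / sphere_area x r * sphere_int x r phi.

(** * Solution operator of the free wave equation, for odd [n >= 3] *)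

Fixpoint double_fact (j : nat) : nat :=
  match j with
  | S (S i) => (j * double_fact i)%N
  | _ => 1%N
  end.

Definition free_wave (n : nat) (phi : ('I_n -> R) -> R) (t : R)
    (x : 'I_n -> R) : R :=
  if Req_EM_T t 0 then phi x
  else
    / INR (double_fact (n - 2)%N)
    * Derive
        (iter (n - 3)%N./2 (fun (g : R -> R) (r : R) => / r * Derive g r)
           (fun r => r ^ (n - 2)%N * sphere_mean x r phi)) t.

(** * Functions of class C^k *)

Definition shift (n : nat) (x : 'I_n -> R) (i : 'I_n) (h : R) : 'I_n -> R :=
  fun j => if j == i then x j + h else x j.

Fixpoint Ck_space (n : nat) (V : NormedModule R_AbsRing) (k : nat)
    (phi : ('I_n -> R) -> V) : Prop :=
  (forall x, continuous phi x) /\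
  match k with
  | O => True
  | S l => forall i, exists dphi : ('I_n -> R) -> V,
      (forall x, is_derive (fun h => phi (shift x i h)) 0 (dphi x))
      /\ Ck_space l dphi
  end.

(** Derivative at [t] of a function on [0, oo): one-sided when [t = 0]. *)
Definition is_derive_ge0 (V : NormedModule R_AbsRing) (g : R -> V) (t : R)
    (l : V) : Prop :=
  filterdiff g (within (Rle 0) (locally t)) (fun h => scal h l).

(** Class C^k on [0, oo) x R^n, up to the boundary; the values of [u] at
    negative times are irrelevant. *)
Fixpoint Ck_spacetime (n : nat) (V : NormedModule R_AbsRing) (k : nat)
    (u : R -> ('I_n -> R) -> V) : Prop :=
  (forall t x, 0 <= t ->
     filterlim (fun p : R * ('I_n -> R) => u p.1 p.2)
       (within (fun p => 0 <= p.1) (locally (t, x))) (locally (u t x))) /\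
  match k with
  | O => True
  | S l =>
      (exists ut : R -> ('I_n -> R) -> V,
         (forall t x, 0 <= t -> is_derive_ge0 (fun s => u s x) t (ut t x))
         /\ Ck_spacetime l ut) /\
      (forall i, exists ui : R -> ('I_n -> R) -> V,
         (forall t x, 0 <= t ->
            is_derive (fun h => u t (shift x i h)) 0 (ui t x))
         /\ Ck_spacetime l ui)
  end.

(** * The Cauchy problem *)

Definition laplacian (n : nat) (phi : ('I_n -> R) -> C) (x : 'I_n -> R) : C :=
  \big[Cplus/RtoC 0]_(i < n) CDerive (CDerive (fun h => phi (shift x i h))) 0.

Definition classical_solution (n : nat) (mu nu2 : R)
    (f : R -> ('I_n -> R) -> R) (u0 u1 : ('I_n -> R) -> R)
    (u : R -> ('I_n -> R) -> C) : Prop :=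
  [/\ Ck_spacetime (V := C_R_NormedModule) 2 u,
      forall t x, 0 < t ->
        (CDerive (CDerive (fun s => u s x)) t - laplacian (u t) x
         + RtoC (mu / (1 + t)) * CDerive (fun s => u s x) t
         + RtoC (nu2 / (1 + t) ^ 2) * u t x)%C = RtoC (f t x),
      forall x, u 0 x = RtoC (u0 x)
    & forall x, is_derive_ge0 (V := C_R_NormedModule)
                  (fun t => u t x) 0 (RtoC (u1 x))].

Definition representation (n : nat) (mu nu2 : R)
    (f : R -> ('I_n -> R) -> R) (u0 u1 : ('I_n -> R) -> R)
    (t : R) (x : 'I_n -> R) : C :=
  let c := (/ cpower 2 (csqrt (delta mu nu2) - 1))%C in
  (RtoC (Rpower (1 + t) (- mu / 2)) * RtoC (free_wave u0 t x)
   + c * CRInt (fun s =>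
           RtoC (free_wave u0 s x) * kernelK0 t 0 s mu nu2) 0 t
   + c * CRInt (fun s =>
           RtoC (free_wave (fun z => u1 z + mu * u0 z)%R s x)
           * kernelK1 t 0 s mu nu2) 0 t
   + c * CRInt (fun b =>
           CRInt (fun s =>
             RtoC (free_wave (f b) s x) * kernelE t 0 b s mu nu2) 0 (t - b)%R)
           0 t)%C.

(* Main.v *)
(* The Liouville substitution u = (1 + t)^(-mu/2) U removes the damping and leaves
   U_tt - Lap U + lam / (1 + t)^2 U = (1 + t)^(mu/2) f with lam = (1 - delta) / 4. With p = 1 + t and
   q = 1 + b, the normalised kernel E is p^(-mu/2) q^(mu/2) P(y), where
   y = (p^2 + q^2 - s^2) / (2 p q) and P solves Legendre's equation
   (y^2 - 1) P'' + 2 y P' + lam P = 0 with P(1) = 1. As lam is real, Re P and Im P solve the same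
   equation with value 1 and 0 at y = 1, so the complex formula splits into two real ones. Each of
   P(y) and dP(y)/dq solves K_tt - K_ss + lam / (1 + t)^2 K = 0, so integrating K against a free wave in s
   gives a solution up to boundary terms on the characteristic s = t - b, and these produce the data and
   the source.

   The free wave comes from spherical means: Darboux's equation, proved by induction on the dimension in
   polar coordinates, is carried by the factors 2 k + 3 + r d/dr from dimension n down to dimension 3,
   where r times the mean solves the one-dimensional wave equation.
   With the stated regularity w[f(b, .)] is only C^1; the second derivatives of the solution are obtained
   after an integration by parts in s. Uniqueness follows from an energy estimate on backward
   light cones for the spherical means of the difference of two solutions. *)

From HB Require Import structures.
Require Import Defs.
From Stdlib Require Import Reals Lra Classical ClassicalEpsilon FunctionalExtensionality.
From Coquelicot Require Import Coquelicot.
From mathcomp Require Import ssreflect ssrfun ssrbool eqtype ssrnat seq fintype bigop.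

Set Implicit Arguments.
Unset Strict Implicit.
Unset Printing Implicit Defensive.

Local Open Scope R_scope.

(** * Continuity of real functions on a uniform space *)

(** Why Legendre's equation: p^2 (d_p^2 - d_s^2) is the wave operator of the metric (dp^2 - ds^2) /
    p^2, and y is the invariant of the pair of points (p, s), (q, 0) under its isometries. A kernel
    that depends on y alone thus turns the equation into an ordinary one. On the characteristics s =
    p - q and s = q - p one has y = 1, so the normalised P(y) is Riemann's function of the operator.

    The count of derivatives shapes the rest. In dimension n = 2 k + 3 the wave w[phi] takes k + 1
    derivatives of phi, its time primitive v[phi] only k. Data of class C^(k+2) allow two space
    derivatives on v but not on w, so second derivatives under the integrals are expressed through
    v. The term w[u0] outside the integrals has no such escape, which is where the additional
    derivative of u0 goes.

    The problem lives on t >= 0 and the profile on y >= 1. Times are clamped at 0 and P is continued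
    below 1, so that continuity is global and only differentiability in t is restricted to t > 0. *)

Lemma cR_const (T : UniformSpace) (c : R) (x : T) : continuous (fun _ : T => c) x.
Proof. exact: continuous_const. Qed.

Lemma cR_plus (T : UniformSpace) (f g : T -> R) (x : T) :
  continuous f x -> continuous g x -> continuous (fun y => f y + g y) x.
Proof. move=> hf hg; exact: (continuous_plus (V := R_NormedModule) f g). Qed.

Lemma cR_opp (T : UniformSpace) (f : T -> R) (x : T) :
  continuous f x -> continuous (fun y => - f y) x.
Proof. move=> hf; exact: (continuous_opp (V := R_NormedModule) f). Qed.

Lemma cR_minus (T : UniformSpace) (f g : T -> R) (x : T) :
  continuous f x -> continuous g x -> continuous (fun y => f y - g y) x.
Proof. move=> hf hg; exact: (continuous_minus (V := R_NormedModule) f g). Qed.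

Lemma cR_mult (T : UniformSpace) (f g : T -> R) (x : T) :
  continuous f x -> continuous g x -> continuous (fun y => f y * g y) x.
Proof. move=> hf hg; exact: (continuous_mult (K := R_AbsRing) f g). Qed.

Lemma cR_pow (T : UniformSpace) (f : T -> R) (k : nat) (x : T) :
  continuous f x -> continuous (fun y => f y ^ k) x.
Proof.
move=> hf; elim: k => [|k IH] /=; first exact: cR_const.
exact: cR_mult.
Qed.

Lemma cR_comp (T : UniformSpace) (f : T -> R) (g : R -> R) (x : T) :
  continuous f x -> (forall y, continuous g y) -> continuous (fun y => g (f y)) x.
Proof. move=> hf hg; exact: (continuous_comp f g). Qed.

Lemma cR_inv (T : UniformSpace) (f : T -> R) (x : T) :
  continuous f x -> f x <> 0 -> continuous (fun y => / f y) x.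
Proof. move=> hf h; apply: (continuous_comp f Rinv) => //; exact: continuous_Rinv. Qed.

Lemma cR_max (T : UniformSpace) (f : T -> R) (c : R) (x : T) :
  continuous f x -> continuous (fun y => Rmax (f y) c) x.
Proof.
move=> hf.
apply: (continuous_ext (fun y => (f y + c + Rabs (f y - c)) / 2)).
  move=> y; rewrite /Rmax /Rabs; case: Rle_dec => h; case: Rcase_abs => h'; lra.
rewrite /Rdiv; apply: cR_mult; last exact: cR_const.
apply: cR_plus; first by apply: cR_plus => //; exact: cR_const.
apply: (cR_comp (g := Rabs)); last exact: continuous_Rabs.
by apply: cR_minus => //; exact: cR_const.
Qed.

Lemma cR_sin (y : R) : continuous sin y. Proof. exact: continuous_sin. Qed.
Lemma cR_cos (y : R) : continuous cos y. Proof. exact: continuous_cos. Qed.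

Lemma c_id (T : UniformSpace) (x : T) : continuous (fun y : T => y) x.
Proof. exact: continuous_id. Qed.

Lemma c_fst (T U V : UniformSpace) (f : T -> U * V) (x : T) :
  continuous f x -> continuous (fun y => (f y).1) x.
Proof.
move=> hf; apply: (continuous_comp f fst) => //; case: (f x) => a b.
exact: continuous_fst.
Qed.

Lemma c_fst0 (U V : UniformSpace) (p : U * V) : continuous (fun p : U * V => p.1) p.
Proof. case: p => a b; exact: continuous_fst. Qed.

Lemma c_snd0 (U V : UniformSpace) (p : U * V) : continuous (fun p : U * V => p.2) p.
Proof. case: p => a b; exact: continuous_snd. Qed.

Lemma c_snd (T U V : UniformSpace) (f : T -> U * V) (x : T) :
  continuous f x -> continuous (fun y => (f y).2) x.
Proof.
move=> hf; apply: (continuous_comp f snd) => //; case: (f x) => a b.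
exact: continuous_snd.
Qed.

Lemma c_pair (T U V : UniformSpace) (f : T -> U) (g : T -> V) (x : T) :
  continuous f x -> continuous g x -> continuous (fun y => (f y, g y)) x.
Proof.
move=> hf hg.
apply: (continuous_comp_2 f g (fun a b => (a, b))) => //.
apply: (continuous_ext (fun p => p)); first by case.
exact: continuous_id.
Qed.

Lemma c_comp2 (T A B U : UniformSpace) (h : A -> B -> U) (f : T -> A) (g : T -> B) (x : T) :
  (forall p : A * B, continuous (fun p => h p.1 p.2) p) ->
  continuous f x -> continuous g x -> continuous (fun y => h (f y) (g y)) x.
Proof. move=> hh hf hg; apply: continuous_comp_2 => //; exact: hh. Qed.

Lemma c_comp3 (T A B D U : UniformSpace) (h : A -> B -> D -> U)
    (f : T -> A) (g : T -> B) (k : T -> D) (x : T) :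
  (forall p : A * B * D, continuous (fun p => h p.1.1 p.1.2 p.2) p) ->
  continuous f x -> continuous g x -> continuous k x ->
  continuous (fun y => h (f y) (g y) (k y)) x.
Proof.
move=> hh hf hg hk.
apply: (c_comp2 (h := fun (p : A * B) d => h p.1 p.2 d) (f := fun y => (f y, g y))) => //.
exact: c_pair.
Qed.

Lemma filter_forall_ord (n : nat) (T : Type) (F : (T -> Prop) -> Prop) {FF : Filter F}
    (P : 'I_n -> T -> Prop) :
  (forall i, F (P i)) -> F (fun t => forall i, P i t).
Proof.
move=> h.
have H : forall s : seq 'I_n, F (fun t => forall i, i \in s -> P i t).
  elim=> [|i s IH]; first by apply: filter_forall => t i; rewrite in_nil.
  apply: filter_imp (filter_and _ _ (h i) IH) => t [h1 h2] j.
  by rewrite in_cons => /orP [/eqP -> //|]; exact: h2.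
apply: filter_imp (H (enum 'I_n)) => t ht i; apply: ht; exact: mem_enum.
Qed.

(** A ball of the function space constrains all coordinates at once; as ['I_n] is finite, this is a
    finite intersection of neighbourhoods. *)
Lemma c_coords (n : nat) (T : UniformSpace) (f : T -> 'I_n -> R) (x : T) :
  (forall i, continuous (fun y => f y i) x) -> continuous (f : T -> ('I_n -> R)) x.
Proof.
move=> h; apply/filterlim_locally => e.
have H : forall i, locally x (fun y => ball (f x i) e (f y i)).
  by move=> i; have /filterlim_locally := h i; apply.
exact: (filter_forall_ord H).
Qed.

Lemma c_coord (n : nat) (T : UniformSpace) (f : T -> 'I_n -> R) (i : 'I_n) (x : T) :
  continuous (f : T -> ('I_n -> R)) x -> continuous (fun y => f y i) x.
Proof.
move=> /filterlim_locally h; apply/filterlim_locally => e.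
apply: filter_imp (h e) => y hy; exact: hy.
Qed.

Lemma c_shift (n : nat) (T : UniformSpace) (f : T -> 'I_n -> R) (g : T -> R) (i : 'I_n) (x : T) :
  continuous (f : T -> ('I_n -> R)) x -> continuous g x ->
  continuous ((fun y => shift (f y) i (g y)) : T -> ('I_n -> R)) x.
Proof.
move=> hf hg; apply: c_coords => j; rewrite /shift.
case: (j == i); last exact: c_coord.
by apply: cR_plus => //; exact: c_coord.
Qed.

Lemma c_big (T : UniformSpace) (I : finType) (f : I -> T -> R) (x : T) :
  (forall i, continuous (f i) x) ->
  continuous (fun y => \big[Rplus/0]_(i : I) f i y) x.
Proof.
move=> h; elim: (index_enum I) => [|i s IH].
  by apply: (continuous_ext (fun _ => 0)) => [y|]; [rewrite big_nil|exact: cR_const].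
apply: (continuous_ext (fun y => f i y + \big[Rplus/0]_(j <- s) f j y)).
  by move=> y; rewrite big_cons.
exact: cR_plus.
Qed.

Ltac cont_step :=
  match goal with
  | |- continuous (fun y => y) _ => exact: c_id
  | |- continuous (fun _ => ?c) _ => exact: continuous_const
  | |- continuous (fun y => fst y) _ => exact: c_fst0
  | |- continuous (fun y => snd y) _ => exact: c_snd0
  | |- continuous (fun y => Rplus _ _) _ => apply: cR_plus
  | |- continuous (fun y => Rminus _ _) _ => apply: cR_minus
  | |- continuous (fun y => Rmult _ _) _ => apply: cR_mult
  | |- continuous (fun y => Ropp _) _ => apply: cR_opp
  | |- continuous (fun y => pow _ _) _ => apply: cR_pow
  | |- continuous (fun y => Rmax _ _) _ => apply: cR_max
  | |- continuous (fun y => sin _) _ => apply: (cR_comp (g := sin)); last exact: cR_sin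
  | |- continuous (fun y => cos _) _ => apply: (cR_comp (g := cos)); last exact: cR_cos
  | |- continuous (fun y => fst _) _ => apply: c_fst
  | |- continuous (fun y => snd _) _ => apply: c_snd
  | |- continuous sin _ => exact: cR_sin
  | |- continuous cos _ => exact: cR_cos
  | |- continuous fst _ => exact: c_fst0
  | |- continuous snd _ => exact: c_snd0
  | H : continuous ?f ?x |- continuous ?f ?x => exact: H
  | H : forall x, continuous ?f x |- continuous ?f ?y => exact: (H y)
  end.
Ltac cont := rewrite /Rdiv; repeat cont_step.

(** * Integrals depending on a parameter *)

Lemma tube (T : UniformSpace) (F : T -> R -> R) (t0 : T) (a b : R) (e : posreal) :
  (forall s, a <= s <= b -> continuous (fun p : T * R => F p.1 p.2) (t0, s)) ->
  locally t0 (fun t => forall s, a <= s <= b -> Rabs (F t s - F t0 s) < e).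
Proof.
move=> hF.
(* Half of [e], because [F t s] and [F t0 s] are both compared with [F t0 u] at a nearby point [u].
   Outside [a, b] the condition is void, so a radius exists for every real [s]. *)
pose P (s : R) (d : posreal) := a <= s <= b ->
  forall t s', ball t0 d t -> ball s d s' -> Rabs (F t s' - F t0 s) < e / 2.
have hP : forall s, exists d, P s d.
  move=> s; case: (classic (a <= s <= b)) => hs; last by exists (mkposreal 1 Rlt_0_1).
  have he : 0 < e / 2 by have := cond_pos e; lra.
  have /filterlim_locally /(_ (mkposreal _ he)) [d hd] := hF s hs.
  exists d => _ t s' h1 h2; exact: (hd (t, s')).
pose D s := proj1_sig (constructive_indefinite_description _ (hP s)).
have hD s : P s (D s) := proj2_sig (constructive_indefinite_description _ (hP s)).
have [d hd] := compactness_value_1d a b D.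
exists d => t ht s hs.
(* Compactness yields the point [u] only under a double negation. *)
apply: NNPP => hn; apply: (hd s hs) => -[u [hu [h1 h2]]]; apply: hn.
have hb : ball t0 (D u) t by apply: (ball_le _ d).
have hs' : ball u (D u) s by rewrite /ball /= /AbsRing_ball /= /abs /minus /plus /opp /=.
have h3 := @hD u hu t s hb hs'.
have h4 := @hD u hu t0 s (ball_center t0 (D u)) hs'.
have := Rabs_triang (F t s - F t0 u) (F t0 u - F t0 s).
rewrite (Rabs_minus_sym (F t0 u)) => h5.
have -> : F t s - F t0 s = (F t s - F t0 u) + (F t0 u - F t0 s) by ring.
lra.
Qed.

Lemma cR_ex_RInt (f : R -> R) (a b : R) : (forall s, continuous f s) -> ex_RInt f a b.
Proof. move=> h; apply: (ex_RInt_continuous (V := R_CompleteNormedModule)) => z _; exact: h. Qed.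

Lemma c_slice (T : UniformSpace) (F : T -> R -> R) (t : T) (s : R) :
  (forall p : T * R, continuous (fun p => F p.1 p.2) p) -> continuous (F t) s.
Proof. move=> h; apply: (c_comp2 (h := F)) => //; cont. Qed.

Lemma c_slice_l (T : UniformSpace) (F : R -> T -> R) (t : T) (s : R) :
  (forall p : R * T, continuous (fun p => F p.1 p.2) p) -> continuous (F^~ t) s.
Proof. move=> h; apply: (c_comp2 (h := F)) => //; cont. Qed.

Lemma continuous_RInt_fixed (T : UniformSpace) (F : T -> R -> R) (a b : R) (t0 : T) :
  a <= b -> (forall p : T * R, continuous (fun p => F p.1 p.2) p) ->
  continuous (fun t => RInt (F t) a b) t0.
Proof.
move=> hab hF; apply/filterlim_locally => e.
(* The added 1 covers the case a = b and leaves room for the strict inequality. *)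
have he : 0 < e / (b - a + 1) by apply: Rdiv_lt_0_compat; [exact: cond_pos|lra].
have := @tube T F t0 a b (mkposreal _ he) (fun s _ => hF (t0, s)).
apply: filter_imp => t /= ht.
have hi u : ex_RInt (F u) a b by apply: cR_ex_RInt => s; exact: c_slice.
rewrite /ball /= /AbsRing_ball /= /abs /minus /plus /opp /=.
have -> : RInt (F t) a b + - RInt (F t0) a b = RInt (fun s => F t s - F t0 s) a b.
  by rewrite (RInt_minus (V := R_CompleteNormedModule)).
apply: (Rle_lt_trans _ ((b - a) * (e / (b - a + 1)))).
  apply: abs_RInt_le_const => // [|s hs]; last by apply: Rlt_le; exact: ht.
  exact: (ex_RInt_minus (V := R_NormedModule)).
have -> : (b - a) * (e / (b - a + 1)) = e - e / (b - a + 1) by field; lra.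
lra.
Qed.

(** Rescaling moves a variable endpoint into the integrand, whatever the sign of [c]; continuity in
    the endpoint then follows from the case of a fixed interval. *)
Lemma RInt_unit (f : R -> R) (c : R) :
  (forall s, continuous f s) -> RInt f 0 c = RInt (fun s => c * f (c * s)) 0 1.
Proof.
move=> hf.
have := RInt_comp_lin (V := R_CompleteNormedModule) f c 0 0 1.
rewrite Rmult_0_r Rmult_1_r !Rplus_0_r => <-; last exact: cR_ex_RInt.
by apply: RInt_ext => s _; rewrite /scal /= /mult /= Rplus_0_r.
Qed.

Lemma continuous_RInt_var (T : UniformSpace) (F : T -> R -> R) (c : T -> R) (t0 : T) :
  (forall p : T * R, continuous (fun p => F p.1 p.2) p) -> (forall t, continuous c t) ->
  continuous (fun t => RInt (F t) 0 (c t)) t0.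
Proof.
move=> hF hc.
apply: (continuous_ext (fun t => RInt (fun s => c t * F t (c t * s)) 0 1)).
  by move=> t; rewrite (RInt_unit (f := F t)) // => s; exact: c_slice.
apply: (continuous_RInt_fixed (F := fun t s => c t * F t (c t * s))); first lra.
move=> p; apply: cR_mult.
  by apply: (continuous_comp fst c); [exact: c_fst0|exact: hc].
apply: (c_comp2 (h := F)) => //; first cont.
apply: cR_mult; last cont.
by apply: (continuous_comp fst c); [cont|exact: hc].
Qed.

Lemma cont2_pt (f : R -> R -> R) (x y : R) :
  continuous (fun p : R * R => f p.1 p.2) (x, y) -> continuity_2d_pt f x y.
Proof. by move=> h; apply/continuity_2d_pt_filterlim. Qed.

Lemma derive_cont2 (f df : R -> R -> R) (t0 s : R) :
  locally t0 (fun t => forall s, is_derive (f^~ s) t (df t s)) ->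
  (forall p : R * R, continuous (fun p => df p.1 p.2) p) ->
  continuity_2d_pt (fun u v => Derive (f^~ v) u) t0 s.
Proof.
move=> [d hd] hc.
apply: (continuity_2d_pt_ext_loc df); last exact: cont2_pt.
exists d => u v hu hv; symmetry; apply: is_derive_unique; exact: hd.
Qed.

(** Differentiability in the parameter is asked only near [t0]: the functions integrated later are
    clamped at time 0 and need not be differentiable there, while [df] is continuous everywhere. *)
Lemma is_derive_RInt_fixed (f df : R -> R -> R) (a b t0 : R) :
  locally t0 (fun t => forall s, is_derive (f^~ s) t (df t s)) ->
  (forall p : R * R, continuous (fun p => df p.1 p.2) p) ->
  (forall t s, continuous (f t) s) ->
  is_derive (fun t => RInt (f t) a b) t0 (RInt (df t0) a b).
Proof.
move=> hd hc hf.
have -> : RInt (df t0) a b = RInt (fun s => Derive (f^~ s) t0) a b.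
  apply: RInt_ext => s _; symmetry; apply: is_derive_unique; exact: locally_singleton hd s.
apply: is_derive_RInt_param.
- by apply: filter_imp hd => t ht s _; exists (df t s).
- by move=> s _; exact: derive_cont2 hd hc.
- by apply: filter_forall => t; apply: cR_ex_RInt.
Qed.

Lemma is_derive_RInt_var (f df : R -> R -> R) (c : R -> R) (t0 dc : R) :
  locally t0 (fun t => forall s, is_derive (f^~ s) t (df t s)) ->
  (forall p : R * R, continuous (fun p => df p.1 p.2) p) ->
  (forall t s, continuous (f t) s) ->
  is_derive c t0 dc ->
  is_derive (fun t => RInt (f t) 0 (c t)) t0
    (f t0 (c t0) * dc + RInt (df t0) 0 (c t0)).
Proof.
move=> hd hc hf hdc.
have hex t a b : ex_RInt (f t) a b by apply: cR_ex_RInt.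
have hl : locally t0 (fun t => locally t (fun t => forall s, is_derive (f^~ s) t (df t s))).
  exact: locally_locally.
have h2 y : locally_2d (fun x' t => continuity_2d_pt (fun u v => Derive (f^~ v) u) x' t) t0 y.
  have [d h] := hl; exists d => u v hu hv; apply: derive_cont2 (h u hu) hc.
have -> : f t0 (c t0) * dc + RInt (df t0) 0 (c t0) =
  RInt (fun s => Derive (f^~ s) t0) 0 (c t0) + - f t0 0 * 0 + f t0 (c t0) * dc.
  have -> : RInt (df t0) 0 (c t0) = RInt (fun s => Derive (f^~ s) t0) 0 (c t0).
    apply: RInt_ext => s _; symmetry; apply: is_derive_unique; exact: locally_singleton hd s.
  ring.
apply: (is_derive_RInt_param_bound_comp f (fun _ => 0) c t0 0 dc) => //.
- by apply: filter_forall => t.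
- by exists (mkposreal 1 Rlt_0_1); apply: filter_forall => t.
- by exists (mkposreal 1 Rlt_0_1); apply: filter_forall => t.
- exact: is_derive_const.
- exists (mkposreal 1 Rlt_0_1); apply: filter_imp hd => t ht s _; by exists (df t s).
- by move=> s _; exact: derive_cont2 hd hc.
- by apply/continuity_pt_filterlim; exact: hf.
- by apply/continuity_pt_filterlim; exact: hf.
Qed.

Lemma is_derive_RInt_upper (f : R -> R) (t0 : R) :
  (forall s, continuous f s) -> is_derive (fun t => RInt f 0 t) t0 (f t0).
Proof.
move=> hf; apply: (is_derive_RInt (V := R_NormedModule) f _ 0) => //.
apply: filter_forall => t; apply: RInt_correct; exact: cR_ex_RInt.
Qed.

Lemma RInt_derive (f df : R -> R) (a b : R) :
  (forall s, is_derive f s (df s)) -> (forall s, continuous df s) ->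
  RInt df a b = f b - f a.
Proof.
move=> h hc; apply: is_RInt_unique.
by apply: (is_RInt_derive f df) => s _; [exact: h|exact: hc].
Qed.

Lemma cR_RInt_plus (f g : R -> R) (a b : R) :
  (forall s, continuous f s) -> (forall s, continuous g s) ->
  RInt (fun s => f s + g s) a b = RInt f a b + RInt g a b.
Proof. by move=> hf hg; apply: (RInt_plus (V := R_CompleteNormedModule)); apply: cR_ex_RInt. Qed.

Lemma cR_RInt_minus (f g : R -> R) (a b : R) :
  (forall s, continuous f s) -> (forall s, continuous g s) ->
  RInt (fun s => f s - g s) a b = RInt f a b - RInt g a b.
Proof. by move=> hf hg; apply: (RInt_minus (V := R_CompleteNormedModule)); apply: cR_ex_RInt. Qed.

Lemma cR_RInt_scal (f : R -> R) (c a b : R) :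
  (forall s, continuous f s) -> RInt (fun s => c * f s) a b = c * RInt f a b.
Proof. by move=> hf; apply: (RInt_scal (V := R_CompleteNormedModule)); apply: cR_ex_RInt. Qed.

Lemma cR_RInt_ext (f g : R -> R) (a b : R) :
  (forall s : R, Rmin a b < s < Rmax a b -> f s = g s :> R) -> RInt f a b = RInt g a b.
Proof. by move=> h; apply: RInt_ext. Qed.

(** * Differentiation rules *)

Lemma RplusA : associative Rplus. Proof. by move=> x y z; ring. Qed.
Lemma RplusC : commutative Rplus. Proof. by move=> x y; ring. Qed.
Lemma Rplus0 : left_id 0 Rplus. Proof. by move=> x; ring. Qed.
HB.instance Definition _ := Monoid.isComLaw.Build R 0 Rplus RplusA RplusC Rplus0.

Notation "\rsum_ ( i < n ) F" := (\big[Rplus/0]_(i < n) F)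
  (at level 41, F at level 41, i, n at level 50).

Lemma dR_eq (f : R -> R) (x l l' : R) : is_derive f x l -> l = l' -> is_derive f x l'.
Proof. by move=> h <-. Qed.

Lemma dR_ext (f g : R -> R) (x l : R) : (forall t, f t = g t) -> is_derive f x l -> is_derive g x l.
Proof. by move=> h; apply: is_derive_ext. Qed.

Lemma is_derive_unique_eq (f : R -> R) (x l l' : R) : is_derive f x l -> is_derive f x l' -> l = l'.
Proof. by move=> /is_derive_unique <- /is_derive_unique. Qed.

Lemma dR_const (c x : R) : is_derive (fun _ : R => c) x 0.
Proof. exact: (is_derive_const (V := R_NormedModule)). Qed.

Lemma dR_id (x : R) : is_derive (fun y : R => y) x 1.
Proof. exact: is_derive_id. Qed.

Lemma dR_plus (f g : R -> R) (x a b : R) :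
  is_derive f x a -> is_derive g x b -> is_derive (fun y => f y + g y) x (a + b).
Proof. move=> hf hg; exact: (is_derive_plus (V := R_NormedModule) f g). Qed.

Lemma dR_minus (f g : R -> R) (x a b : R) :
  is_derive f x a -> is_derive g x b -> is_derive (fun y => f y - g y) x (a - b).
Proof. move=> hf hg; exact: (is_derive_minus (V := R_NormedModule) f g). Qed.

Lemma dR_opp (f : R -> R) (x a : R) :
  is_derive f x a -> is_derive (fun y => - f y) x (- a).
Proof. move=> hf; exact: (is_derive_opp (V := R_NormedModule) f). Qed.

Lemma dR_mult (f g : R -> R) (x a b : R) :
  is_derive f x a -> is_derive g x b -> is_derive (fun y => f y * g y) x (a * g x + f x * b).
Proof. move=> hf hg; apply: (is_derive_mult f g) => // n m; exact: Rmult_comm. Qed.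

Lemma dR_scal (f : R -> R) (c x a : R) :
  is_derive f x a -> is_derive (fun y => c * f y) x (c * a).
Proof. move=> h; apply: dR_eq (dR_mult (dR_const c x) h) _; ring. Qed.

Lemma dR_comp (f g : R -> R) (x a b : R) :
  is_derive f (g x) a -> is_derive g x b -> is_derive (fun y => f (g y)) x (a * b).
Proof.
by move=> hf hg; apply: dR_eq (is_derive_comp f g x a b hf hg) _; rewrite /scal /= /mult /= Rmult_comm.
Qed.

Lemma dR_pow (f : R -> R) (k : nat) (x a : R) :
  is_derive f x a -> is_derive (fun y => f y ^ k) x (INR k * a * f x ^ k.-1).
Proof. exact: is_derive_pow. Qed.

Lemma dR_big (I : finType) (f : I -> R -> R) (df : I -> R) (x : R) :
  (forall i, is_derive (f i) x (df i)) ->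
  is_derive (fun y => \big[Rplus/0]_(i : I) f i y) x (\big[Rplus/0]_(i : I) df i).
Proof.
move=> h; elim: (index_enum I) => [|i s IH].
  rewrite big_nil; apply: (is_derive_ext (fun _ => 0)); last exact: dR_const.
  by move=> y; rewrite big_nil.
rewrite big_cons; apply: (is_derive_ext (fun y => f i y + \big[Rplus/0]_(j <- s) f j y)).
  by move=> y; rewrite big_cons.
exact: dR_plus.
Qed.

Lemma dR_cont (f : R -> R) (x a : R) : is_derive f x a -> continuous f x.
Proof. by move=> h; apply: ex_derive_continuous; exists a. Qed.

Lemma dR_sin (x : R) : is_derive sin x (cos x). Proof. exact: is_derive_sin. Qed.
Lemma dR_cos (x : R) : is_derive cos x (- sin x). Proof. exact: is_derive_cos. Qed.

Lemma big_scal (I : finType) (c : R) (f : I -> R) :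
  c * \big[Rplus/0]_(i : I) f i = \big[Rplus/0]_(i : I) (c * f i).
Proof.
elim: (index_enum I) => [|i s IH]; first by rewrite !big_nil; ring.
by rewrite !big_cons -IH; ring.
Qed.

(** The hypotheses are asymmetric: a continuous partial derivative in the first variable, a mere
    derivative at one point in the second. This lets the second slot hold a function known only to
    be differentiable at that point. *)
Lemma dR_comp2 (F dF : R -> R -> R) (f g : R -> R) (x df dg d2 : R) :
  (forall u v, is_derive (F^~ v) u (dF u v)) ->
  continuous (fun u : R * R => dF u.1 u.2) (f x, g x) ->
  is_derive (F (f x)) (g x) d2 ->
  is_derive f x df -> is_derive g x dg ->
  is_derive (fun y => F (f y) (g y)) x (df * dF (f x) (g x) + dg * d2).
Proof.
move=> hF hc h2 hf hg.
pose lh (u v : R) : R := u * dF (f x) (g x) + v * d2.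
have h : filterdiff (fun u : R * R => F u.1 u.2) (locally (f x, g x)) (fun u : R * R => lh u.1 u.2).
  apply: (is_derive_filterdiff F _ _ dF d2) => //.
  by apply: filter_forall => -[u v]; exact: hF.
have := filterdiff_comp'_2 (K := R_AbsRing) (T := R_NormedModule) (U := R_NormedModule)
  (V := R_NormedModule) (W := R_NormedModule) f g F x _ _ lh hf hg h.
move=> H; apply: (filterdiff_ext_lin _ _ _ H) => y.
rewrite /lh /plus /scal /= /mult /=; ring.
Qed.

(** * Chain rule along a curve *)

Lemma shift0 (n : nat) (x : 'I_n -> R) (i : 'I_n) : shift x i 0 = x.
Proof. by apply: functional_extensionality => j; rewrite /shift; case: eqP => //; rewrite Rplus_0_r. Qed.

Lemma shift_shift (n : nat) (x : 'I_n -> R) (i : 'I_n) (h k : R) :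
  shift (shift x i h) i k = shift x i (h + k).
Proof.
by apply: functional_extensionality => j; rewrite /shift; case: eqP => //; rewrite Rplus_assoc.
Qed.

Lemma shiftC (n : nat) (x : 'I_n -> R) (i j : 'I_n) (h k : R) :
  shift (shift x i h) j k = shift (shift x j k) i h.
Proof.
apply: functional_extensionality => l; rewrite /shift.
by case: eqP => [->|_]; case: eqP => [->|_] //; ring.
Qed.

Lemma is_derive_shift (n : nat) (g : ('I_n -> R) -> R) (i : 'I_n) (dg : ('I_n -> R) -> R)
    (x : 'I_n -> R) (h : R) :
  (forall x, is_derive (fun h => g (shift x i h)) 0 (dg x)) ->
  is_derive (fun h => g (shift x i h)) h (dg (shift x i h)).
Proof.
move=> hd.
apply: (is_derive_ext (fun k => g (shift (shift x i h) i (k - h)))).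
  by move=> k; rewrite shift_shift; congr (g (shift _ _ _)); ring.
apply: dR_eq; last exact: Rmult_1_r.
apply: (dR_comp (f := fun k => g (shift (shift x i h) i k)) (g := fun k => k - h)).
  by rewrite Rminus_diag; exact: hd.
apply: dR_eq (dR_minus (dR_id h) (dR_const h h)) _; ring.
Qed.

Lemma chain_curve (n : nat) (g : ('I_n -> R) -> R) (dg : 'I_n -> ('I_n -> R) -> R)
    (z : R -> 'I_n -> R) (dz : 'I_n -> R) (t0 : R) :
  (forall i x, is_derive (fun h => g (shift x i h)) 0 (dg i x)) ->
  (forall i x, continuous (dg i) x) ->
  (forall i, is_derive (fun t => z t i) t0 (dz i)) ->
  is_derive (fun t => g (z t)) t0 (\rsum_(i < n) (dz i * dg i (z t0))).
Proof.
move=> hg hc hz.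
(* Replace the coordinates of [z t0] by those of [z t] one at a time. *)
pose hyb k t : 'I_n -> R := fun i => if (i < k)%N then z t i else z t0 i.
have hyb0 t : hyb 0%N t = z t0 by exact: functional_extensionality.
have hybt k : hyb k t0 = z t0 by apply: functional_extensionality => i; rewrite /hyb; case: ifP.
have main : forall k, (k <= n)%N ->
    is_derive (fun t => g (hyb k t)) t0
      (\big[Rplus/0]_(i < n | (i < k)%N) (dz i * dg i (z t0))).
  elim=> [_|k IH hk].
    rewrite big_pred0 //; apply: (is_derive_ext (fun _ => g (z t0))); last exact: dR_const.
    by move=> t; rewrite hyb0.
  pose i0 := Ordinal hk.
  have hS t : hyb k.+1 t = shift (hyb k t) i0 (z t i0 - z t0 i0).
    apply: functional_extensionality => j; rewrite /shift /hyb ltnS -val_eqE /= leq_eqVlt.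
    case: eqP => [e|_] //=.
    have -> : j = i0 by apply: val_inj.
    by rewrite ltnn /=; ring.
  rewrite (bigD1 i0) //=.
  rewrite (eq_bigl (fun i : 'I_n => (i < k)%N)); last first.
    by move=> i; rewrite ltnS -val_eqE /= ltn_neqAle andbC.
  (* The displacement of coordinate [i0] is the first argument, with its continuous partial
     derivative; the second argument moves the coordinates before [i0], where the induction
     hypothesis gives the derivative at [t0] alone. *)
  pose F h t := g (shift (hyb k t) i0 h).
  apply: (is_derive_ext (fun t => F (z t i0 - z t0 i0) t)); first by move=> t; rewrite hS.
  have hz0 : is_derive (fun t => z t i0 - z t0 i0) t0 (dz i0).
    apply: dR_eq (dR_minus (hz i0) (dR_const _ _)) _; ring.
  apply: dR_eq.
    apply: (dR_comp2 (F := F) (dF := fun h t => dg i0 (shift (hyb k t) i0 h)) _ _ _ hz0 (dR_id t0)).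
    - by move=> h t; exact: is_derive_shift.
    - apply: (continuous_comp (fun u : R * R => shift (hyb k u.2) i0 u.1) (dg i0)); last exact: hc.
      apply: (c_shift (f := fun u : R * R => hyb k u.2) (g := fst)); last exact: continuous_fst.
      apply: c_coords => i; rewrite /hyb; case: (i < k)%N; last exact: cR_const.
      apply: (continuous_comp snd (fun t => z t i)); first exact: continuous_snd.
      exact: dR_cont (hz i).
    - rewrite /= Rminus_diag.
      apply: (is_derive_ext (fun t => g (hyb k t))); last exact: IH (ltnW hk).
      by move=> t; rewrite /F shift0.
  by rewrite /= Rminus_diag hybt shift0 Rmult_1_l.
have := main n (leqnn n).
rewrite (eq_bigl xpredT) => [H|i]; last exact: ltn_ord.
apply: is_derive_ext H => t; congr g; apply: functional_extensionality => i.
by rewrite /hyb ltn_ord.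
Qed.

(** * Integration over the unit sphere *)

Notation usi := unit_sphere_int.

Lemma vcons_0 (m : nat) (a : R) (v : 'I_m -> R) : vcons a v ord0 = a.
Proof. by rewrite /vcons unlift_none. Qed.

Lemma vcons_lift (m : nat) (a : R) (v : 'I_m -> R) (j : 'I_m) : vcons a v (lift ord0 j) = v j.
Proof. by rewrite /vcons liftK. Qed.

Lemma vcons_eqP (m : nat) (a : R) (v : 'I_m -> R) (w : 'I_m.+1 -> R) :
  w ord0 = a -> (forall j, w (lift ord0 j) = v j) -> w = vcons a v.
Proof.
move=> h0 h; apply: functional_extensionality => i; rewrite /vcons.
by case: unliftP => [j ->|->].
Qed.

Lemma scale_vcons (m : nat) (r a : R) (v : 'I_m -> R) :
  (fun i => r * vcons a v i) = vcons (r * a) (fun j => r * v j).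
Proof. by apply: vcons_eqP => [|j]; rewrite ?vcons_0 ?vcons_lift. Qed.

Lemma shift_vcons_lift (m : nat) (a : R) (v : 'I_m -> R) (j : 'I_m) (h : R) :
  shift (vcons a v) (lift ord0 j) h = vcons a (shift v j h).
Proof.
apply: vcons_eqP => [|l]; rewrite /shift ?vcons_0 ?vcons_lift.
  by rewrite -val_eqE.
by rewrite (inj_eq lift_inj).
Qed.

Lemma c_vcons (T : UniformSpace) (m : nat) (a : T -> R) (v : T -> 'I_m -> R) (x : T) :
  continuous a x -> continuous (v : T -> ('I_m -> R)) x ->
  continuous ((fun y => vcons (a y) (v y)) : T -> ('I_m.+1 -> R)) x.
Proof.
move=> ha hv; apply: c_coords => i; rewrite /vcons; case: (unlift ord0 i) => [j|] //.
exact: c_coord.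
Qed.

Lemma c_polar (T : UniformSpace) (m : nat) (th : T -> R) (w : T -> 'I_m -> R) (x : T) :
  continuous th x -> continuous (w : T -> ('I_m -> R)) x ->
  continuous ((fun y => vcons (cos (th y)) (fun j => sin (th y) * w y j)) : T -> ('I_m.+1 -> R)) x.
Proof.
move=> ht hw; apply: c_vcons; first by cont.
by apply: c_coords => j; cont; exact: c_coord.
Qed.

Lemma usi_SS (m : nat) (g : ('I_m.+2 -> R) -> R) :
  usi g = RInt (fun th => sin th ^ m *
     usi (fun w : 'I_m.+1 -> R => g (vcons (cos th) (fun j => sin th * w j)))) 0 PI.
Proof. by []. Qed.

(** The induction quantifies over the parameter space, since the polar angle joins the parameters: T
    becomes T x R. *)
Lemma usi_continuous (n : nat) (T : UniformSpace) (F : T -> ('I_n -> R) -> R) (t : T) :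
  (forall p : T * ('I_n -> R), continuous (fun p => F p.1 p.2) p) ->
  continuous (fun t => usi (F t)) t.
Proof.
elim: n T F t => [|[|n] IH] T F t hF; first exact: cR_const.
  by apply: cR_plus; apply: (c_comp2 (h := F)) => //; [cont|cont].
apply: (continuous_RInt_fixed (F := fun t th => sin th ^ n * _)); first by have := PI_RGT_0; lra.
move=> p; apply: cR_mult; first cont.
apply: (IH (prod_UniformSpace T R_UniformSpace)
  (fun q w => F q.1 (vcons (cos q.2) (fun j => sin q.2 * w j)))) => q.
apply: (c_comp2 (h := F)) => //; first cont.
by apply: c_polar; cont.
Qed.

Lemma usi_slice_continuous (n : nat) (g : ('I_n.+1 -> R) -> R) (t : R) :
  (forall x, continuous g x) ->
  continuous (fun th => usi (fun w : 'I_n -> R => g (vcons (cos th) (fun j => sin th * w j)))) t.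
Proof.
move=> hg; apply: (usi_continuous (F := fun th w => g (vcons (cos th) (fun j => sin th * w j)))).
move=> p; apply: (continuous_comp (fun p : R * ('I_n -> R) => vcons _ _) g); last exact: hg.
by apply: c_polar; cont.
Qed.

Lemma usi_integrand_continuous (n : nat) (g : ('I_n.+2 -> R) -> R) (t : R) :
  (forall x, continuous g x) ->
  continuous (fun th => sin th ^ n *
    usi (fun w : 'I_n.+1 -> R => g (vcons (cos th) (fun j => sin th * w j)))) t.
Proof. by move=> hg; apply: cR_mult; [cont|exact: usi_slice_continuous]. Qed.

Lemma continuous_polar_slice (n : nat) (g : ('I_n.+1 -> R) -> R) (th : R) :
  (forall x, continuous g x) ->
  forall w : 'I_n -> R, continuous (fun w : 'I_n -> R => g (vcons (cos th) (fun j => sin th * w j))) w.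
Proof.
move=> hg w; apply: (continuous_comp (fun w : 'I_n -> R => vcons _ _) g); last exact: hg.
by apply: c_polar; cont.
Qed.

Lemma usi_plus (n : nat) (f g : ('I_n -> R) -> R) :
  (forall x, continuous f x) -> (forall x, continuous g x) ->
  usi (fun w => f w + g w) = usi f + usi g.
Proof.
elim: n f g => [|[|n] IH] f g hf hg; first by rewrite /= Rplus_0_r.
  rewrite /=; ring.
rewrite !usi_SS -cR_RInt_plus; try by move=> s; apply: usi_integrand_continuous.
apply: cR_RInt_ext => th _; rewrite IH; try exact: continuous_polar_slice.
ring.
Qed.

Lemma usi_scal (n : nat) (c : R) (f : ('I_n -> R) -> R) :
  (forall x, continuous f x) -> usi (fun w => c * f w) = c * usi f.
Proof.
elim: n f => [|[|n] IH] f hf; first by rewrite /= Rmult_0_r.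
  rewrite /=; ring.
rewrite !usi_SS -cR_RInt_scal; last by move=> s; apply: usi_integrand_continuous.
apply: cR_RInt_ext => th _; rewrite IH; last exact: continuous_polar_slice.
ring.
Qed.

Lemma usi_1_gt0 (n : nat) : 0 < usi (fun _ : 'I_n.+1 -> R => 1).
Proof.
elim: n => [|n IH]; first by rewrite /=; lra.
rewrite usi_SS; apply: RInt_gt_0; first exact: PI_RGT_0.
  by move=> th hth; apply: Rmult_lt_0_compat => //; apply: pow_lt; apply: sin_gt_0; lra.
by move=> th _; cont.
Qed.

Lemma is_derive_usi (n : nat) (f df : R -> ('I_n -> R) -> R) (t0 : R) :
  locally t0 (fun t => forall w, is_derive (f^~ w) t (df t w)) ->
  (forall p : R * ('I_n -> R), continuous (fun p => df p.1 p.2) p) ->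
  (forall t w, continuous (f t) w) ->
  is_derive (fun t => usi (f t)) t0 (usi (df t0)).
Proof.
elim: n f df t0 => [|[|n] IH] f df t0 hd hc hf; first exact: dR_const.
  by have h := locally_singleton _ _ hd; apply: dR_plus; apply: h.
apply: (is_derive_RInt_fixed
  (f := fun t th => sin th ^ n * usi (fun w : 'I_n.+1 -> R => f t (vcons (cos th) (fun j => sin th * w j))))
  (df := fun t th => sin th ^ n * usi (fun w : 'I_n.+1 -> R => df t (vcons (cos th) (fun j => sin th * w j))))).
- apply: filter_imp (locally_locally _ _ hd) => t ht th; apply: dR_scal.
  apply: (IH (fun t w => f t (vcons (cos th) (fun j => sin th * w j)))
             (fun t w => df t (vcons (cos th) (fun j => sin th * w j)))).
  + by apply: filter_imp ht => u hu w; exact: hu.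
  + move=> p; apply: (c_comp2 (h := df)) => //; first cont.
    by apply: c_polar; cont.
  + by move=> u; exact: continuous_polar_slice.
- move=> p; apply: cR_mult; first cont.
  apply: (usi_continuous (T := prod_UniformSpace R_UniformSpace R_UniformSpace)
    (F := fun q w => df q.1 (vcons (cos q.2) (fun j => sin q.2 * w j)))) => q.
  apply: (c_comp2 (h := df)) => //; first cont.
  by apply: c_polar; cont.
by move=> t s; exact: usi_integrand_continuous.
Qed.

(** * Darboux's equation *)

Lemma sum_polar (m : nat) (a b : R) (w : 'I_m -> R) (F : 'I_m.+1 -> R) :
  \rsum_(i < m.+1) (vcons a (fun j => b * w j) i * F i)
  = a * F ord0 + b * \rsum_(j < m) (w j * F (lift ord0 j)).
Proof.
rewrite big_ord_recl vcons_0 big_scal; congr (_ + _).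
by apply: eq_bigr => j _; rewrite vcons_lift; ring.
Qed.

Lemma usi_lin2 (n : nat) (a b : R) (f g : ('I_n -> R) -> R) :
  (forall x, continuous f x) -> (forall x, continuous g x) ->
  usi (fun w => a * f w + b * g w) = a * usi f + b * usi g.
Proof.
move=> hf hg; rewrite (usi_plus (f := fun w => a * f w) (g := fun w => b * g w));
  try by move=> x; apply: cR_mult => //; exact: cR_const.
by rewrite !usi_scal.
Qed.

(** This lemma and the next evaluate sums over S^0 = {1, -1}, where w changes sign and w^2 = 1. The
    dimension enters through the equation [n = 0] because they are applied where [n] is the variable
    of an induction. *)
Lemma usi_dim1_odd (n : nat) (F : 'I_n.+1 -> ('I_n.+1 -> R) -> R) :
  n = 0%N -> (forall j, F j (fun _ => 1) = F j (fun _ => -1)) ->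
  usi (fun w => \rsum_(j < n.+1) (w j * F j w)) = 0.
Proof. by move=> n0; subst n => h; rewrite /= !big_ord1 h; ring. Qed.

Lemma usi_dim1_quadratic (n : nat) (F : 'I_n.+1 -> 'I_n.+1 -> ('I_n.+1 -> R) -> R) :
  n = 0%N ->
  usi (fun w => \rsum_(j < n.+1) (w j * \rsum_(l < n.+1) (w l * F j l w)))
  = usi (fun w => \rsum_(j < n.+1) F j j w).
Proof. by move=> n0; subst n; rewrite /= !big_ord1; ring. Qed.

(** This is the divergence theorem on the sphere of radius r for an arbitrary C^1 field [dg] with
    Jacobian [d2]: the tangential divergence, trace minus normal part, integrates to n / r times the
    normal component. The identity is multiplied by r, so r = 0 is included. *)
Lemma darboux_sphere (n : nat) (dg : 'I_n.+1 -> ('I_n.+1 -> R) -> R)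
    (d2 : 'I_n.+1 -> 'I_n.+1 -> ('I_n.+1 -> R) -> R) (r : R) :
  (forall i x, continuous (dg i) x) -> (forall i j x, continuous (d2 i j) x) ->
  (forall i j x, is_derive (fun h => dg i (shift x j h)) 0 (d2 i j x)) ->
  r * usi (fun w => \rsum_(i < n.+1) (w i * \rsum_(j < n.+1) (w j * d2 i j (fun l => r * w l))))
  + INR n * usi (fun w => \rsum_(i < n.+1) (w i * dg i (fun l => r * w l)))
  = r * usi (fun w => \rsum_(i < n.+1) d2 i i (fun l => r * w l)).
Proof.
elim: n dg d2 r => [|n IH] dg d2 r c1 c2 hd.
  by rewrite /= !big_ord1; ring.
pose z th (w : 'I_n.+1 -> R) : 'I_n.+2 -> R :=
  fun i => r * vcons (cos th) (fun j => sin th * w j) i.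
have cz (T : UniformSpace) (th : T -> R) (w : T -> 'I_n.+1 -> R) (x : T) :
    continuous th x -> continuous (w : T -> ('I_n.+1 -> R)) x ->
    continuous ((fun y => z (th y) (w y)) : T -> ('I_n.+2 -> R)) x.
  move=> ht hw; apply: c_coords => i; apply: cR_mult; first exact: cR_const.
  by apply: (c_coord (f := fun y => vcons (cos (th y)) (fun j => sin (th y) * w y j))); exact: c_polar.
have cg (T : UniformSpace) (g : ('I_n.+2 -> R) -> R) (th : T -> R) (w : T -> 'I_n.+1 -> R) (x : T) :
    (forall x, continuous g x) ->
    continuous th x -> continuous (w : T -> ('I_n.+1 -> R)) x -> continuous (fun y => g (z (th y) (w y))) x.
  by move=> hg ht hw; apply: (continuous_comp (fun y => z (th y) (w y)) g) => //; exact: cz.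
have cw (T : UniformSpace) (w : T -> 'I_n.+1 -> R) (j : 'I_n.+1) (x : T) :
    continuous (w : T -> ('I_n.+1 -> R)) x -> continuous (fun y => w y j) x by exact: c_coord.
pose sl j := lift (@ord0 n.+1) j.
(* Block decomposition along the polar axis. [A] is the axis entry, [B1] and [B2] are the two mixed
   blocks contracted with w, [C] is the tail block contracted twice and [L] its trace; [A1] and [C1]
   are the axis and tail parts of the field itself. *)
pose fA1 th (w : 'I_n.+1 -> R) := dg ord0 (z th w).
pose fC1 th (w : 'I_n.+1 -> R) := \rsum_(j < n.+1) (w j * dg (sl j) (z th w)).
pose fA th (w : 'I_n.+1 -> R) := d2 ord0 ord0 (z th w).
pose fB1 th (w : 'I_n.+1 -> R) := \rsum_(j < n.+1) (w j * d2 ord0 (sl j) (z th w)).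
pose fB2 th (w : 'I_n.+1 -> R) := \rsum_(j < n.+1) (w j * d2 (sl j) ord0 (z th w)).
pose fC th (w : 'I_n.+1 -> R) :=
  \rsum_(j < n.+1) (w j * \rsum_(l < n.+1) (w l * d2 (sl j) (sl l) (z th w))).
pose fL th (w : 'I_n.+1 -> R) := \rsum_(j < n.+1) d2 (sl j) (sl j) (z th w).
have kA1 (T : UniformSpace) th w (x : T) : continuous th x -> continuous w x -> continuous (fun y => fA1 (th y) (w y)) x.
  by move=> *; exact: cg.
have kC1 (T : UniformSpace) th w (x : T) : continuous th x -> continuous w x -> continuous (fun y => fC1 (th y) (w y)) x.
  by move=> *; apply: c_big => j; apply: cR_mult; [exact: cw|exact: cg].
have kA (T : UniformSpace) th w (x : T) : continuous th x -> continuous w x -> continuous (fun y => fA (th y) (w y)) x.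
  by move=> *; exact: cg.
have kB1 (T : UniformSpace) th w (x : T) : continuous th x -> continuous w x -> continuous (fun y => fB1 (th y) (w y)) x.
  by move=> *; apply: c_big => j; apply: cR_mult; [exact: cw|exact: cg].
have kB2 (T : UniformSpace) th w (x : T) : continuous th x -> continuous w x -> continuous (fun y => fB2 (th y) (w y)) x.
  by move=> *; apply: c_big => j; apply: cR_mult; [exact: cw|exact: cg].
have kC (T : UniformSpace) th w (x : T) : continuous th x -> continuous w x -> continuous (fun y => fC (th y) (w y)) x.
  move=> *; apply: c_big => j; apply: cR_mult; first exact: cw.
  by apply: c_big => l; apply: cR_mult; [exact: cw|exact: cg].
have kL (T : UniformSpace) th w (x : T) : continuous th x -> continuous w x -> continuous (fun y => fL (th y) (w y)) x.
  by move=> *; apply: c_big => j; exact: cg.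
have slice (f : R -> ('I_n.+1 -> R) -> R) :
    (forall (T : UniformSpace) th w (x : T), continuous th x -> continuous w x -> continuous (fun y => f (th y) (w y)) x) ->
    (forall th w, continuous (f th) w) /\ (forall th, continuous (fun th => usi (f th)) th).
  move=> hf; split; first by move=> th w; apply: (hf _ (fun _ => th) id); cont.
  by move=> th; apply: usi_continuous => p; apply: hf; cont.
have [sA1 uA1] := slice _ kA1. have [sC1 uC1] := slice _ kC1. have [sA uA] := slice _ kA.
have [sB1 uB1] := slice _ kB1. have [sB2 uB2] := slice _ kB2. have [sC uC] := slice _ kC.
have [sL uL] := slice _ kL.
have dz th w i : is_derive (fun th => z th w i) th (vcons (r * - sin th) (fun j => r * cos th * w j) i).
  rewrite /z /vcons; case: (unlift ord0 i) => [j|]; last by apply: dR_scal; exact: dR_cos.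
  apply: (dR_ext (f := fun th => r * w j * sin th)); first by move=> t; ring.
  apply: dR_eq (dR_scal _ (dR_sin th)) _; ring.
have dchain i th w : is_derive (fun th => dg i (z th w)) th
    (r * - sin th * d2 i ord0 (z th w) + r * cos th * \rsum_(j < n.+1) (w j * d2 i (sl j) (z th w))).
  apply: dR_eq (chain_curve (dg := d2 i) (hd i) (c2 i) (dz th w)) _.
  by rewrite sum_polar.
have dA1 th : is_derive (fun th => usi (fA1 th)) th (r * - sin th * usi (fA th) + r * cos th * usi (fB1 th)).
  apply: dR_eq.
    apply: (is_derive_usi (f := fA1)
      (df := fun th w => r * - sin th * fA th w + r * cos th * fB1 th w)) => //.
    - by apply: filter_forall => t w; exact: dchain.
    - by move=> p; cont; [apply: kA; cont|apply: kB1; cont].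
  by rewrite usi_lin2.
have dC1 th : is_derive (fun th => usi (fC1 th)) th (r * - sin th * usi (fB2 th) + r * cos th * usi (fC th)).
  apply: dR_eq.
    apply: (is_derive_usi (f := fC1)
      (df := fun th w => r * - sin th * fB2 th w + r * cos th * fC th w)) => //.
    - apply: filter_forall => t w.
      apply: dR_eq.
        by apply: dR_big => j; apply: dR_scal; exact: dchain.
      rewrite /fB2 /fC !big_scal -big_split /=; apply: eq_bigr => j _; ring.
    - by move=> p; cont; [apply: kB2; cont|apply: kC; cont].
  by rewrite usi_lin2.
have ext th (w : 'I_n.+1 -> R) : (fun l => r * vcons (cos th) (fun j => sin th * w j) l) = z th w by [].
pose E1 th := r * (cos th * (cos th * usi (fA th) + sin th * usi (fB1 th))
   + sin th * (cos th * usi (fB2 th) + sin th * usi (fC th)))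
   + INR n.+1 * (cos th * usi (fA1 th) + sin th * usi (fC1 th)).
pose E2 th := r * (usi (fA th) + usi (fL th)).
(* In polar coordinates the two sides differ by the integral of the derivative [dT]; its primitive
   vanishes at [0] and [PI], in the case [n = 0] because [fC1] is odd in [w] there. *)
pose dT th := INR n * cos th * sin th ^ n.-1 * (- sin th * usi (fA1 th) + cos th * usi (fC1 th))
  + sin th ^ n * (- cos th * usi (fA1 th) - sin th * usi (fC1 th)
     - sin th * (r * - sin th * usi (fA th) + r * cos th * usi (fB1 th))
     + cos th * (r * - sin th * usi (fB2 th) + r * cos th * usi (fC th))).
(* The bracket is the component of the field along the meridian direction (- sin th, cos th * w). *)
have hdT th : is_derive (fun th => sin th ^ n * (- sin th * usi (fA1 th) + cos th * usi (fC1 th))) th (dT th).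
  apply: dR_eq.
    apply: dR_mult; first by apply: dR_pow; exact: dR_sin.
    apply: dR_plus; apply: dR_mult; first by apply: dR_opp; exact: dR_sin.
    - exact: dA1.
    - exact: dR_cos.
    - exact: dC1.
  rewrite /dT; ring.
have cdT th : continuous dT th.
  rewrite /dT; cont.
have C1_1 th : n = 0%N -> sin th = 0 -> usi (fC1 th) = 0.
  move=> n0 hs; have X := @usi_dim1_odd n (fun j w => dg (sl j) (z th w)) n0; apply: X => j.
  congr (dg _ _); apply: functional_extensionality => i; rewrite /z hs.
  congr (_ * vcons _ _ _); apply: functional_extensionality => l; ring.
have CL_1 th : n = 0%N -> usi (fC th) = usi (fL th).
  by move=> n0; exact: (@usi_dim1_quadratic n (fun j l w => d2 (sl j) (sl l) (z th w)) n0).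
have intT : RInt dT 0 PI = 0 :> R.
  rewrite (RInt_derive _ _ hdT) // sin_PI sin_0.
  case: (posnP n) => [n0|npos]; last by rewrite pow_i; [ring|exact/ltP].
  rewrite !C1_1 ?sin_PI ?sin_0 //; ring.
have key th : sin th ^ n * E1 th + dT th = sin th ^ n * E2 th.
  have hcs : cos th * cos th = 1 - sin th * sin th.
    have := sin2_cos2 th; rewrite /Rsqr; lra.
  (* The slice at polar angle [th] is a sphere of radius r sin th in the hyperplane whose first
     coordinate is r cos th. *)
  have IH' : r * sin th * usi (fC th) + INR n * usi (fC1 th) = r * sin th * usi (fL th).
    have := IH (fun j v => dg (sl j) (vcons (r * cos th) v))
       (fun j l v => d2 (sl j) (sl l) (vcons (r * cos th) v)) (r * sin th).
    have e (w : 'I_n.+1 -> R) : vcons (r * cos th) (fun l => r * sin th * w l) = z th w.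
      rewrite /z scale_vcons; congr vcons; apply: functional_extensionality => j; ring.
    have e1 : usi (fun w : 'I_n.+1 -> R =>
        \rsum_(i < n.+1) (w i * dg (sl i) (vcons (r * cos th) (fun l => r * sin th * w l)))) = usi (fC1 th).
      by congr usi; apply: functional_extensionality => w; rewrite /fC1 e.
    have e2 : usi (fun w : 'I_n.+1 -> R =>
        \rsum_(i < n.+1) (w i * \rsum_(j < n.+1) (w j * d2 (sl i) (sl j)
           (vcons (r * cos th) (fun l => r * sin th * w l))))) = usi (fC th).
      by congr usi; apply: functional_extensionality => w; rewrite /fC e.
    have e3 : usi (fun w : 'I_n.+1 -> R =>
        \rsum_(i < n.+1) d2 (sl i) (sl i) (vcons (r * cos th) (fun l => r * sin th * w l))) = usi (fL th).
      by congr usi; apply: functional_extensionality => w; rewrite /fL e.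
    rewrite e1 e2 e3; apply.
    - move=> i x; apply: (continuous_comp (fun v => vcons (r * cos th) v) (dg (sl i))); last exact: c1.
      by apply: c_vcons; cont.
    - move=> i j x; apply: (continuous_comp (fun v => vcons (r * cos th) v) (d2 (sl i) (sl j))); last exact: c2.
      by apply: c_vcons; cont.
    - move=> i j x; apply: (dR_ext (f := fun h => dg (sl i) (shift (vcons (r * cos th) x) (sl j) h))).
        by move=> h; rewrite shift_vcons_lift.
      exact: hd.
  (* For n = 0 the truncated exponent [n.-1] is 0 and the relation between the two powers of the
     sine fails; there the coefficient [INR n] vanishes instead, and w^2 = 1 identifies [fC] with
     [fL]. *)
  have hS : (INR n = 0 /\ usi (fC th) = usi (fL th)) \/ sin th ^ n = sin th * sin th ^ n.-1.
    case: (posnP n) => [n0|npos]; first by left; split; [rewrite n0|exact: CL_1].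
    by right; rewrite -[in LHS](prednK npos).
  rewrite /E1 /E2 /dT S_INR.
  move: hcs IH' hS; move: (usi (fA th)) (usi (fA1 th)) (usi (fB1 th)) (usi (fB2 th)) (usi (fC th)).
  move: (usi (fC1 th)) (usi (fL th)) (sin th) (cos th) (sin th ^ n) (sin th ^ n.-1) (INR n).
  move=> C1 L s c S S' N A A1 B1 B2 C hcs IH' [[-> ->]|->].
    have -> : c * (r * - s * B2 + r * c * L) = c * (r * - s * B2) + (c * c) * r * L by ring.
    rewrite hcs.
    have -> : c * (c * A + s * B1) = (c * c) * A + c * s * B1 by ring.
    by rewrite hcs; ring.
  have -> : N * c * S' * (- s * A1 + c * C1) = - N * c * S' * s * A1 + S' * (c * c) * (N * C1) by ring.
  have hNC : N * C1 = r * s * L - r * s * C by lra.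
  have -> : (N + 1) * (c * A1 + s * C1) = (N + 1) * c * A1 + s * (N * C1) + s * C1 by ring.
  have -> : c * (r * - s * B2 + r * c * C) = c * (r * - s * B2) + (c * c) * r * C by ring.
  have -> : c * (c * A + s * B1) = (c * c) * A + c * s * B1 by ring.
  by rewrite hNC hcs; ring.
have cE1 th : continuous E1 th.
  rewrite /E1; cont.
have cE2 th : continuous E2 th.
  rewrite /E2; cont.
have cs (f : R -> R) th : (forall th, continuous f th) -> continuous (fun th => sin th ^ n * f th) th.
  by move=> hf; cont.
have usi_z (f : ('I_n.+2 -> R) -> R) :
    usi f = RInt (fun th => sin th ^ n * usi (fun w : 'I_n.+1 -> R => f (vcons (cos th) (fun j => sin th * w j)))) 0 PI.
  by rewrite usi_SS.
have i1 : usi (fun w : 'I_n.+2 -> R => \rsum_(i < n.+2) (w i * \rsum_(j < n.+2) (w j * d2 i j (fun l => r * w l))))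
  = RInt (fun th => sin th ^ n * (cos th * (cos th * usi (fA th) + sin th * usi (fB1 th))
   + sin th * (cos th * usi (fB2 th) + sin th * usi (fC th)))) 0 PI.
  rewrite usi_z; apply: cR_RInt_ext => th _; congr (_ * _).
  rewrite -!usi_lin2 //; last 2 first.
  - by move=> w; cont.
  - by move=> w; cont.
  congr usi; apply: functional_extensionality => w.
  rewrite sum_polar sum_polar ext; congr (_ + _ * _).
  rewrite (eq_bigr (fun j => cos th * (w j * d2 (sl j) ord0 (z th w))
     + sin th * (w j * \rsum_(l < n.+1) (w l * d2 (sl j) (sl l) (z th w))))); last first.
    by move=> j _; rewrite sum_polar /sl; ring.
  by rewrite big_split /= -!big_scal.
have i2 : usi (fun w : 'I_n.+2 -> R => \rsum_(i < n.+2) (w i * dg i (fun l => r * w l)))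
  = RInt (fun th => sin th ^ n * (cos th * usi (fA1 th) + sin th * usi (fC1 th))) 0 PI.
  rewrite usi_z; apply: cR_RInt_ext => th _; congr (_ * _).
  rewrite -!usi_lin2 //; congr usi; apply: functional_extensionality => w.
  by rewrite sum_polar ext.
have i3 : usi (fun w : 'I_n.+2 -> R => \rsum_(i < n.+2) d2 i i (fun l => r * w l))
  = RInt (fun th => sin th ^ n * (usi (fA th) + usi (fL th))) 0 PI.
  rewrite usi_z; apply: cR_RInt_ext => th _; congr (_ * _).
  rewrite -usi_plus //; congr usi; apply: functional_extensionality => w.
  by rewrite big_ord_recl ext.
rewrite i1 i2 i3.
have -> : r * RInt (fun th => sin th ^ n * (usi (fA th) + usi (fL th))) 0 PI
    = RInt (fun th => sin th ^ n * E2 th) 0 PI.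
  rewrite -cR_RInt_scal; last by move=> th; cont.
  by apply: cR_RInt_ext => th _; rewrite /E2; ring.
pose F1 th := sin th ^ n * (cos th * (cos th * usi (fA th) + sin th * usi (fB1 th))
   + sin th * (cos th * usi (fB2 th) + sin th * usi (fC th))).
pose F2 th := sin th ^ n * (cos th * usi (fA1 th) + sin th * usi (fC1 th)).
have cF1 th : continuous F1 th by rewrite /F1; cont.
have cF2 th : continuous F2 th by rewrite /F2; cont.
rewrite -/F1 -/F2 -(cR_RInt_scal r) // -(cR_RInt_scal (INR n.+1)) //.
rewrite -(cR_RInt_plus (f := fun th => r * F1 th) (g := fun th => INR n.+1 * F2 th));
  try by move=> th; cont.
transitivity (RInt (fun th => r * F1 th + INR n.+1 * F2 th) 0 PI + RInt dT 0 PI).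
  by rewrite intT Rplus_0_r.
rewrite -cR_RInt_plus //; last by move=> th; cont.
by apply: cR_RInt_ext => th _; rewrite -key /E1 /F1 /F2; ring.
Qed.

(** * Functions with continuous partial derivatives, depending on a parameter *)

(** One mixed derivative is given and the other is obtained: [f t h - f t 0] is the integral of
    [fh], differentiation under the integral makes [ft t0 h - ft t0 0] the integral of [fht], and
    the upper limit can then be differentiated. *)
Lemma schwarz (f ft fh fht : R -> R -> R) (t0 h0 : R) :
  locally t0 (fun t => forall h, is_derive (f^~ h) t (ft t h)) ->
  locally t0 (fun t => forall h, is_derive (f t) h (fh t h)) ->
  locally t0 (fun t => forall h, is_derive (fh^~ h) t (fht t h)) ->
  (forall t h, continuous (fh t) h) ->
  (forall p : R * R, continuous (fun p => fht p.1 p.2) p) ->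
  is_derive (ft t0) h0 (fht t0 h0).
Proof.
move=> h1 h2 h3 hc hcc.
have key h : ft t0 h = ft t0 0 + RInt (fht t0) 0 h.
  apply: (is_derive_unique_eq (f := f^~ h) (x := t0)); first exact: locally_singleton h1 h.
  apply: (is_derive_ext_loc (fun t => f t 0 + RInt (fh t) 0 h)).
    apply: filter_imp h2 => t ht; rewrite (RInt_derive 0 h ht (hc t)).
    by rewrite /=; ring.
  apply: dR_plus; first exact: locally_singleton h1 0.
  exact: is_derive_RInt_fixed.
apply: (dR_ext (f := fun h => ft t0 0 + RInt (fht t0) 0 h)) => //.
apply: dR_eq; last exact: Rplus_0_l.
apply: dR_plus; first exact: dR_const.
by apply: is_derive_RInt_upper => s; exact: c_slice.
Qed.

Definition PD (n : nat) (i : 'I_n) (phi : ('I_n -> R) -> R) (x : 'I_n -> R) : R :=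
  Derive (fun h => phi (shift x i h)) 0.

(** A family indexed by a time [b]: only space derivatives are counted, but each is jointly
    continuous in (b, x). This is what is used of the source f(b, .). Derivatives are the canonical
    [PD], so that no witnesses have to be carried along. *)
Fixpoint Ck (n k : nat) (Phi : R -> ('I_n -> R) -> R) : Prop :=
  (forall p : R * ('I_n -> R), continuous (fun p => Phi p.1 p.2) p) /\
  match k with
  | O => True
  | S l => forall i,
      (forall b x, is_derive (fun h => Phi b (shift x i h)) 0 (PD i (Phi b) x))
      /\ Ck l (fun b => PD i (Phi b))
  end.

Notation ck k phi := (Ck k (fun _ : R => phi)).

Lemma Ck_cont (n k : nat) (Phi : R -> ('I_n -> R) -> R) :
  Ck k Phi -> forall p : R * ('I_n -> R), continuous (fun p => Phi p.1 p.2) p.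
Proof. by case: k => [|k] []. Qed.

Lemma Ck_S (n k : nat) (Phi : R -> ('I_n -> R) -> R) : Ck k.+1 Phi -> Ck k Phi.
Proof.
elim: k Phi => [|k IH] Phi [hc h]; first by split.
by split=> // i; have [h1 h2] := h i; split=> //; apply: IH.
Qed.

Lemma Ck_le (n k l : nat) (Phi : R -> ('I_n -> R) -> R) : (l <= k)%N -> Ck k Phi -> Ck l Phi.
Proof.
move=> /subnK <-; elim: (k - l)%N => [//|m IH]; rewrite addSn => h.
by apply: IH; exact: Ck_S.
Qed.

Lemma Ck_derive (n k : nat) (Phi : R -> ('I_n -> R) -> R) (i : 'I_n) (b : R) (x : 'I_n -> R) :
  Ck k.+1 Phi -> is_derive (fun h => Phi b (shift x i h)) 0 (PD i (Phi b) x).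
Proof. by case=> _ /(_ i) [h _]. Qed.

Lemma Ck_PD (n k : nat) (Phi : R -> ('I_n -> R) -> R) (i : 'I_n) :
  Ck k.+1 Phi -> Ck k (fun b => PD i (Phi b)).
Proof. by case=> _ /(_ i) [_ h]. Qed.

Lemma Ck_comp (n k : nat) (Phi : R -> ('I_n -> R) -> R) (g : R -> R) :
  (forall b, continuous g b) -> Ck k Phi -> Ck k (fun b => Phi (g b)).
Proof.
move=> hg; elim: k Phi => [|k IH] Phi [hc h]; split => //; try first [
  by move=> p; apply: (c_comp2 (h := Phi)) => //; [apply: cR_comp => //; cont|cont]].
by move=> i; have [h1 h2] := h i; split=> [b x|]; [exact: h1|exact: (IH (fun b => PD i (Phi b)))].
Qed.

Lemma Ck_slice (n k : nat) (Phi : R -> ('I_n -> R) -> R) (b : R) : Ck k Phi -> ck k (Phi b).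
Proof. by move=> h; apply: (Ck_comp (g := fun _ => b)) h => c; exact: cR_const. Qed.

Lemma PD_plus (n : nat) (i : 'I_n) (phi psi : ('I_n -> R) -> R) (x : 'I_n -> R) :
  ck 1 phi -> ck 1 psi -> PD i (fun x => phi x + psi x) x = PD i phi x + PD i psi x.
Proof.
move=> h1 h2; apply: is_derive_unique; apply: dR_plus.
  exact: (Ck_derive i 0 x h1).
exact: (Ck_derive i 0 x h2).
Qed.

Lemma PD_scal (n : nat) (i : 'I_n) (c : R) (phi : ('I_n -> R) -> R) (x : 'I_n -> R) :
  ck 1 phi -> PD i (fun x => c * phi x) x = c * PD i phi x.
Proof. move=> h1; apply: is_derive_unique; apply: dR_scal; exact: (Ck_derive i 0 x h1). Qed.

Lemma Ck_ext (n k : nat) (Phi Psi : R -> ('I_n -> R) -> R) :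
  (forall b x, Phi b x = Psi b x) -> Ck k Phi -> Ck k Psi.
Proof.
move=> h; have -> // : Phi = Psi.
by apply: functional_extensionality => b; apply: functional_extensionality.
Qed.

Lemma Ck_plus (n k : nat) (Phi Psi : R -> ('I_n -> R) -> R) :
  Ck k Phi -> Ck k Psi -> Ck k (fun b x => Phi b x + Psi b x).
Proof.
elim: k Phi Psi => [|k IH] Phi Psi h1 h2; split; try by move=> p; apply: cR_plus; [exact: (Ck_cont h1)|exact: (Ck_cont h2)].
  by [].
have e i b x : PD i (fun x => Phi b x + Psi b x) x = PD i (Phi b) x + PD i (Psi b) x.
  by apply: PD_plus; apply: Ck_slice; [exact: Ck_le h1|exact: Ck_le h2].
move=> i; split=> [b x|].
  by rewrite e; apply: dR_plus; [exact: (Ck_derive i b x h1)|exact: (Ck_derive i b x h2)].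
by apply: Ck_ext (IH _ _ (Ck_PD i h1) (Ck_PD i h2)) => b x; rewrite e.
Qed.

Lemma Ck_scal (n k : nat) (Phi : R -> ('I_n -> R) -> R) (c : R -> R) :
  (forall b, continuous c b) -> Ck k Phi -> Ck k (fun b x => c b * Phi b x).
Proof.
move=> hc; elim: k Phi => [|k IH] Phi h; split;
  try by move=> p; apply: cR_mult; [apply: cR_comp => //; cont|exact: (Ck_cont h)].
  by [].
have e i b x : PD i (fun x => c b * Phi b x) x = c b * PD i (Phi b) x.
  by apply: PD_scal; apply: Ck_slice; exact: Ck_le h.
move=> i; split=> [b x|].
  by rewrite e; apply: dR_scal; exact: (Ck_derive i b x h).
by apply: Ck_ext (IH _ (Ck_PD i h)) => b x; rewrite e.
Qed.

Lemma ck_cont (n k : nat) (phi : ('I_n -> R) -> R) (x : 'I_n -> R) : ck k phi -> continuous phi x.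
Proof.
move=> h; apply: (continuous_comp (fun x => (0, x)) (fun p : R * ('I_n -> R) => phi p.2)).
  by apply: c_pair; cont.
exact: (Ck_cont h).
Qed.

Lemma PD_comm (n : nat) (i j : 'I_n) (phi : ('I_n -> R) -> R) :
  ck 2 phi -> PD i (PD j phi) = PD j (PD i phi).
Proof.
move=> h; apply: functional_extensionality => x.
apply: is_derive_unique.
have d1 (k : 'I_n) y t : is_derive (fun t => phi (shift y k t)) t (PD k phi (shift y k t)).
  by apply: is_derive_shift => z; exact: (Ck_derive k 0 z h).
have d2 (k l : 'I_n) y t : is_derive (fun t => PD k phi (shift y l t)) t (PD l (PD k phi) (shift y l t)).
  by apply: is_derive_shift => z; exact: (Ck_derive l 0 z (Ck_PD k h)).
have := @schwarz (fun t s => phi (shift (shift x i s) j t))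
  (fun t s => PD j phi (shift (shift x i s) j t))
  (fun t s => PD i phi (shift (shift x j t) i s))
  (fun t s => PD j (PD i phi) (shift (shift x i s) j t)) 0 0.
rewrite !shift0 => H.
apply: (dR_ext (f := fun s => PD j phi (shift (shift x i s) j 0))).
  by move=> s; rewrite shift0.
apply: H.
- by apply: filter_forall => t s; exact: d1.
- apply: filter_forall => t s; apply: (dR_ext (f := fun s => phi (shift (shift x j t) i s))).
    by move=> u; rewrite shiftC.
  exact: d1.
- apply: filter_forall => t s; apply: (dR_ext (f := fun t => PD i phi (shift (shift x i s) j t))).
    by move=> u; rewrite shiftC.
  exact: d2.
- move=> t s; apply: (continuous_comp (fun s => shift (shift x j t) i s) (PD i phi)).
    by apply: c_shift; cont.
  exact: ck_cont (Ck_PD i h).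
- move=> p; apply: (continuous_comp (fun p : R * R => shift (shift x i p.2) j p.1) (PD j (PD i phi))).
    by apply: (c_shift (f := fun p : R * R => shift x i p.2)); [apply: c_shift; cont|cont].
  exact: ck_cont (Ck_PD j (Ck_PD i h)).
Qed.

(** * Spherical means and their radial derivatives *)

#[local] Arguments unit_sphere_int n _ : simpl never.

(** The direction [w] is constant during differentiation, so at x + r w this is the j-th derivative
    in r along the ray. Means over the unit sphere written in this way make sense for every real r,
    zero included. *)
Fixpoint dirD (n j : nat) (phi : ('I_n -> R) -> R) (w z : 'I_n -> R) : R :=
  match j with
  | O => phi z
  | S l => \rsum_(i < n) (w i * dirD l (PD i phi) w z)
  end.

Definition ray (n : nat) (x : 'I_n -> R) (r : R) (w : 'I_n -> R) : 'I_n -> R :=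
  fun i => x i + r * w i.

(** The [j]-th radial derivative of the spherical mean of [phi]. *)
Definition sph (n j : nat) (phi : ('I_n -> R) -> R) (r : R) (x : 'I_n -> R) : R :=
  / usi (fun _ : 'I_n -> R => 1) * usi (fun w => dirD j phi w (ray x r w)).

Lemma sphE (n j : nat) (phi : ('I_n -> R) -> R) (r : R) (x : 'I_n -> R) :
  sph j phi r x = / usi (fun _ : 'I_n -> R => 1) * usi (fun w => dirD j phi w (ray x r w)).
Proof. by []. Qed.

Definition lap (n : nat) (phi : ('I_n -> R) -> R) (x : 'I_n -> R) : R :=
  \rsum_(i < n) PD i (PD i phi) x.

Lemma c_ray (T : UniformSpace) (n : nat) (x : T -> 'I_n -> R) (r : T -> R) (w : T -> 'I_n -> R) (t : T) :
  continuous (x : T -> ('I_n -> R)) t -> continuous r t -> continuous (w : T -> ('I_n -> R)) t ->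
  continuous ((fun y => ray (x y) (r y) (w y)) : T -> ('I_n -> R)) t.
Proof.
move=> hx hr hw; apply: c_coords => i; rewrite /ray; cont; exact: c_coord.
Qed.

Lemma dirD_continuous (n j : nat) (T : UniformSpace) (Phi : R -> ('I_n -> R) -> R)
    (b : T -> R) (w z : T -> 'I_n -> R) (t : T) :
  Ck j Phi -> continuous b t -> continuous (w : T -> ('I_n -> R)) t ->
  continuous (z : T -> ('I_n -> R)) t -> continuous (fun y => dirD j (Phi (b y)) (w y) (z y)) t.
Proof.
elim: j Phi => [|j IH] Phi h hb hw hz /=.
  by apply: (c_comp2 (h := Phi)) => //; exact: Ck_cont h.
apply: c_big => i; apply: cR_mult; first exact: c_coord.
exact: (IH (fun b => PD i (Phi b)) (Ck_PD i h)).
Qed.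

Lemma dirD_plus (n j : nat) (phi psi : ('I_n -> R) -> R) (w z : 'I_n -> R) :
  ck j phi -> ck j psi -> dirD j (fun x => phi x + psi x) w z = dirD j phi w z + dirD j psi w z.
Proof.
elim: j phi psi => [//|j IH] phi psi h1 h2 /=.
rewrite -big_split /=; apply: eq_bigr => i _.
have -> : PD i (fun x => phi x + psi x) = (fun x => PD i phi x + PD i psi x).
  by apply: functional_extensionality => x; apply: PD_plus; [exact: Ck_le h1|exact: Ck_le h2].
rewrite IH; [ring|exact: (Ck_PD i h1)|exact: (Ck_PD i h2)].
Qed.

Lemma dirD_scal (n j : nat) (c : R) (phi : ('I_n -> R) -> R) (w z : 'I_n -> R) :
  ck j phi -> dirD j (fun x => c * phi x) w z = c * dirD j phi w z.
Proof.
elim: j phi => [//|j IH] phi h1 /=.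
rewrite big_scal; apply: eq_bigr => i _.
have -> : PD i (fun x => c * phi x) = (fun x => c * PD i phi x).
  by apply: functional_extensionality => x; apply: PD_scal; exact: Ck_le h1.
rewrite IH; [ring|exact: (Ck_PD i h1)].
Qed.

Lemma is_derive_dirD_ray (n j : nat) (phi : ('I_n -> R) -> R) (w x : 'I_n -> R) (r : R) :
  ck j.+1 phi -> is_derive (fun r => dirD j phi w (ray x r w)) r (dirD j.+1 phi w (ray x r w)).
Proof.
elim: j phi => [|j IH] phi h.
  apply: (chain_curve (z := fun r => ray x r w) (dg := fun i => PD i phi)).
  - by move=> i y; exact: (Ck_derive i 0 y h).
  - by move=> i y; exact: ck_cont (Ck_PD i h).
  - move=> i; rewrite /ray; apply: dR_eq.
      by apply: dR_plus; [exact: dR_const|apply: dR_mult; [exact: dR_id|exact: dR_const]].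
    by rewrite /=; ring.
by apply: dR_big => i; apply: dR_scal; exact: (IH _ (Ck_PD i h)).
Qed.

Lemma is_derive_dirD_shift (n j : nat) (phi : ('I_n -> R) -> R) (w z : 'I_n -> R) (i : 'I_n) :
  ck j.+1 phi -> is_derive (fun h => dirD j phi w (shift z i h)) 0 (dirD j (PD i phi) w z).
Proof.
elim: j phi z => [|j IH] phi z h; first exact: (Ck_derive i 0 z h).
apply: dR_big => l; apply: dR_scal; rewrite PD_comm; last exact: Ck_le h.
exact: (IH _ _ (Ck_PD l h)).
Qed.

Lemma ray_shift (n : nat) (x : 'I_n -> R) (i : 'I_n) (h r : R) (w : 'I_n -> R) :
  ray (shift x i h) r w = shift (ray x r w) i h.
Proof.
by apply: functional_extensionality => j; rewrite /ray /shift; case: eqP => _ //; ring.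
Qed.

Lemma sph_continuous (n j : nat) (T : UniformSpace) (Phi : R -> ('I_n -> R) -> R)
    (b r : T -> R) (x : T -> 'I_n -> R) (t : T) :
  Ck j Phi -> (forall t, continuous b t) -> (forall t, continuous r t) ->
  (forall t, continuous (x : T -> ('I_n -> R)) t) ->
  continuous (fun y => sph j (Phi (b y)) (r y) (x y)) t.
Proof.
move=> h hb hr hx; apply: cR_mult; first exact: cR_const.
apply: (usi_continuous (F := fun y w => dirD j (Phi (b y)) w (ray (x y) (r y) w))) => p.
have k (f : T -> R) : (forall t, continuous f t) ->
    continuous (fun p : T * ('I_n -> R) => f p.1) p.
  by move=> hf; apply: (continuous_comp fst f); [exact: c_fst0|exact: hf].
apply: dirD_continuous => //; [exact: k|cont|apply: c_ray; [|exact: k|cont]].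
by apply: (continuous_comp fst x); [exact: c_fst0|exact: hx].
Qed.

Lemma dirD_slice_continuous (n j : nat) (phi : ('I_n -> R) -> R) (r : R) (x w : 'I_n -> R) :
  ck j phi -> continuous (fun w : 'I_n -> R => dirD j phi w (ray x r w)) w.
Proof.
move=> h; apply: (dirD_continuous (Phi := fun _ => phi) (b := fun _ => 0)) => //; try by cont.
by apply: c_ray; cont.
Qed.

Lemma is_derive_sph (n j : nat) (phi : ('I_n -> R) -> R) (r : R) (x : 'I_n -> R) :
  ck j.+1 phi -> is_derive (fun r => sph j phi r x) r (sph j.+1 phi r x).
Proof.
move=> h; apply: dR_scal.
apply: (is_derive_usi (f := fun r w => dirD j phi w (ray x r w))
  (df := fun r w => dirD j.+1 phi w (ray x r w))).
- by apply: filter_forall => t w; exact: is_derive_dirD_ray.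
- move=> p; apply: (dirD_continuous (Phi := fun _ => phi) (b := fun _ => 0)) => //; try by cont.
  by apply: c_ray; cont.
- by move=> t w; apply: dirD_slice_continuous; exact: Ck_S.
Qed.

Lemma is_derive_sph_shift (n j : nat) (phi : ('I_n -> R) -> R) (r : R) (x : 'I_n -> R) (i : 'I_n) :
  ck j.+1 phi -> is_derive (fun h => sph j phi r (shift x i h)) 0 (sph j (PD i phi) r x).
Proof.
move=> h; apply: dR_scal; rewrite -[in X in is_derive _ _ X](shift0 x i).
apply: (is_derive_usi (f := fun h w => dirD j phi w (ray (shift x i h) r w))
  (df := fun h w => dirD j (PD i phi) w (ray (shift x i h) r w))).
- apply: filter_forall => t w.
  apply: (dR_ext (f := fun h => dirD j phi w (shift (ray x r w) i h))).
    by move=> u; rewrite ray_shift.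
  rewrite ray_shift; apply: (is_derive_shift (dg := dirD j (PD i phi) w)) => z.
  exact: is_derive_dirD_shift.
- move=> p; apply: (dirD_continuous (Phi := fun _ => PD i phi) (b := fun _ => 0)); try by cont.
    exact: (Ck_PD i h).
  by apply: c_ray; cont; apply: c_shift; cont.
- by move=> t w; apply: dirD_slice_continuous; exact: Ck_S.
Qed.

Lemma sph_plus (n j : nat) (phi psi : ('I_n -> R) -> R) (r : R) (x : 'I_n -> R) :
  ck j phi -> ck j psi -> sph j (fun x => phi x + psi x) r x = sph j phi r x + sph j psi r x.
Proof.
move=> h1 h2; rewrite /sph -Rmult_plus_distr_l -usi_plus; first last.
- by move=> w; exact: dirD_slice_continuous.
- by move=> w; exact: dirD_slice_continuous.
by congr (_ * usi _); apply: functional_extensionality => w; exact: dirD_plus.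
Qed.

Lemma sph_scal (n j : nat) (c : R) (phi : ('I_n -> R) -> R) (r : R) (x : 'I_n -> R) :
  ck j phi -> sph j (fun x => c * phi x) r x = c * sph j phi r x.
Proof.
move=> h1; rewrite /sph -Rmult_assoc (Rmult_comm c) Rmult_assoc -(usi_scal c); last first.
  by move=> w; exact: dirD_slice_continuous.
by congr (_ * usi _); apply: functional_extensionality => w; exact: dirD_scal.
Qed.

Lemma usi_1_neq0 (n : nat) : usi (fun _ : 'I_n.+1 -> R => 1) <> 0.
Proof. have := usi_1_gt0 n; lra. Qed.

Lemma sph_0 (n : nat) (phi : ('I_n.+1 -> R) -> R) (x : 'I_n.+1 -> R) : sph 0 phi 0 x = phi x.
Proof.
have e : (fun w : 'I_n.+1 -> R => dirD 0 phi w (ray x 0 w)) = (fun w => phi x * 1).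
  apply: functional_extensionality => w; rewrite Rmult_1_r /=; congr phi.
  by apply: functional_extensionality => i; rewrite /ray; ring.
rewrite /sph e usi_scal; last by move=> y; exact: cR_const.
by field; exact: usi_1_neq0.
Qed.

Lemma Ck_0 (n k : nat) : Ck k (fun _ (_ : 'I_n -> R) => 0).
Proof.
have e i x : PD i (fun _ : 'I_n -> R => 0) x = 0 by exact: Derive_const.
elim: k => [|k IH]; first by split=> // p; exact: cR_const.
split=> [p|i]; first exact: cR_const.
by split=> [b x|]; [rewrite e; exact: dR_const|apply: Ck_ext IH => b x; rewrite e].
Qed.

Lemma ck_lap (n k : nat) (phi : ('I_n -> R) -> R) : ck k.+2 phi -> ck k (lap phi).
Proof.
move=> h; rewrite /lap; elim: (index_enum _) => [|i s IH].
  by apply: (Ck_ext (Phi := fun _ _ => 0)) => [b x|]; [rewrite big_nil|exact: Ck_0].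
apply: (Ck_ext (Phi := fun b x => PD i (PD i phi) x + \big[Rplus/0]_(j <- s) PD j (PD j phi) x)).
  by move=> b x; rewrite big_cons.
by apply: Ck_plus => //; exact: (Ck_PD i (Ck_PD i h)).
Qed.

Lemma darboux (n : nat) (phi : ('I_n.+1 -> R) -> R) (r : R) (x : 'I_n.+1 -> R) :
  ck 2 phi -> r * sph 2 phi r x + INR n * sph 1 phi r x = r * sph 0 (lap phi) r x.
Proof.
move=> h.
have H := @darboux_sphere n (fun i v => PD i phi (fun l => x l + v l))
  (fun i j v => PD j (PD i phi) (fun l => x l + v l)) r.
rewrite /sph /lap /= /ray.
move: H; set a := usi _; set b := usi _; set c := usi _ => H.
set c1 := / _.
have -> : r * (c1 * a) + INR n * (c1 * b) = c1 * (r * a + INR n * b) by ring.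
rewrite H; first by ring.
- move=> i v; apply: (continuous_comp (fun v : 'I_n.+1 -> R => (fun l => x l + v l) : 'I_n.+1 -> R) (PD i phi)).
    by apply: c_coords => l; cont; exact: (c_coord (f := id)); cont.
  exact: ck_cont (Ck_PD i h).
- move=> i j v; apply: (continuous_comp (fun v : 'I_n.+1 -> R => (fun l => x l + v l) : 'I_n.+1 -> R) (PD j (PD i phi))).
    by apply: c_coords => l; cont; exact: (c_coord (f := id)); cont.
  exact: ck_cont (Ck_PD j (Ck_PD i h)).
move=> i j v; apply: (dR_ext (f := fun h => PD i phi (shift (fun l => x l + v l) j h))).
  move=> t; congr PD; apply: functional_extensionality => l.
  by rewrite /shift; case: eqP => _ //; ring.
exact: (Ck_derive j 0 _ (Ck_PD i h)).
Qed.

#[local] Opaque unit_sphere_int sph.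

(** * The solution operator of the free wave equation *)

(** If [m j] is the [j]-th derivative of [m 0], then [euler k m] is the family
    of derivatives of [(2 k + 3) m_0 + r m_0']. Since
    [(1/r d/dr) (r^(2k+3) m_0) = r^(2k+1) ((2 k + 3) m_0 + r m_0')], iterating it gives
    [(1/r d/dr)^k (r^(2k+1) m_0) = r * iter_euler k m 0]. *)
Definition euler (k : nat) (m : nat -> R -> R) (j : nat) (r : R) : R :=
  (2 * INR k + 3 + INR j) * m j r + r * m j.+1 r.

Fixpoint iter_euler (k : nat) (m : nat -> R -> R) : nat -> R -> R :=
  match k with
  | O => m
  | S l => iter_euler l (euler l m)
  end.

Definition jet (N : nat) (m : nat -> R -> R) : Prop :=
  forall j r, (j < N)%N -> is_derive (m j) r (m j.+1 r).

Lemma euler_jet (k N : nat) (m : nat -> R -> R) : jet N.+1 m -> jet N (euler k m).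
Proof.
move=> h j r hj; apply: dR_eq.
  apply: dR_plus; first by apply: dR_scal; apply: h; exact: leqW.
  by apply: dR_mult; [exact: dR_id|apply: h].
rewrite /euler S_INR /=; ring.
Qed.

Lemma iter_euler_jet (k N : nat) (m : nat -> R -> R) : jet (N + k) m -> jet N (iter_euler k m).
Proof.
elim: k m => [|k IH] m /=; first by rewrite addn0.
by rewrite addnS => h; apply: IH; exact: euler_jet.
Qed.

(* If [L_d = d^2/dr^2 + (d-1)/r d/dr], then
   [L_(2k+3) (2k+3 + r d/dr) = (2k+3 + r d/dr) L_(2k+5)]. *)
Lemma iter_euler_radial (k : nat) (m mL : nat -> R -> R) (r : R) :
  jet k.+2 m -> jet k mL ->
  (forall r, r * m 2%N r + (2 * INR k + 2) * m 1%N r = r * mL 0%N r) ->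
  2 * iter_euler k m 1 r + r * iter_euler k m 2 r = r * iter_euler k mL 0 r.
Proof.
elim: k m mL => [|k IH] m mL hm hL h; first by have /= := h r; lra.
apply: IH => [||s]; [exact: euler_jet|exact: euler_jet|].
have h' : s * m 3%N s + (2 * INR k + 5) * m 2%N s = mL 0%N s + s * mL 1%N s.
  have d1 : is_derive (fun s => s * m 2%N s + (2 * INR k.+1 + 2) * m 1%N s) s
      (s * m 3%N s + (2 * INR k + 5) * m 2%N s).
    apply: dR_eq.
      by apply: dR_plus; [apply: dR_mult; [exact: dR_id|exact: hm]|apply: dR_scal; exact: hm].
    rewrite S_INR /=; ring.
  apply: (is_derive_unique_eq d1).
  apply: (dR_ext (f := fun s => s * mL 0%N s)); first by move=> t; rewrite h.
  apply: dR_eq; first by apply: dR_mult; [exact: dR_id|exact: hL].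
  rewrite /=; ring.
have := h s; rewrite /euler S_INR /= => hs.
have e3 : s * (s * m 3%N s + (2 * INR k + 5) * m 2%N s) = s * (mL 0%N s + s * mL 1%N s) by rewrite h'.
have e1 : (2 * INR k + 2) * (s * m 2%N s + (2 * (INR k + 1) + 2) * m 1%N s) =
   (2 * INR k + 2) * (s * mL 0%N s) by rewrite hs.
lra.
Qed.

(** At r = 0 the operator 2 k + 3 + r d/dr reduces to its constant, and the constants multiply to
    the double factorial that normalises the wave. *)
Lemma iter_euler_0 (k : nat) (m : nat -> R -> R) :
  iter_euler k m 0 0 = INR (double_fact k.*2.+1) * m 0%N 0.
Proof.
elim: k m => [|k IH] m; first by rewrite /=; ring.
have -> : double_fact k.+1.*2.+1 = (k.*2.+3 * double_fact k.*2.+1)%N by rewrite doubleS.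
rewrite /= IH /euler mult_INR -addnn !S_INR plus_INR /=; ring.
Qed.

Lemma double_fact_neq0 (k : nat) : INR (double_fact k.*2.+1) <> 0.
Proof.
elim: k => [|k IH]; first by rewrite /=; lra.
have -> : double_fact k.+1.*2.+1 = (k.*2.+3 * double_fact k.*2.+1)%N by rewrite doubleS.
rewrite mult_INR; apply: Rmult_integral_contrapositive; split=> //.
exact: not_0_INR.
Qed.

Lemma iter_euler_continuous (T : UniformSpace) (k i : nat) (m : T -> nat -> R -> R) (r : T -> R) (t : T) :
  (forall j, (j <= i + k)%N -> continuous (fun y => m y j (r y)) t) -> continuous r t ->
  continuous (fun y => iter_euler k (m y) i (r y)) t.
Proof.
elim: k m => [|k IH] m h hr /=; first by apply: h; rewrite addn0.
apply: (IH (fun y => euler k (m y))) => // j hj; rewrite /euler; cont; apply: h.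
  by rewrite addnS leqW.
by rewrite addnS.
Qed.

Lemma is_derive_iter_euler (k i : nat) (m : R -> nat -> R -> R) (dm : nat -> R -> R) (r h0 : R) :
  (forall j, (j <= i + k)%N -> is_derive (fun h => m h j r) h0 (dm j r)) ->
  is_derive (fun h => iter_euler k (m h) i r) h0 (iter_euler k dm i r).
Proof.
elim: k m dm => [|k IH] m dm h /=; first by apply: h; rewrite addn0.
apply: (IH (fun h => euler k (m h))) => // j hj; apply: dR_plus; apply: dR_scal; apply: h.
  by rewrite addnS leqW.
by rewrite addnS.
Qed.

Lemma iter_euler_lin (k i : nat) (a : R) (m1 m2 m3 : nat -> R -> R) (r : R) :
  (forall j, (j <= i + k)%N -> m3 j r = a * m1 j r + m2 j r) ->
  iter_euler k m3 i r = a * iter_euler k m1 i r + iter_euler k m2 i r.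
Proof.
elim: k m1 m2 m3 => [|k IH] m1 m2 m3 h /=; first by apply: h; rewrite addn0.
apply: IH => j hj; rewrite /euler (h j) ?(h j.+1); first by ring.
  by rewrite addnS.
by rewrite addnS leqW.
Qed.

(** [iterSr] exposes the innermost radial derivative: it meets the highest power of r and produces
    the Euler factor with the largest constant. [g] is known for r > 0 only, which suffices to
    differentiate there. *)
Lemma iter_radial_derive (k : nat) (m : nat -> R -> R) (g : R -> R) (r : R) :
  jet k m -> (forall r, 0 < r -> g r = r ^ k.*2.+1 * m 0%N r) -> 0 < r ->
  iter k (fun (g : R -> R) (r : R) => / r * Derive g r) g r = r * iter_euler k m 0 r.
Proof.
elim: k m g r => [|k IH] m g r hm hg hr; first by rewrite /= hg //=; ring.
rewrite iterSr; apply: IH => // [|s hs]; first exact: euler_jet.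
have -> : Derive g s = INR k.*2.+3 * 1 * s ^ k.*2.+2 * m 0%N s + s ^ k.*2.+3 * m 1%N s.
  apply: is_derive_unique.
  apply: (is_derive_ext_loc (fun s => s ^ k.*2.+3 * m 0%N s)).
    apply: filter_imp (open_gt 0 s hs) => t ht; rewrite hg //.
  by apply: dR_mult; [apply: dR_pow; exact: dR_id|exact: hm].
have -> : INR k.*2.+3 = 2 * INR k + 3 by rewrite -addnn !S_INR plus_INR; ring.
rewrite /euler /=; field; lra.
Qed.

Definition fam (n : nat) (phi : ('I_n -> R) -> R) (x : 'I_n -> R) (j : nat) (r : R) : R :=
  sph j phi r x.

(** The free wave with data (0, phi); [wop] is its time derivative, the free wave with data (phi,
    0). In this form neither contains a division by r, so both are defined for all real r. *)
Definition vop (k : nat) (phi : ('I_k.*2.+3 -> R) -> R) (r : R) (x : 'I_k.*2.+3 -> R) : R :=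
  / INR (double_fact k.*2.+1) * (r * iter_euler k (fam phi x) 0 r).

Definition wop (k : nat) (phi : ('I_k.*2.+3 -> R) -> R) (r : R) (x : 'I_k.*2.+3 -> R) : R :=
  / INR (double_fact k.*2.+1) * (iter_euler k (fam phi x) 0 r + r * iter_euler k (fam phi x) 1 r).

Lemma fam_jet (n N : nat) (phi : ('I_n -> R) -> R) (x : 'I_n -> R) : ck N phi -> jet N (fam phi x).
Proof. by move=> h j r hj; apply: is_derive_sph; exact: Ck_le h. Qed.

Lemma vop_continuous (T : UniformSpace) (k : nat) (Phi : R -> ('I_k.*2.+3 -> R) -> R)
    (b r : T -> R) (x : T -> 'I_k.*2.+3 -> R) (t : T) :
  Ck k Phi -> (forall t, continuous b t) -> (forall t, continuous r t) ->
  (forall t, continuous (x : T -> ('I_k.*2.+3 -> R)) t) ->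
  continuous (fun y => vop (Phi (b y)) (r y) (x y)) t.
Proof.
move=> h hb hr hx; rewrite /vop; cont.
apply: (iter_euler_continuous (m := fun y => fam (Phi (b y)) (x y))) => // j hj.
by apply: sph_continuous => //; exact: Ck_le h.
Qed.

Lemma wop_continuous (T : UniformSpace) (k : nat) (Phi : R -> ('I_k.*2.+3 -> R) -> R)
    (b r : T -> R) (x : T -> 'I_k.*2.+3 -> R) (t : T) :
  Ck k.+1 Phi -> (forall t, continuous b t) -> (forall t, continuous r t) ->
  (forall t, continuous (x : T -> ('I_k.*2.+3 -> R)) t) ->
  continuous (fun y => wop (Phi (b y)) (r y) (x y)) t.
Proof.
move=> h hb hr hx; rewrite /wop; cont;
  apply: (iter_euler_continuous (m := fun y => fam (Phi (b y)) (x y))) => // j hj;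
  by apply: sph_continuous => //; apply: Ck_le h => //; apply: leq_trans hj _; rewrite ?leqW.
Qed.

Lemma is_derive_vop (k : nat) (phi : ('I_k.*2.+3 -> R) -> R) (r : R) (x : 'I_k.*2.+3 -> R) :
  ck k.+1 phi -> is_derive (fun r => vop phi r x) r (wop phi r x).
Proof.
move=> h; apply: dR_scal; apply: dR_eq.
  apply: dR_mult; first exact: dR_id.
  by apply: (iter_euler_jet (N := 1)) => //; exact: fam_jet.
rewrite /=; ring.
Qed.

(** With [is_derive_vop] this is the wave equation as a first-order system, v' = w and w' =
    v[lap phi], the Laplacian being applied to the datum. *)
Lemma is_derive_wop (k : nat) (phi : ('I_k.*2.+3 -> R) -> R) (r : R) (x : 'I_k.*2.+3 -> R) :
  ck k.+2 phi -> is_derive (fun r => wop phi r x) r (vop (lap phi) r x).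
Proof.
move=> h; apply: dR_scal.
have hj : jet 2 (iter_euler k (fam phi x)) by apply: iter_euler_jet; exact: fam_jet.
apply: dR_eq.
  apply: dR_plus; first by apply: hj.
  by apply: dR_mult; [exact: dR_id|apply: hj].
rewrite -(iter_euler_radial (m := fam phi x) (mL := fam (lap phi) x)).
- by rewrite /=; ring.
- exact: fam_jet.
- by apply: fam_jet; exact: ck_lap.
- move=> s; have hd := @darboux k.*2.+2 phi s x (Ck_le (k := k.+2) (l := 2) isT h).
  have e : INR k.*2.+2 = 2 * INR k + 2 by rewrite -addnn !S_INR plus_INR; ring.
  by rewrite -e; exact: hd.
Qed.

Lemma is_derive_vop_shift (k : nat) (phi : ('I_k.*2.+3 -> R) -> R) (r : R) (x : 'I_k.*2.+3 -> R)
    (i : 'I_k.*2.+3) :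
  ck k.+1 phi -> is_derive (fun h => vop phi r (shift x i h)) 0 (vop (PD i phi) r x).
Proof.
move=> h; do 2 apply: dR_scal.
apply: (is_derive_iter_euler (m := fun h => fam phi (shift x i h))) => j hj.
by apply: is_derive_sph_shift; exact: Ck_le h.
Qed.

Lemma is_derive_wop_shift (k : nat) (phi : ('I_k.*2.+3 -> R) -> R) (r : R) (x : 'I_k.*2.+3 -> R)
    (i : 'I_k.*2.+3) :
  ck k.+2 phi -> is_derive (fun h => wop phi r (shift x i h)) 0 (wop (PD i phi) r x).
Proof.
move=> h; apply: dR_scal; apply: dR_plus; last apply: dR_scal;
  apply: (is_derive_iter_euler (m := fun h => fam phi (shift x i h))) => j hj;
  by apply: is_derive_sph_shift; apply: Ck_le h; rewrite ltnS //; apply: leq_trans hj _; rewrite ?leqW.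
Qed.

Lemma vop_0 (k : nat) (phi : ('I_k.*2.+3 -> R) -> R) (x : 'I_k.*2.+3 -> R) : vop phi 0 x = 0.
Proof. rewrite /vop; ring. Qed.

Lemma wop_0 (k : nat) (phi : ('I_k.*2.+3 -> R) -> R) (x : 'I_k.*2.+3 -> R) : wop phi 0 x = phi x.
Proof.
rewrite /wop iter_euler_0 Rmult_0_l Rplus_0_r /fam sph_0.
by field; exact: double_fact_neq0.
Qed.

Lemma vop_lin (k : nat) (a : R) (phi psi : ('I_k.*2.+3 -> R) -> R) (r : R) (x : 'I_k.*2.+3 -> R) :
  ck k phi -> ck k psi -> vop (fun x => a * phi x + psi x) r x = a * vop phi r x + vop psi r x.
Proof.
move=> h1 h2.
have e : iter_euler k (fam (fun x => a * phi x + psi x) x) 0 r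
    = a * iter_euler k (fam phi x) 0 r + iter_euler k (fam psi x) 0 r.
  apply: iter_euler_lin => j hj.
  have h1' : ck j phi by exact: Ck_le h1.
  have h2' : ck j psi by exact: Ck_le h2.
  rewrite /fam (@sph_plus _ _ (fun x => a * phi x) psi) //; last first.
    by apply: Ck_scal => // b; exact: cR_const.
  by rewrite sph_scal.
rewrite [LHS]/vop e /vop; ring.
Qed.

(** Both sides are derivatives in r of the same function, by [vop_lin]. *)
Lemma wop_lin (k : nat) (a : R) (phi psi : ('I_k.*2.+3 -> R) -> R) (r : R) (x : 'I_k.*2.+3 -> R) :
  ck k.+1 phi -> ck k.+1 psi -> wop (fun x => a * phi x + psi x) r x = a * wop phi r x + wop psi r x.
Proof.
move=> h1 h2.
apply: (is_derive_unique_eq (f := fun r => vop (fun x => a * phi x + psi x) r x) (x := r)).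
  apply: is_derive_vop; apply: Ck_plus => //.
  by apply: Ck_scal => // b; exact: cR_const.
apply: (dR_ext (f := fun r => a * vop phi r x + vop psi r x)).
  by move=> t; rewrite vop_lin //; exact: Ck_S.
by apply: dR_plus; first apply: dR_scal; exact: is_derive_vop.
Qed.

Lemma vop_lap (k : nat) (phi : ('I_k.*2.+3 -> R) -> R) (r : R) (x : 'I_k.*2.+3 -> R) :
  ck k.+2 phi -> vop (lap phi) r x = \rsum_(i < k.*2.+3) vop (PD i (PD i phi)) r x.
Proof.
move=> h; rewrite /lap.
(* The regularity of the partial sums is carried through the induction because [vop_lin] asks for
   it. *)
suff : ck k (fun x => \rsum_(i < k.*2.+3) PD i (PD i phi) x) /\
  vop (fun x => \rsum_(i < k.*2.+3) PD i (PD i phi) x) r x = \rsum_(i < k.*2.+3) vop (PD i (PD i phi)) r x.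
  by case.
elim: (index_enum _) => [|i s [IH1 IH2]].
  have e : (fun x : 'I_k.*2.+3 -> R => \big[Rplus/0]_(i <- [::]) PD i (PD i phi) x) = (fun _ => 0).
    by apply: functional_extensionality => y; rewrite big_nil.
  rewrite e big_nil; split; first exact: Ck_0.
  (* From -1 * 0 + 0 = 0, linearity gives v[0] = - v[0] + v[0] = 0. *)
  have := vop_lin (-1) r x (Ck_0 k.*2.+3 k) (Ck_0 k.*2.+3 k).
  rewrite (_ : (fun x => _) = (fun _ => 0)); first by lra.
  apply: functional_extensionality => y; ring.
have e : (fun x => \big[Rplus/0]_(j <- (i :: s)) PD j (PD j phi) x) =
    (fun x => 1 * PD i (PD i phi) x + \big[Rplus/0]_(j <- s) PD j (PD j phi) x).
  by apply: functional_extensionality => y; rewrite big_cons; ring.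
have hi : ck k (PD i (PD i phi)) := Ck_PD i (Ck_PD i h).
rewrite e big_cons; split; last by rewrite vop_lin // IH2 Rmult_1_l.
by apply: Ck_plus => //; apply: Ck_scal => // b; exact: cR_const.
Qed.

(** The powers of the radius in the sphere integral and in the sphere area cancel, leaving the mean
    over the unit sphere; the separate clause of [free_wave] at t = 0 agrees with [wop_0]. *)
Lemma free_wave_wop (k : nat) (phi : ('I_k.*2.+3 -> R) -> R) (t : R) (x : 'I_k.*2.+3 -> R) :
  ck k.+1 phi -> 0 <= t -> free_wave phi t x = wop phi t x.
Proof.
move=> h ht; rewrite /free_wave; case: Req_EM_T => [t0|ht0]; first by rewrite /= t0 wop_0.
have e1 : (k.*2.+3 - 3)%N./2 = k by rewrite !subSS subn0 doubleK.
have e2 : (k.*2.+3 - 2)%N = k.*2.+1 by rewrite !subSS subn0.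
rewrite e1 e2 -(is_derive_unique _ _ _ (is_derive_vop t x h)) /vop Derive_scal; congr (_ * _).
have ht' : 0 < t by lra.
apply: Derive_ext_loc; apply: filter_imp (open_gt 0 t ht') => r hr.
apply: iter_radial_derive => //; first by apply: fam_jet; exact: Ck_S.
move=> s hs; congr (_ * _).
rewrite /sphere_mean /sphere_area /sphere_int /fam sphE.
have -> : usi (fun w => phi (fun i => x i + s * w i)) = usi (fun w => dirD 0 phi w (ray x s w)) by [].
have hp : s ^ (k.*2.+3).-1 <> 0 by apply: pow_nonzero; lra.
have := @usi_1_neq0 k.*2.+2.
move: hp; move: (s ^ _) => A hA; move: (usi (fun w => dirD _ _ _ _)) => D.
move: (usi _) => B hB.
by field.
Qed.

(** * Complex-valued functions of a real variable *)

Definition cder (g : R -> C) (t : R) (l : C) : Prop :=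
  is_derive (fun s => Re (g s)) t (Re l) /\ is_derive (fun s => Im (g s)) t (Im l).

Lemma C_ext (z w : C) : Re z = Re w -> Im z = Im w -> z = w.
Proof. by case: z => a b; case: w => c d /= -> ->. Qed.

Lemma cder_eq (g : R -> C) (t : R) (l l' : C) : cder g t l -> l = l' -> cder g t l'.
Proof. by move=> h <-. Qed.

Lemma cder_const (c : C) (t : R) : cder (fun _ => c) t 0.
Proof. by split; exact: dR_const. Qed.

Lemma cder_plus (f g : R -> C) (t : R) (a b : C) :
  cder f t a -> cder g t b -> cder (fun s => f s + g s)%C t (a + b)%C.
Proof. by move=> [f1 f2] [g1 g2]; split; exact: dR_plus. Qed.

Lemma cder_mult (f g : R -> C) (t : R) (a b : C) :
  cder f t a -> cder g t b -> cder (fun s => f s * g s)%C t (a * g t + f t * b)%C.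
Proof.
move=> [f1 f2] [g1 g2]; split.
  apply: dR_eq; first by apply: dR_minus; apply: dR_mult; eassumption.
  rewrite /Cmult /Cplus /Re /Im /=; ring.
apply: dR_eq; first by apply: dR_plus; apply: dR_mult; eassumption.
rewrite /Cmult /Cplus /Re /Im /=; ring.
Qed.

Lemma cder_scal (c : C) (f : R -> C) (t : R) (a : C) :
  cder f t a -> cder (fun s => c * f s)%C t (c * a)%C.
Proof. move=> h; apply: cder_eq (cder_mult (cder_const c t) h) _; ring. Qed.

Lemma cder_RtoC (f : R -> R) (t l : R) : is_derive f t l -> cder (fun s => RtoC (f s)) t (RtoC l).
Proof. by move=> h; split=> //; exact: dR_const. Qed.

Lemma cder_comp (g : R -> C) (f : R -> R) (t l : R) (a : C) :
  cder g (f t) a -> is_derive f t l -> cder (fun s => g (f s)) t (a * RtoC l)%C.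
Proof.
move=> [g1 g2] hf; split.
  apply: dR_eq; first exact: (dR_comp g1 hf).
  rewrite /Cmult /RtoC /Re /Im /=; ring.
apply: dR_eq; first exact: (dR_comp g2 hf).
rewrite /Cmult /RtoC /Re /Im /=; ring.
Qed.

Lemma cder_pow (f : R -> C) (t : R) (a : C) (k : nat) :
  cder f t a -> cder (fun s => Cpow (f s) k) t (RtoC (INR k) * a * Cpow (f t) k.-1)%C.
Proof.
move=> h; elim: k => [|k IH]; first by apply: cder_eq (cder_const 1 t) _; rewrite /=; ring.
apply: cder_eq (cder_mult h IH) _.
by case: k {IH} => [|k]; rewrite !S_INR !RtoC_plus /=; ring.
Qed.

Lemma cder_cpower (f : R -> R) (t l : R) (c : C) :
  0 < f t -> is_derive f t l ->
  cder (fun s => cpower (f s) c) t (cpower (f t) c * (c * RtoC (l / f t)))%C.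
Proof.
move=> hp hf.
have hl : is_derive (fun s => ln (f s)) t (l / f t).
  by apply: dR_eq (dR_comp (is_derive_ln _ hp) hf) _; rewrite /Rdiv Rmult_comm.
have h1 (u : R) : is_derive (fun s => u * ln (f s)) t (u * (l / f t)) by exact: dR_scal.
have e1 s : Re (c * RtoC (ln (f s)))%C = Re c * ln (f s) by rewrite /Cmult /RtoC /Re /Im /=; ring.
have e2 s : Im (c * RtoC (ln (f s)))%C = Im c * ln (f s) by rewrite /Cmult /RtoC /Re /Im /=; ring.
have hE := dR_comp (is_derive_exp _) (h1 (Re c)).
rewrite /cpower /cexp; split.
  apply: (dR_ext (f := fun s => exp (Re c * ln (f s)) * cos (Im c * ln (f s)))).
    by move=> s; rewrite e1 e2.
  apply: dR_eq; first by apply: dR_mult; [exact: hE|exact: (dR_comp (dR_cos _) (h1 (Im c)))].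
  rewrite e1 e2 /Cmult /RtoC /Re /Im /=; ring.
apply: (dR_ext (f := fun s => exp (Re c * ln (f s)) * sin (Im c * ln (f s)))).
  by move=> s; rewrite e1 e2.
apply: dR_eq; first by apply: dR_mult; [exact: hE|exact: (dR_comp (dR_sin _) (h1 (Im c)))].
rewrite e1 e2 /Cmult /RtoC /Re /Im /=; ring.
Qed.

Lemma cexp_plus (z w : C) : cexp (z + w)%C = (cexp z * cexp w)%C.
Proof.
apply: C_ext; rewrite /cexp /Cmult /Cplus /Re /Im /= exp_plus.
  by rewrite cos_plus; ring.
by rewrite sin_plus; ring.
Qed.

Lemma cpower_plus (x : R) (c d : C) : cpower x (c + d)%C = (cpower x c * cpower x d)%C.
Proof. by rewrite /cpower Cmult_plus_distr_r cexp_plus. Qed.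

Lemma cpower_mult (x y : R) (c : C) :
  0 < x -> 0 < y -> cpower (x * y)%R c = (cpower x c * cpower y c)%C.
Proof. by move=> hx hy; rewrite /cpower ln_mult // RtoC_plus Cmult_plus_distr_l cexp_plus. Qed.

Lemma cpower_0 (x : R) : cpower x 0 = 1.
Proof. by rewrite /cpower Cmult_0_l /cexp /= exp_0 cos_0 sin_0; apply: C_ext => /=; ring. Qed.

Lemma cpower_RtoC (x r : R) : cpower x (RtoC r) = RtoC (exp (r * ln x)).
Proof.
rewrite /cpower -RtoC_mult /cexp /= cos_0 sin_0.
by apply: C_ext => /=; ring.
Qed.

Lemma cpower_neq0 (x : R) (c : C) : cpower x c <> 0.
Proof.
move=> h; have := cpower_plus x c (- c)%C.
rewrite h Cmult_0_l (_ : c + - c = 0)%C ?cpower_0; last by ring.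
by move=> /(f_equal fst) /= /R1_neq_R0.
Qed.

(** * The hypergeometric series F(a, a; 1; z) *)

(** The coefficients of z d/dz applied to the series. *)
Definition theta (u : nat -> R) (k : nat) : R := INR k * u k.

Lemma theta_incr (u : nat -> R) (k : nat) : PS_incr_1 (V := R_NormedModule) (PS_derive u) k = theta u k.
Proof. by case: k => [|k]; rewrite /theta /= ?Rmult_0_l. Qed.

Lemma PSeries_theta (u : nat -> R) (x : R) : PSeries (theta u) x = x * PSeries (PS_derive u) x.
Proof. by rewrite -PSeries_incr_1; apply: PSeries_ext => k; rewrite theta_incr. Qed.

Lemma CV_radius_theta (u : nat -> R) : CV_radius (theta u) = CV_radius u.
Proof.
by rewrite -(CV_radius_derive u) -(CV_radius_incr_1 (PS_derive u)); apply: CV_radius_ext => k; rewrite theta_incr.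
Qed.

Lemma PSeries_derive_theta (u : nat -> R) (x : R) :
  Rbar_lt (Rabs x) (CV_radius u) ->
  PSeries (PS_derive (theta u)) x = PSeries (PS_derive u) x + x * PSeries (PS_derive (PS_derive u)) x.
Proof.
move=> h.
have h1 : Rbar_lt (Rabs x) (CV_radius (theta u)) by rewrite CV_radius_theta.
have h2 : Rbar_lt (Rabs x) (CV_radius (PS_derive u)) by rewrite CV_radius_derive.
apply: (is_derive_unique_eq (is_derive_PSeries _ _ h1)).
apply: (dR_ext (f := fun x => x * PSeries (PS_derive u) x)).
  by move=> t; rewrite PSeries_theta.
apply: dR_eq; first by apply: dR_mult; [exact: dR_id|exact: is_derive_PSeries].
by rewrite Rmult_1_l.
Qed.

Lemma PSeries_lin (c : R) (u v w : nat -> R) (x : R) :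
  ex_pseries u x -> ex_pseries v x -> (forall k, w k = c * u k + v k) ->
  ex_pseries w x /\ PSeries w x = c * PSeries u x + PSeries v x.
Proof.
move=> hu hv hw.
have e k : PS_plus (PS_scal c u) v k = w k by rewrite hw.
have hs : ex_pseries (PS_scal c u) x.
  by apply: (ex_pseries_scal (V := R_NormedModule)) => //; rewrite /mult /=; ring.
split; first by apply: (ex_pseries_ext _ _ _ e); exact: (ex_pseries_plus (V := R_NormedModule)).
by rewrite -(PSeries_ext _ _ _ e) PSeries_plus // PSeries_scal.
Qed.

Lemma CV_radius_abs_le (u v : nat -> R) :
  (forall k, Rabs (u k) <= v k) -> Rbar_le (CV_radius v) (CV_radius u).
Proof.
move=> h; apply: (is_lub_Rbar_subset _ _ _ _ _ (CV_radius_bounded u) (CV_radius_bounded v)).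
move=> r [M hM]; exists M => k; apply: Rle_trans (hM k).
rewrite !Rabs_mult; apply: Rmult_le_compat_r; first exact: Rabs_pos.
apply: Rle_trans (h k) _; exact: Rle_abs.
Qed.

Definition hcoef (a : C) (k : nat) : C :=
  (pochhammer a k * pochhammer a k / (pochhammer 1 k * RtoC (INR (k`!)%N)))%C.

Lemma RtoC_neq0 (x : R) : x <> 0 -> RtoC x <> 0.
Proof. by move=> h /(f_equal fst). Qed.

Lemma INR_S_neq0 (k : nat) : INR k.+1 <> 0.
Proof. exact: not_0_INR. Qed.

Lemma pochhammer_1 (k : nat) : pochhammer 1 k = RtoC (INR (k`!)%N).
Proof.
elim: k => [|k IH]; first by [].
rewrite /= IH -RtoC_plus -RtoC_mult factS mult_INR; congr RtoC.
by rewrite S_INR; ring.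
Qed.

Lemma hcoef_S (a : C) (k : nat) :
  (RtoC (INR k.+1) * RtoC (INR k.+1) * hcoef a k.+1
   = (a + RtoC (INR k)) * (a + RtoC (INR k)) * hcoef a k)%C.
Proof.
rewrite /hcoef !pochhammer_1 factS mult_INR RtoC_mult /=.
have h1 : RtoC (INR k.+1) <> 0 by apply: RtoC_neq0; exact: INR_S_neq0.
have h2 : RtoC (INR (k`!)%N) <> 0.
  by apply: RtoC_neq0; apply: not_0_INR; have := fact_gt0 k; case: (k`!)%N.
by field.
Qed.

(** A positive majorant of the coefficients. The ratio test cannot be applied to their real and
    imaginary parts, which may vanish; for m > 0 every [hbound m k] is positive and the ratios tend
    to 1. *)
Fixpoint hbound (m : R) (k : nat) : R :=
  match k with O => 1 | S j => hbound m j * ((m + INR j) / INR j.+1) ^ 2 end.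

Lemma hbound_gt0 (m : R) (k : nat) : 0 < m -> 0 < hbound m k.
Proof.
move=> hm; elim: k => [|k IH] /=; first lra.
have := pos_INR k => hk.
have : 0 < (m + INR k) / INR k.+1 by apply: Rdiv_lt_0_compat; [lra|rewrite S_INR; lra].
move=> h; apply: Rmult_lt_0_compat => //; rewrite Rmult_1_r; exact: Rmult_lt_0_compat.
Qed.

Lemma CV_radius_hbound (m : R) : 0 < m -> CV_radius (hbound m) = 1.
Proof.
move=> hm; rewrite -[in RHS]Rinv_1.
apply: CV_radius_finite_DAlembert; [by move=> k; have := hbound_gt0 k hm; lra|lra|].
apply: (is_lim_seq_ext (fun k => ((m - 1) * / INR k.+1 + 1) * ((m - 1) * / INR k.+1 + 1))).
  move=> k; have hk := hbound_gt0 k hm; have hI := pos_INR k.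
  have e : hbound m k.+1 / hbound m k = ((m + INR k) / INR k.+1) ^ 2.
    rewrite -[hbound m k.+1]/(hbound m k * ((m + INR k) / INR k.+1) ^ 2) S_INR; field; lra.
  rewrite e Rabs_pos_eq; last exact: pow2_ge_0.
  by rewrite S_INR; field; lra.
have hl : is_lim_seq (fun k => (m - 1) * / INR k.+1 + 1) 1.
  have -> : Rbar.Finite 1 = Rbar.Finite ((m - 1) * 0 + 1) by congr Rbar.Finite; ring.
  apply: is_lim_seq_plus'; last exact: is_lim_seq_const.
  apply: is_lim_seq_mult'; first exact: is_lim_seq_const.
  have hI : is_lim_seq (fun k => / INR k) 0.
    by apply: (is_lim_seq_inv _ p_infty); [exact: is_lim_seq_INR|].
  by have [h _] := is_lim_seq_incr_1 (fun k => / INR k) 0; exact: h.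
have -> : Rbar.Finite 1 = Rbar.Finite (1 * 1) by congr Rbar.Finite; ring.
exact: is_lim_seq_mult'.
Qed.

Lemma Cmod_hcoef (a : C) (k : nat) : Cmod (hcoef a k) <= hbound (Cmod a + 1) k.
Proof.
elim: k => [|k IH].
  rewrite /hcoef /= (_ : 1 * 1 / (1 * 1) = 1)%C ?Cmod_1; [lra|by field; exact: RtoC_neq0 R1_neq_R0].
have hI := pos_INR k.
have h1 : RtoC (INR k.+1) <> 0 by apply: RtoC_neq0; exact: INR_S_neq0.
have e : hcoef a k.+1 = (hcoef a k * (((a + RtoC (INR k)) / RtoC (INR k.+1)) * ((a + RtoC (INR k)) / RtoC (INR k.+1))))%C.
  have := hcoef_S a k => h.
  have -> : hcoef a k.+1 = (RtoC (INR k.+1) * RtoC (INR k.+1) * hcoef a k.+1 / (RtoC (INR k.+1) * RtoC (INR k.+1)))%C by field.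
  by rewrite h; field.
have h : Cmod ((a + RtoC (INR k)) / RtoC (INR k.+1)) <= (Cmod a + 1 + INR k) / INR k.+1.
  rewrite Cmod_div // Cmod_R Rabs_pos_eq; last exact: pos_INR.
  apply: Rmult_le_compat_r; first by apply: Rlt_le; apply: Rinv_0_lt_compat; rewrite S_INR; lra.
  by have := Cmod_triangle a (RtoC (INR k)); rewrite Cmod_R (Rabs_pos_eq (INR k)) //; lra.
rewrite -[hbound _ k.+1]/(hbound (Cmod a + 1) k * ((Cmod a + 1 + INR k) / INR k.+1) ^ 2).
rewrite e; move: h; move: (_ / RtoC _)%C => q h; move: IH; move: (hcoef a k) => A IH.
rewrite !Cmod_mult.
have h0 := Cmod_ge_0 q.
apply: Rmult_le_compat => //; first exact: Cmod_ge_0.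
  exact: Rmult_le_pos.
move: h h0; move: (Cmod q) => u; move: (_ / _) => v hu h0; nra.
Qed.

Definition hyp (a : C) (j : nat) (z : R) : C :=
  (PSeries (iter j PS_derive (fun k => Re (hcoef a k))) z,
   PSeries (iter j PS_derive (fun k => Im (hcoef a k))) z).

Lemma CV_radius_iter (u : nat -> R) (j : nat) : CV_radius (iter j PS_derive u) = CV_radius u.
Proof. by elim: j => [//|j IH]; rewrite iterS CV_radius_derive. Qed.

Lemma im_le_Cmod (c : C) : Rabs (Im c) <= Cmod c.
Proof.
have := re_le_Cmod (c * Ci)%C; rewrite Cmod_mult Cmod_Ci Rmult_1_r.
have -> : Re (c * Ci)%C = - Im c by rewrite /Cmult /Ci /Re /Im /=; ring.
by rewrite Rabs_Ropp.
Qed.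

Lemma hcoef_radius (a : C) (z : R) : Rabs z < 1 ->
  Rbar_lt (Rabs z) (CV_radius (fun k => Re (hcoef a k))) /\
  Rbar_lt (Rabs z) (CV_radius (fun k => Im (hcoef a k))).
Proof.
move=> hz.
have hm : 0 < Cmod a + 1 by have := Cmod_ge_0 a; lra.
have h1 := CV_radius_hbound hm.
have H u : (forall k, Rabs (u k) <= hbound (Cmod a + 1) k) -> Rbar_lt (Rabs z) (CV_radius u).
  by move=> /CV_radius_abs_le; rewrite h1; apply: Rbar_lt_le_trans.
split; apply: H => k; apply: Rle_trans (Cmod_hcoef a k); [exact: re_le_Cmod|exact: im_le_Cmod].
Qed.

Lemma hypergeom_hyp (a : C) (z : R) : hypergeom a a 1 (RtoC z) = hyp a 0 z.
Proof.
rewrite /hypergeom /CSeries /hyp /PSeries /=; congr pair; apply: Series_ext => k;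
  rewrite -/(hcoef a k) -RtoC_pow /Cmult /RtoC /Re /Im /=; ring.
Qed.

Lemma cder_hyp (a : C) (j : nat) (z : R) : Rabs z < 1 -> cder (hyp a j) z (hyp a j.+1 z).
Proof.
move=> /(hcoef_radius a) [h1 h2].
by split; apply: is_derive_PSeries; rewrite CV_radius_iter.
Qed.

(** The recurrence (k+1)^2 c_(k+1) = (a+k)^2 c_k says (d/dz)(z d/dz) F = (z d/dz + a)^2 F, which
    expands to the hypergeometric equation. For complex a it becomes a coupled pair of real
    recurrences. *)
Lemma hyp_ode (a : C) (z : R) : Rabs z < 1 ->
  (RtoC z * (1 - RtoC z) * hyp a 2 z + (1 - (2 * a + 1) * RtoC z) * hyp a 1 z - a * a * hyp a 0 z = 0)%C.
Proof.
move=> /(hcoef_radius a) [].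
set u := (fun k => Re (hcoef a k)); set v := (fun k => Im (hcoef a k)) => hu hv.
have exu := CV_radius_inside _ _ hu. have exv := CV_radius_inside _ _ hv.
have ext w : Rbar_lt (Rabs z) (CV_radius w) -> ex_pseries (theta w) z.
  by move=> h; apply: CV_radius_inside; rewrite CV_radius_theta.
have ext2 w : Rbar_lt (Rabs z) (CV_radius w) -> ex_pseries (theta (theta w)) z.
  by move=> h; apply: CV_radius_inside; rewrite !CV_radius_theta.
have rec k : PS_derive (theta u) k = (Re a * Re a - Im a * Im a) * u k + (- (2 * Re a * Im a) * v k +
     (2 * Re a * theta u k + (- (2 * Im a) * theta v k + theta (theta u) k))) /\
   PS_derive (theta v) k = (Re a * Re a - Im a * Im a) * v k + ((2 * Re a * Im a) * u k +
     (2 * Re a * theta v k + ((2 * Im a) * theta u k + theta (theta v) k))).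
  have := hcoef_S a k; rewrite /PS_derive /theta /u /v.
  move: (hcoef a k) (hcoef a k.+1) (INR k) (INR k.+1) => A B x y h.
  have := f_equal Re h; have := f_equal Im h.
  case: (a) (A) (B) => a1 a2 [b1 b2] [c1 c2]; rewrite /Cmult /Cplus /RtoC /Re /Im /= => e1 e2.
  split; lra.
(* The recurrences of the real and imaginary parts share this shape up to signs, so one summation
   serves both. *)
have fin w1 w2 x1 x2 c1 c2 c3 c4 : Rbar_lt (Rabs z) (CV_radius w1) -> Rbar_lt (Rabs z) (CV_radius w2) ->
    (forall k, PS_derive (theta w1) k = c1 * w1 k + (c2 * w2 k +
      (c3 * theta w1 k + (c4 * theta w2 k + theta (theta w1) k)))) ->
    x1 = PSeries (PS_derive w1) z -> x2 = PSeries (PS_derive (PS_derive w1)) z ->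
    x1 + z * x2 = c1 * PSeries w1 z + (c2 * PSeries w2 z +
      (c3 * (z * x1) + (c4 * (z * PSeries (PS_derive w2) z) + z * (x1 + z * x2)))).
  move=> h1 h2 hr -> ->.
  have [g1 k1] := PSeries_lin (ext _ h2) (ext2 _ h1) (fun k => erefl (c4 * theta w2 k + theta (theta w1) k)).
  have [g2 k2] := PSeries_lin (ext _ h1) g1 (fun k => erefl (c3 * theta w1 k + _)).
  have [g3 k3] := PSeries_lin (CV_radius_inside _ _ h2) g2 (fun k => erefl (c2 * w2 k + _)).
  have [g4 k4] := PSeries_lin (CV_radius_inside _ _ h1) g3 hr.
  by rewrite -[LHS]PSeries_derive_theta // k4 k3 k2 k1 !PSeries_theta PSeries_derive_theta.
have E1 := fin u v _ _ _ _ _ _ hu hv (fun k => (rec k).1) erefl erefl.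
have E2 := fin v u _ _ _ _ _ _ hv hu (fun k => (rec k).2) erefl erefl.
rewrite /hyp /= -/u -/v.
move: E1 E2; move: (PSeries _ z) (PSeries v z) (PSeries _ z) (PSeries (PS_derive v) z) (PSeries _ z) (PSeries _ z).
case: (a) => a1 a2; rewrite /Re /Im /= => f0 g0 f1 g1 f2 g2 E1 E2.
apply: C_ext; rewrite /Cmult /Cminus /Cplus /Copp /RtoC /Re /Im /=; nra.
Qed.

(** * The radial profile of the kernel: a solution of Legendre's equation *)

(** This is (y - 1) / (y + 1), written through 1 / (1 + y) so that the derivatives of the profile
    have polynomial coefficients in [nn y]. *)
Definition argz (y : R) : R := 1 - 2 * / (1 + y).
Definition nn (y : R) : C := RtoC (/ (1 + y)).

(** [y |-> (2 + 2 y)^(-a) F(a, a; 1; (y - 1) / (y + 1))] and its first three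
    derivatives are [(2 + 2 y)^(-a)] times [hypH a j y], [j = 0, .., 3]. *)
Definition hypH (a : C) (j : nat) (y : R) : C :=
  let F i := hyp a i (argz y) in
  let n := nn y in
  match j with
  | 0 => F 0%N
  | 1 => - a * n * F 0%N + 2 * n ^ 2 * F 1%N
  | 2 => a * (a + 1) * n ^ 2 * F 0%N - (4 * a + 4) * n ^ 3 * F 1%N + 4 * n ^ 4 * F 2%N
  | _ => - a * n * (a * (a + 1) * n ^ 2 * F 0%N - (4 * a + 4) * n ^ 3 * F 1%N + 4 * n ^ 4 * F 2%N)
         + (- (2) * (a * (a + 1)) * n ^ 3 * F 0%N + 2 * (a * (a + 1)) * n ^ 4 * F 1%N
            + 3 * (4 * a + 4) * n ^ 4 * F 1%N - 2 * (4 * a + 4) * n ^ 5 * F 2%N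
            - 16 * n ^ 5 * F 2%N + 8 * n ^ 6 * F 3%N)
  end%C.

Definition profile (c a : C) (j : nat) (y : R) : C :=
  (c * cpower (2 * (1 + y))%R (- a) * hypH a j y)%C.

Lemma argz_lt1 (y : R) : 0 < y -> Rabs (argz y) < 1.
Proof.
move=> hy; have h1 : 0 < / (1 + y) by apply: Rinv_0_lt_compat; lra.
have h2 : / (1 + y) < 1 by rewrite -[X in _ < X]Rinv_1; apply: Rinv_lt_contravar; lra.
rewrite /argz; apply: Rabs_def1; lra.
Qed.

Lemma dR_inv1 (y : R) : 0 < y -> is_derive (fun y => / (1 + y)) y (- (/ (1 + y)) ^ 2).
Proof.
move=> hy; apply: dR_eq.
  apply: is_derive_inv; first by apply: dR_plus; [exact: dR_const|exact: dR_id].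
  lra.
by field; lra.
Qed.

Lemma cder_nn (y : R) : 0 < y -> cder nn y (- (nn y ^ 2))%C.
Proof.
move=> hy; apply: cder_eq (cder_RtoC (dR_inv1 hy)) _.
by rewrite /nn RtoC_opp RtoC_pow.
Qed.

Lemma cder_F (a : C) (j : nat) (y : R) : 0 < y ->
  cder (fun y => hyp a j (argz y)) y (hyp a j.+1 (argz y) * (2 * nn y ^ 2))%C.
Proof.
move=> hy.
have hz : is_derive argz y (2 * (/ (1 + y)) ^ 2).
  apply: dR_eq; first by apply: dR_minus; [exact: dR_const|apply: dR_scal; exact: dR_inv1].
  ring.
apply: cder_eq (cder_comp (cder_hyp a j (argz_lt1 hy)) hz) _.
by rewrite /nn RtoC_mult RtoC_pow.
Qed.

Lemma cder_minus (f g : R -> C) (t : R) (a b : C) :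
  cder f t a -> cder g t b -> cder (fun s => f s - g s)%C t (a - b)%C.
Proof. by move=> [f1 f2] [g1 g2]; split; exact: dR_minus. Qed.

Ltac cder_tac hy :=
  repeat first [ exact: cder_const | exact: (cder_F _ _ hy)
    | apply: cder_minus | apply: cder_plus | apply: cder_mult
    | apply: cder_pow; exact: (cder_nn hy) | exact: (cder_nn hy) ].

Lemma cder_profile (c a : C) (j : nat) (y : R) : (j < 3)%N -> 0 < y ->
  cder (profile c a j) y (profile c a j.+1 y).
Proof.
move=> hj hy.
have hpow : cder (fun y => cpower (2 * (1 + y))%R (- a)) y
    (cpower (2 * (1 + y))%R (- a) * (- a * nn y))%C.
  apply: cder_eq.
    apply: cder_cpower; first lra.
    by apply: dR_scal; apply: dR_plus; [exact: dR_const|exact: dR_id].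
  congr (_ * (_ * RtoC _))%C; field; lra.
apply: cder_eq.
  apply: cder_mult; first by apply: cder_mult; [exact: cder_const|exact: hpow].
  (* The logarithmic derivative of (2 + 2 y)^(-a) is - a * nn y; the added term compensates for
     it. *)
  have : cder (hypH a j) y (hypH a j.+1 y + a * nn y * hypH a j y)%C.
    case: j hj => [|[|[|]]] // _; rewrite /hypH.
    - by apply: cder_eq (cder_F a 0 hy) _; ring.
    - apply: cder_eq; first by cder_tac hy.
      rewrite /=; ring.
    - apply: cder_eq; first by cder_tac hy.
      rewrite /=; ring.
  by move=> h; exact: h.
rewrite /profile; ring.
Qed.

Lemma profile_3_continuous (c a : C) (y : R) : 0 < y ->
  continuous (fun y => Re (profile c a 3 y)) y /\ continuous (fun y => Im (profile c a 3 y)) y.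
Proof.
move=> hy.
have [l [h1 h2]] : exists l, cder (profile c a 3) y l.
  eexists; apply: cder_mult.
    apply: cder_mult; first exact: cder_const.
    apply: cder_cpower; first lra.
    by apply: dR_scal; apply: dR_plus; [exact: dR_const|exact: dR_id].
  by rewrite /hypH; cder_tac hy.
by split; [exact: dR_cont h1|exact: dR_cont h2].
Qed.

(** In the variable n = 1 / (1 + y), where y = 1 / n - 1 and z = 1 - 2 n, the left side is the
    common power times 2 n times the hypergeometric equation. *)
Lemma profile_ode (c a : C) (y : R) : 0 < y ->
  (RtoC (y ^ 2 - 1) * profile c a 2 y + RtoC (2 * y) * profile c a 1 y + a * (1 - a) * profile c a 0 y = 0)%C.
Proof.
move=> hy; have := hyp_ode a (argz_lt1 hy); rewrite /profile /hypH /argz.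
set F0 := hyp a 0 _; set F1 := hyp a 1 _; set F2 := hyp a 2 _.
have hn : nn y <> 0 by apply: RtoC_neq0; apply: Rinv_neq_0_compat; lra.
have -> : RtoC (1 - 2 * / (1 + y)) = (1 - 2 * nn y)%C by rewrite RtoC_minus RtoC_mult.
have ey : RtoC y = (/ nn y - 1)%C.
  have h1 : RtoC (1 + y) <> 0 by apply: RtoC_neq0; lra.
  have -> : RtoC y = (RtoC (1 + y) - 1)%C by rewrite -RtoC_minus; congr RtoC; ring.
  by rewrite /nn RtoC_inv; try lra; field.
have -> : RtoC (y ^ 2 - 1) = (RtoC y * RtoC y - 1)%C by rewrite -RtoC_mult -RtoC_minus; congr RtoC; ring.
have -> : RtoC (2 * y) = (2 * RtoC y)%C by rewrite RtoC_mult.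
rewrite ey => ode.
have -> : ((((/ nn y - 1) * (/ nn y - 1) - 1) * (c * cpower (2 * (1 + y)) (- a) *
      (a * (a + 1) * nn y ^ 2 * F0 - (4 * a + 4) * nn y ^ 3 * F1 + 4 * nn y ^ 4 * F2)) +
    2 * (/ nn y - 1) * (c * cpower (2 * (1 + y)) (- a) * (- a * nn y * F0 + 2 * nn y ^ 2 * F1)) +
    a * (1 - a) * (c * cpower (2 * (1 + y)) (- a) * F0)) =
    c * cpower (2 * (1 + y)) (- a) * (2 * nn y) * ((1 - 2 * nn y) * (1 - (1 - 2 * nn y)) * F2
      + (1 - (2 * a + 1) * (1 - 2 * nn y)) * F1 - a * a * F0))%C.
  by field.
by rewrite ode; ring.
Qed.

(** The last clause is the derivative of the one before it. The kernel for u0 contains P', so its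
    second derivatives reach P''' and its wave equation rests on the differentiated relation. *)
Definition legendre (lam kappa : R) (P : nat -> R -> R) : Prop :=
  [/\ forall j y, (j < 3)%N -> is_derive (P j) y (P j.+1 y),
      forall y, continuous (P 3%N) y,
      P 0%N 1 = kappa,
      forall y, 1 <= y -> (y ^ 2 - 1) * P 2%N y + 2 * y * P 1%N y + lam * P 0%N y = 0
    & forall y, 1 <= y -> (y ^ 2 - 1) * P 3%N y + 4 * y * P 2%N y + (2 + lam) * P 1%N y = 0].

(** Integration from 1 of a continuous extension of the derivative continues [p] below 1 and leaves
    it unchanged on y >= 1. Applied three times, starting from the third derivative, it extends the
    whole profile. *)
Lemma extend_primitive (p dp E : R -> R) :
  (forall y, 0 < y -> is_derive p y (dp y)) -> (forall y, continuous E y) ->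
  (forall y, 1 <= y -> E y = dp y) ->
  exists Q : R -> R, (forall y, is_derive Q y (E y)) /\ (forall y, 1 <= y -> Q y = p y).
Proof.
move=> hp hE he; exists (fun y => p 1 + RInt E 1 y); split=> y.
  apply: dR_eq; last exact: Rplus_0_l.
  apply: dR_plus; first exact: dR_const.
  apply: (is_derive_RInt (V := R_NormedModule) E _ 1) => //.
  by apply: filter_forall => t; apply: RInt_correct; exact: cR_ex_RInt.
move=> hy; have e : RInt E 1 y = p y - p 1 :> R; last by rewrite [LHS]/= e; ring.
apply: is_RInt_unique; apply: (is_RInt_derive p E) => x; rewrite Rmin_left // Rmax_right // => hx.
  by rewrite he; [apply: hp; lra|lra].
Qed.

(* Only [y >= 1] occurs in the kernels; extending the profile to all of [R] avoids domain conditions. *)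
Lemma legendre_extend (lam kappa : R) (p : nat -> R -> R) :
  (forall j y, (j < 3)%N -> 0 < y -> is_derive (p j) y (p j.+1 y)) ->
  (forall y, 0 < y -> continuous (p 3%N) y) ->
  (forall y, 0 < y -> (y ^ 2 - 1) * p 2%N y + 2 * y * p 1%N y + lam * p 0%N y = 0) ->
  p 0%N 1 = kappa ->
  exists P, legendre lam kappa P /\ forall y, 1 <= y -> P 0%N y = p 0%N y.
Proof.
move=> hd hc hode hk.
pose P3 y := p 3%N (Rmax y 1).
have c3 y : continuous P3 y.
  apply: (continuous_comp (fun y => Rmax y 1) (p 3%N)); first by cont.
  by apply: hc; have := Rmax_r y 1; lra.
have e3 y : 1 <= y -> P3 y = p 3%N y by move=> hy; rewrite /P3 Rmax_left.
have [P2 [d2 e2]] := extend_primitive (fun y => hd 2%N y isT) c3 e3.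
have c2 y : continuous P2 y by exact: dR_cont (d2 y).
have [P1 [d1 e1]] := extend_primitive (fun y => hd 1%N y isT) c2 e2.
have c1 y : continuous P1 y by exact: dR_cont (d1 y).
have [P0 [d0 e0]] := extend_primitive (fun y => hd 0%N y isT) c1 e1.
exists (fun j => match j with 0 => P0 | 1 => P1 | 2 => P2 | _ => P3 end); split => //.
split=> //.
- by move=> [|[|[|]]].
- by rewrite e0 //; lra.
- by move=> y hy; rewrite e2 // e1 // e0 //; apply: hode; lra.
move=> y hy; rewrite e3 // e2 // e1 //; have hy0 : 0 < y by lra.
have D : is_derive (fun y => (y ^ 2 - 1) * p 2%N y + 2 * y * p 1%N y + lam * p 0%N y) y
   ((y ^ 2 - 1) * p 3%N y + 4 * y * p 2%N y + (2 + lam) * p 1%N y).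
  apply: dR_eq.
    apply: dR_plus; last by apply: dR_scal; apply: hd.
    apply: dR_plus; apply: dR_mult; try by apply: hd.
      by apply: dR_minus; [apply: dR_pow; exact: dR_id|exact: dR_const].
    by apply: dR_scal; exact: dR_id.
  rewrite /=; ring.
apply: (is_derive_unique_eq D).
apply: (is_derive_ext_loc (fun _ => 0)); last exact: dR_const.
by apply: filter_imp (open_gt 0 y hy0) => t ht; rewrite hode.
Qed.

Lemma csqrt_sqr (d : R) : (csqrt d * csqrt d)%C = RtoC d.
Proof.
rewrite /csqrt; case: Rle_dec => h.
  by rewrite -RtoC_mult sqrt_sqrt.
have h' : 0 <= - d by lra.
apply: C_ext; rewrite /Cmult /RtoC /Re /Im /=; last by ring.
by have := sqrt_sqrt _ h'; lra.
Qed.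

Lemma hyp_0 (a : C) : hyp a 0 0 = 1.
Proof.
have e : hcoef a 0 = 1.
  by rewrite /hcoef /= (_ : 1 * 1 / (1 * 1) = 1)%C //; field; exact: RtoC_neq0 R1_neq_R0.
by rewrite /hyp; cbn [iter]; rewrite !PSeries_0 e.
Qed.

Lemma profile_legendre (d : R) :
  let sd := csqrt d in
  let a := ((1 - sd) / 2)%C in
  exists P Q, [/\ legendre ((1 - d) / 4) 1 P, legendre ((1 - d) / 4) 0 Q
    & forall y, 1 <= y -> profile (/ cpower 2 (sd - 1)) a 0 y = (P 0%N y, Q 0%N y)].
Proof.
move=> sd a; set c := (/ _)%C.
have h2 : RtoC 2 <> 0 by apply: RtoC_neq0; lra.
have ha : (a * (1 - a))%C = RtoC ((1 - d) / 4).
  have -> : (a * (1 - a) = (1 - sd * sd) / (2 * 2))%C by rewrite /a; field.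
  rewrite csqrt_sqr -RtoC_mult -RtoC_minus -RtoC_div; last lra.
  by congr RtoC; field.
(* At y = 1 the base is 4 and the hypergeometric argument is 0, so the value is c * 4^(-a) = c *
   2^(sd - 1). This is the origin of the constant 1 / 2^(sqrt delta - 1) in the formula. *)
have v1 : profile c a 0 1 = 1.
  rewrite /profile /hypH /argz.
  have -> : 1 - 2 * / (1 + 1) = 0 by field.
  rewrite hyp_0 cpower_mult; try lra.
  have -> : cpower (1 + 1) (- a) = cpower 2 (- a) by congr cpower; ring.
  rewrite -cpower_plus (_ : - a + - a = sd - 1)%C; last by rewrite /a; field.
  by rewrite /c; field; exact: cpower_neq0.
have ode y : 0 < y -> forall f : C -> R, f = Re \/ f = Im ->
  (y ^ 2 - 1) * f (profile c a 2 y) + 2 * y * f (profile c a 1 y) + (1 - d) / 4 * f (profile c a 0 y) = 0.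
  move=> hy f hf; have := profile_ode c a hy; rewrite ha => h.
  case: hf => ->; [have := f_equal Re h|have := f_equal Im h];
    rewrite /Cmult /Cplus /RtoC /Re /Im /=; lra.
have [P [hP eP]] := legendre_extend (p := fun j y => Re (profile c a j y)) (lam := (1 - d) / 4) (kappa := 1)
  (fun j y hj hy => (cder_profile c a hj hy).1) (fun y hy => (profile_3_continuous c a hy).1)
  (fun y hy => ode y hy Re (or_introl erefl)) (f_equal Re v1).
have [Q [hQ eQ]] := legendre_extend (p := fun j y => Im (profile c a j y)) (lam := (1 - d) / 4) (kappa := 0)
  (fun j y hj hy => (cder_profile c a hj hy).2) (fun y hy => (profile_3_continuous c a hy).2)
  (fun y hy => ode y hy Im (or_intror erefl)) (f_equal Im v1).
exists P, Q; split=> // y hy; rewrite eP // eQ //.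
Qed.

(** * The wave kernels *)

(** [Ks t b 0 = 0] reflects evenness in s and removes the boundary term at s = 0 when the Laplacian
    is moved onto the kernel. The equation is asked only inside the cone 0 <= s <= t - b, where y >=
    1. *)
Definition wave_kernel (lam : R) (K Kt Ks Ktt Kss : R -> R -> R -> R) : Prop :=
  let c3 (F : R -> R -> R -> R) := forall p : R * R * R, continuous (fun p => F p.1.1 p.1.2 p.2) p in
  [/\ [/\ c3 K, c3 Kt, c3 Ks, c3 Ktt & c3 Kss],
      forall t b s, 0 < t -> is_derive (fun t => K t b s) t (Kt t b s)
                          /\ is_derive (fun t => Kt t b s) t (Ktt t b s),
      forall t b s, is_derive (fun s => K t b s) s (Ks t b s)
                 /\ is_derive (fun s => Ks t b s) s (Kss t b s),
      forall t b, Ks t b 0 = 0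
    & forall t b s, 0 < t -> 0 <= b -> 0 <= s <= t - b ->
        Ktt t b s - Kss t b s + lam / (1 + t) ^ 2 * K t b s = 0].

(* Clamping times at [0] makes the kernels continuous on the whole space. *)
Definition pc (t : R) : R := 1 + Rmax t 0.

Lemma pc_ge1 (t : R) : 1 <= pc t.
Proof. rewrite /pc; have := Rmax_r t 0; lra. Qed.

Lemma pc_eq (t : R) : 0 <= t -> pc t = 1 + t.
Proof. by move=> h; rewrite /pc Rmax_left. Qed.

Lemma cR_pc (T : UniformSpace) (f : T -> R) (x : T) : continuous f x -> continuous (fun y => pc (f y)) x.
Proof. by move=> h; rewrite /pc; cont. Qed.

Lemma dR_pc (f : R -> R) (t l : R) : 0 < t -> is_derive f (1 + t) l -> is_derive (fun t => f (pc t)) t l.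
Proof.
move=> ht h; apply: (is_derive_ext_loc (fun t => f (1 + t))).
  by apply: filter_imp (open_gt 0 t ht) => s hs; rewrite pc_eq //; lra.
apply: dR_eq; last exact: Rmult_1_r.
apply: (dR_comp (g := fun t => 1 + t)) => //.
apply: dR_eq; first by apply: dR_plus; [exact: dR_const|exact: dR_id].
ring.
Qed.

Definition yv (p q s : R) : R := (p ^ 2 + q ^ 2 - s ^ 2) / (2 * (p * q)).
Definition yp (p q s : R) : R := (p ^ 2 - q ^ 2 + s ^ 2) / (2 * (p ^ 2 * q)).
Definition ypp (p q s : R) : R := (q ^ 2 - s ^ 2) / (p ^ 3 * q).
Definition ys (p q s : R) : R := - s / (p * q).
Definition yss (p q s : R) : R := - 1 / (p * q).
(** [yq = d yv / dq], whose derivatives follow. *)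
Definition yq (p q s : R) : R := (q ^ 2 - p ^ 2 + s ^ 2) / (2 * (p * q ^ 2)).
Definition yqp (p q s : R) : R := - (q ^ 2 + p ^ 2 + s ^ 2) / (2 * (p ^ 2 * q ^ 2)).
Definition yqpp (p q s : R) : R := (q ^ 2 + s ^ 2) / (p ^ 3 * q ^ 2).
Definition yqs (p q s : R) : R := s / (p * q ^ 2).
Definition yqss (p q s : R) : R := 1 / (p * q ^ 2).

Lemma yv_ge1 (p q s : R) : 0 < p -> 0 < q -> 0 <= s <= p - q -> 1 <= yv p q s.
Proof.
move=> hp hq hs; rewrite /yv; have hpq : 0 < p * q by exact: Rmult_lt_0_compat.
apply: (Rmult_le_reg_r (2 * (p * q))); first lra.
rewrite /Rdiv Rmult_assoc Rinv_l; last lra.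
nra.
Qed.

Lemma pq_neq0 (p q : R) (k l : nat) : 0 < p -> 0 < q -> 2 * (p ^ k * q ^ l) <> 0 /\ p ^ k * q ^ l <> 0.
Proof.
move=> hp hq; have := pow_lt p k hp; have := pow_lt q l hq => h1 h2.
by have := Rmult_lt_0_compat _ _ h2 h1; split; lra.
Qed.

Lemma d_yv_p (p q s : R) : 0 < p -> 0 < q -> is_derive (fun p => yv p q s) p (yp p q s).
Proof. rewrite /yv /yp => hp hq; auto_derive; [have := @pq_neq0 p q 1 1 hp hq; rewrite !pow_1; tauto|field; lra]. Qed.
Lemma d_yp_p (p q s : R) : 0 < p -> 0 < q -> is_derive (fun p => yp p q s) p (ypp p q s).
Proof. rewrite /yp /ypp => hp hq; auto_derive; [have := @pq_neq0 p q 2 1 hp hq; rewrite !pow_1; tauto|field; lra]. Qed.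
Lemma d_yv_s (p q s : R) : 0 < p -> 0 < q -> is_derive (fun s => yv p q s) s (ys p q s).
Proof. rewrite /yv /ys => hp hq; auto_derive; [by []|field; lra]. Qed.
Lemma d_ys_s (p q s : R) : 0 < p -> 0 < q -> is_derive (fun s => ys p q s) s (yss p q s).
Proof. rewrite /ys /yss => hp hq; auto_derive; [by []|field; lra]. Qed.
Lemma d_yv_q (p q s : R) : 0 < p -> 0 < q -> is_derive (fun q => yv p q s) q (yq p q s).
Proof. rewrite /yv /yq => hp hq; auto_derive; [have := @pq_neq0 p q 1 1 hp hq; rewrite !pow_1; tauto|field; lra]. Qed.
Lemma d_yq_p (p q s : R) : 0 < p -> 0 < q -> is_derive (fun p => yq p q s) p (yqp p q s).
Proof. rewrite /yq /yqp => hp hq; auto_derive; [have := @pq_neq0 p q 1 2 hp hq; rewrite !pow_1; tauto|field; lra]. Qed.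
Lemma d_yqp_p (p q s : R) : 0 < p -> 0 < q -> is_derive (fun p => yqp p q s) p (yqpp p q s).
Proof. rewrite /yqp /yqpp => hp hq; auto_derive; [have := @pq_neq0 p q 2 2 hp hq; tauto|field; lra]. Qed.
Lemma d_yq_s (p q s : R) : 0 < p -> 0 < q -> is_derive (fun s => yq p q s) s (yqs p q s).
Proof. rewrite /yq /yqs => hp hq; auto_derive; [by []|field; lra]. Qed.
Lemma d_yqs_s (p q s : R) : 0 < p -> 0 < q -> is_derive (fun s => yqs p q s) s (yqss p q s).
Proof. rewrite /yqs /yqss => hp hq; auto_derive; [by []|field; lra]. Qed.

Lemma cR_ratio (T : UniformSpace) (f g : T -> R) (x : T) :
  continuous f x -> continuous g x -> g x <> 0 -> continuous (fun y => f y / g y) x.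
Proof. by move=> hf hg h; apply: cR_mult => //; exact: cR_inv. Qed.

(** When P(1) = 1 this is, for t, b >= 0, Riemann's function with pole at time b and s = 0. *)
Definition GK (P : nat -> R -> R) (t b s : R) : R := P 0%N (yv (pc t) (pc b) s).
Definition GKt (P : nat -> R -> R) (t b s : R) : R :=
  P 1%N (yv (pc t) (pc b) s) * yp (pc t) (pc b) s.
Definition GKs (P : nat -> R -> R) (t b s : R) : R :=
  P 1%N (yv (pc t) (pc b) s) * ys (pc t) (pc b) s.
Definition GKtt (P : nat -> R -> R) (t b s : R) : R :=
  P 2%N (yv (pc t) (pc b) s) * yp (pc t) (pc b) s ^ 2 + P 1%N (yv (pc t) (pc b) s) * ypp (pc t) (pc b) s.
Definition GKss (P : nat -> R -> R) (t b s : R) : R :=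
  P 2%N (yv (pc t) (pc b) s) * ys (pc t) (pc b) s ^ 2 + P 1%N (yv (pc t) (pc b) s) * yss (pc t) (pc b) s.

(** [DK] is [- d/dq] of [P (yv p q s)] at [q = 1]; it does not depend on [b]. *)
Definition DK (P : nat -> R -> R) (t b s : R) : R := - (P 1%N (yv (pc t) 1 s) * yq (pc t) 1 s).
Definition DKt (P : nat -> R -> R) (t b s : R) : R :=
  - (P 2%N (yv (pc t) 1 s) * yp (pc t) 1 s * yq (pc t) 1 s + P 1%N (yv (pc t) 1 s) * yqp (pc t) 1 s).
Definition DKs (P : nat -> R -> R) (t b s : R) : R :=
  - (P 2%N (yv (pc t) 1 s) * ys (pc t) 1 s * yq (pc t) 1 s + P 1%N (yv (pc t) 1 s) * yqs (pc t) 1 s).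
Definition DKtt (P : nat -> R -> R) (t b s : R) : R :=
  - (P 3%N (yv (pc t) 1 s) * yp (pc t) 1 s ^ 2 * yq (pc t) 1 s
     + P 2%N (yv (pc t) 1 s) * (ypp (pc t) 1 s * yq (pc t) 1 s + 2 * yp (pc t) 1 s * yqp (pc t) 1 s)
     + P 1%N (yv (pc t) 1 s) * yqpp (pc t) 1 s).
Definition DKss (P : nat -> R -> R) (t b s : R) : R :=
  - (P 3%N (yv (pc t) 1 s) * ys (pc t) 1 s ^ 2 * yq (pc t) 1 s
     + P 2%N (yv (pc t) 1 s) * (yss (pc t) 1 s * yq (pc t) 1 s + 2 * ys (pc t) 1 s * yqs (pc t) 1 s)
     + P 1%N (yv (pc t) 1 s) * yqss (pc t) 1 s).

Lemma legendre_continuous (lam kappa : R) (P : nat -> R -> R) (j : nat) (y : R) :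
  legendre lam kappa P -> (j <= 3)%N -> continuous (P j) y.
Proof.
move=> [h c _ _ _]; rewrite leq_eqVlt => /orP [/eqP -> //|hj]; exact: dR_cont (h j y hj).
Qed.

Lemma y_continuous (T : UniformSpace) (p q s : T -> R) (x : T) :
  continuous p x -> continuous q x -> continuous s x -> 0 < p x -> 0 < q x ->
  [/\ continuous (fun z => yv (p z) (q z) (s z)) x, continuous (fun z => yp (p z) (q z) (s z)) x,
      continuous (fun z => ypp (p z) (q z) (s z)) x, continuous (fun z => ys (p z) (q z) (s z)) x
    & continuous (fun z => yss (p z) (q z) (s z)) x] /\
  [/\ continuous (fun z => yq (p z) (q z) (s z)) x, continuous (fun z => yqp (p z) (q z) (s z)) x,
      continuous (fun z => yqpp (p z) (q z) (s z)) x, continuous (fun z => yqs (p z) (q z) (s z)) x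
    & continuous (fun z => yqss (p z) (q z) (s z)) x].
Proof.
move=> hp hq hs p0 q0.
have h11 := @pq_neq0 _ _ 1 1 p0 q0. have h21 := @pq_neq0 _ _ 2 1 p0 q0.
have h31 := @pq_neq0 _ _ 3 1 p0 q0. have h12 := @pq_neq0 _ _ 1 2 p0 q0.
have h22 := @pq_neq0 _ _ 2 2 p0 q0. have h32 := @pq_neq0 _ _ 3 2 p0 q0.
rewrite !pow_1 in h11 h21 h31 h12 h22 h32.
by split; split; apply: cR_ratio; try (by cont); rewrite /=; tauto.
Qed.

Lemma y_diag (p q : R) : 0 < p -> 0 < q ->
  yv p q (p - q) = 1 /\ yp p q (p - q) + ys p q (p - q) = 0.
Proof. by move=> hp hq; rewrite /yv /yp /ys; split; field; lra. Qed.

(** The first two turn d_p^2 - d_s^2 of P(y) into ((y^2 - 1) P'' + 2 y P') / p^2. The last two are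
    their derivatives with respect to q, as needed for [DK]. *)
Lemma y_identities (p q s : R) : 0 < p -> 0 < q ->
  [/\ yp p q s ^ 2 - ys p q s ^ 2 = (yv p q s ^ 2 - 1) / p ^ 2,
      ypp p q s - yss p q s = 2 * yv p q s / p ^ 2,
      yp p q s * yqp p q s - ys p q s * yqs p q s = yv p q s * yq p q s / p ^ 2
    & yqpp p q s - yqss p q s = 2 * yq p q s / p ^ 2].
Proof.
move=> hp hq; rewrite /yv /yp /ys /ypp /yss /yq /yqp /yqs /yqpp /yqss.
by split; field; lra.
Qed.

Lemma GK_wave_kernel (lam kappa : R) (P : nat -> R -> R) :
  legendre lam kappa P -> wave_kernel lam (GK P) (GKt P) (GKs P) (GKtt P) (GKss P).
Proof.
move=> hP; have [hd hc3 h1 ode _] := hP.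
have pc0 t : 0 < pc t by have := pc_ge1 t; lra.
have cont3 (p : R * R * R) : [/\ continuous (fun p : R * R * R => yv (pc p.1.1) (pc p.1.2) p.2) p,
    continuous (fun p : R * R * R => yp (pc p.1.1) (pc p.1.2) p.2) p,
    continuous (fun p : R * R * R => ypp (pc p.1.1) (pc p.1.2) p.2) p,
    continuous (fun p : R * R * R => ys (pc p.1.1) (pc p.1.2) p.2) p
    & continuous (fun p : R * R * R => yss (pc p.1.1) (pc p.1.2) p.2) p].
  apply: (y_continuous (p := fun p : R * R * R => pc p.1.1) (q := fun p => pc p.1.2) (s := snd) _ _ _ _ _).1 => //;
   try apply: cR_pc; cont.
have cP j (p : R * R * R) : (j <= 3)%N -> continuous (fun p : R * R * R => P j (yv (pc p.1.1) (pc p.1.2) p.2)) p.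
  move=> hj; apply: (cR_comp (g := P j)); first by have [] := cont3 p.
  move=> y; exact: legendre_continuous hP hj.
split.
- split=> p; have [? ? ? ? ?] := cont3 p; rewrite /GK /GKt /GKs /GKtt /GKss.
  + exact: cP.
  + by apply: cR_mult => //; exact: cP.
  + by apply: cR_mult => //; exact: cP.
  + by apply: cR_plus; apply: cR_mult; (try exact: cP) => //; cont.
  + by apply: cR_plus; apply: cR_mult; (try exact: cP) => //; cont.
- move=> t b s ht; have hp : 0 < 1 + t by lra.
  have e : pc t = 1 + t by rewrite pc_eq //; lra.
  split.
    apply: (dR_pc (f := fun p => P 0%N (yv p (pc b) s))) => //; rewrite /GKt e.
    by apply: dR_comp; [exact: hd|exact: d_yv_p].
  apply: (dR_pc (f := fun p => P 1%N (yv p (pc b) s) * yp p (pc b) s)) => //; rewrite /GKtt e.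
  apply: dR_eq.
    by apply: dR_mult; [apply: (dR_comp (f := P 1%N)); [exact: hd|exact: d_yv_p]|exact: d_yp_p].
  by rewrite /=; ring.
- move=> t b s; split; first by apply: (dR_comp (f := P 0%N)); [exact: hd|exact: d_yv_s].
  apply: dR_eq.
    by apply: dR_mult; [apply: (dR_comp (f := P 1%N)); [exact: hd|exact: d_yv_s]|exact: d_ys_s].
  by rewrite /GKss /=; ring.
- by move=> t b; rewrite /GKs /ys; field; split; apply: Rgt_not_eq; exact: pc0.
move=> t b s ht hb hs; have e : pc t = 1 + t by rewrite pc_eq //; lra.
have eb : pc b = 1 + b by rewrite pc_eq.
rewrite /GKtt /GKss /GK e eb.
have hp : 0 < 1 + t by lra. have hq : 0 < 1 + b by lra.
have hy : 1 <= yv (1 + t) (1 + b) s by apply: yv_ge1; lra.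
have [i1 i2 _ _] := y_identities s hp hq.
have := ode _ hy; move: i1 i2; move: (yv _ _ _) (yp _ _ _) (ys _ _ _) (ypp _ _ _) (yss _ _ _).
move=> y a c a2 c2 i1 i2 o.
have -> : P 2%N y * a ^ 2 + P 1%N y * a2 - (P 2%N y * c ^ 2 + P 1%N y * c2) + lam / (1 + t) ^ 2 * P 0%N y
  = P 2%N y * (a ^ 2 - c ^ 2) + P 1%N y * (a2 - c2) + lam / (1 + t) ^ 2 * P 0%N y by ring.
rewrite i1 i2.
have -> : P 2%N y * ((y ^ 2 - 1) / (1 + t) ^ 2) + P 1%N y * (2 * y / (1 + t) ^ 2) + lam / (1 + t) ^ 2 * P 0%N y
  = ((y ^ 2 - 1) * P 2%N y + 2 * y * P 1%N y + lam * P 0%N y) / (1 + t) ^ 2 by field; lra.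
by rewrite o; field; lra.
Qed.

(** Along the characteristic s = t - b the variable y is constantly 1, so the kernel is constant
    there and its derivative along that line vanishes. *)
Lemma GK_diag (lam kappa : R) (P : nat -> R -> R) (t b : R) :
  legendre lam kappa P -> 0 <= b <= t ->
  GK P t b (t - b) = kappa /\ GKt P t b (t - b) + GKs P t b (t - b) = 0.
Proof.
move=> [_ _ h1 _ _] hb; rewrite /GK /GKt /GKs !pc_eq; try lra.
have -> : t - b = (1 + t) - (1 + b) by ring.
have [e1 e2] : yv (1 + t) (1 + b) (1 + t - (1 + b)) = 1 /\
  yp (1 + t) (1 + b) (1 + t - (1 + b)) + ys (1 + t) (1 + b) (1 + t - (1 + b)) = 0.
  by apply: y_diag; lra.
by rewrite e1 h1; split=> //; rewrite -Rmult_plus_distr_l e2; ring.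
Qed.

Lemma DK_wave_kernel (lam kappa : R) (P : nat -> R -> R) :
  legendre lam kappa P -> wave_kernel lam (DK P) (DKt P) (DKs P) (DKtt P) (DKss P).
Proof.
move=> hP; have [hd hc3 h1 _ ode] := hP.
have pc0 t : 0 < pc t by have := pc_ge1 t; lra.
have one : 0 < 1 by lra.
have cpc (p : R * R * R) : continuous (fun p : R * R * R => pc p.1.1) p by apply: cR_pc; cont.
have cont3 (p : R * R * R) := y_continuous (cpc p) (@cR_const _ 1 p) (@c_snd0 _ _ p) (pc0 _) one.
have cP j (p : R * R * R) : (j <= 3)%N -> continuous (fun p : R * R * R => P j (yv (pc p.1.1) 1 p.2)) p.
  move=> hj; apply: (cR_comp (g := P j)); first by have [[]] := cont3 p.
  move=> y; exact: legendre_continuous hP hj.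
have k1 (p : R * R * R) := @cP 1%N p isT. have k2 (p : R * R * R) := @cP 2%N p isT.
have k3 (p : R * R * R) := @cP 3%N p isT.
split.
- split=> p; have [[? ? ? ? ?] [? ? ? ? ?]] := cont3 p; rewrite /DK /DKt /DKs /DKtt /DKss;
  by repeat first [assumption|exact: k1|exact: k2|exact: k3|cont_step].
- move=> t b s ht; have hp : 0 < 1 + t by lra.
  have e : pc t = 1 + t by rewrite pc_eq //; lra.
  split.
    apply: (dR_pc (f := fun p => - (P 1%N (yv p 1 s) * yq p 1 s))) => //; rewrite /DKt e.
    apply: dR_eq.
      by apply: dR_opp; apply: dR_mult; [apply: (dR_comp (f := P 1%N)); [exact: hd|exact: d_yv_p]|exact: d_yq_p].
    by rewrite /=; ring.
  apply: (dR_pc (f := fun p => - (P 2%N (yv p 1 s) * yp p 1 s * yq p 1 s + P 1%N (yv p 1 s) * yqp p 1 s))) => //.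
  rewrite /DKtt e; apply: dR_eq.
    apply: dR_opp; apply: dR_plus; apply: dR_mult.
    - by apply: dR_mult; [apply: (dR_comp (f := P 2%N)); [exact: hd|exact: d_yv_p]|exact: d_yp_p].
    - exact: d_yq_p.
    - by apply: (dR_comp (f := P 1%N)); [exact: hd|exact: d_yv_p].
    - exact: d_yqp_p.
  by rewrite /=; ring.
- move=> t b s; split.
    apply: dR_eq.
      by apply: dR_opp; apply: dR_mult; [apply: (dR_comp (f := P 1%N)); [exact: hd|exact: d_yv_s]|exact: d_yq_s].
    by rewrite /DKs /=; ring.
  apply: dR_eq.
    apply: dR_opp; apply: dR_plus; apply: dR_mult.
    - by apply: dR_mult; [apply: (dR_comp (f := P 2%N)); [exact: hd|exact: d_yv_s]|exact: d_ys_s].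
    - exact: d_yq_s.
    - by apply: (dR_comp (f := P 1%N)); [exact: hd|exact: d_yv_s].
    - exact: d_yqs_s.
  by rewrite /DKss /=; ring.
- by move=> t b; rewrite /DKs /ys /yqs; field; apply: Rgt_not_eq; exact: pc0.
move=> t b s ht hb hs; have e : pc t = 1 + t by rewrite pc_eq //; lra.
rewrite /DKtt /DKss /DK e.
have hp : 0 < 1 + t by lra.
have hy : 1 <= yv (1 + t) 1 s by apply: yv_ge1; lra.
have [i1 i2 i3 i4] := y_identities s hp one.
have := ode _ hy; move: i1 i2 i3 i4; move: (yv _ _ _) (yp _ _ _) (ys _ _ _) (ypp _ _ _) (yss _ _ _).
move: (yq _ _ _) (yqp _ _ _) (yqs _ _ _) (yqpp _ _ _) (yqss _ _ _).
move=> d dp ds dpp dss y a c a2 c2 i1 i2 i3 i4 o.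
have -> : - (P 3%N y * a ^ 2 * d + P 2%N y * (a2 * d + 2 * a * dp) + P 1%N y * dpp) -
   - (P 3%N y * c ^ 2 * d + P 2%N y * (c2 * d + 2 * c * ds) + P 1%N y * dss) +
   lam / (1 + t) ^ 2 * - (P 1%N y * d)
  = - (P 3%N y * (a ^ 2 - c ^ 2) * d + P 2%N y * ((a2 - c2) * d + 2 * (a * dp - c * ds))
      + P 1%N y * (dpp - dss) + lam / (1 + t) ^ 2 * (P 1%N y * d)) by ring.
rewrite i1 i2 i3 i4.
have -> : - (P 3%N y * ((y ^ 2 - 1) / (1 + t) ^ 2) * d + P 2%N y * (2 * y / (1 + t) ^ 2 * d + 2 * (y * d / (1 + t) ^ 2))
      + P 1%N y * (2 * d / (1 + t) ^ 2) + lam / (1 + t) ^ 2 * (P 1%N y * d))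
  = - d * ((y ^ 2 - 1) * P 3%N y + 4 * y * P 2%N y + (2 + lam) * P 1%N y) / (1 + t) ^ 2 by field; lra.
by rewrite o; field; lra.
Qed.

(** At y = 1 Legendre's equation degenerates to 2 P'(1) + lam P(1) = 0, which fixes P'(1); the P''
    terms cancel because y is constant along s = t. The derivative along s = t does not vanish here:
    it balances the term lam / (1 + t)^2 applied to kappa w[u0]. *)
Lemma DK_diag (lam kappa : R) (P : nat -> R -> R) (t b : R) :
  legendre lam kappa P -> 0 <= t ->
  DK P t b t = - (lam * kappa / 2) * (t / (1 + t)) /\
  DKt P t b t + DKs P t b t = - (lam * kappa / 2) / (1 + t) ^ 2.
Proof.
move=> [_ _ h1 ode _] ht.
have e1 : P 1%N 1 = - (lam * kappa / 2) by have := ode 1 (Rle_refl 1); rewrite h1; lra.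
have hp : 0 < 1 + t by lra.
have [y1 y2] := y_diag hp Rlt_0_1.
have et : 1 + t - 1 = t by ring.
rewrite et in y1 y2.
rewrite /DK /DKt /DKs !pc_eq // y1 e1; split.
  by rewrite /yq; field; lra.
have -> : yp (1 + t) 1 t = - ys (1 + t) 1 t by lra.
by rewrite /yqp /yqs; field; lra.
Qed.

(** * Twice differentiable functions on spacetime *)

(** Continuity is global while time derivatives are asked for t > 0 only, as befits functions
    clamped in time. The one-sided derivative at t = 0 is recovered from the continuity of [Ut]. *)
Definition C2d (n : nat) (U Ut Utt : R -> ('I_n -> R) -> R) (Ui Uti : 'I_n -> R -> ('I_n -> R) -> R)
    (Uij : 'I_n -> 'I_n -> R -> ('I_n -> R) -> R) : Prop :=
  let c (F : R -> ('I_n -> R) -> R) := forall p : R * ('I_n -> R), continuous (fun p => F p.1 p.2) p in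
  let dt (F G : R -> ('I_n -> R) -> R) := forall t x, 0 < t -> is_derive (F^~ x) t (G t x) in
  let dx (F : R -> ('I_n -> R) -> R) i (G : R -> ('I_n -> R) -> R) :=
    forall t x, is_derive (fun h => F t (shift x i h)) 0 (G t x) in
  [/\ c U /\ c Ut /\ c Utt,
      forall i, c (Ui i) /\ c (Uti i) /\ (forall j, c (Uij i j)),
      dt U Ut /\ dt Ut Utt
    & forall i, [/\ dt (Ui i) (Uti i), dx U i (Ui i), dx Ut i (Uti i) & forall j, dx (Ui i) j (Uij i j)]].

Lemma C2d_plus (n : nat) U Ut Utt Ui Uti Uij V Vt Vtt Vi Vti Vij :
  @C2d n U Ut Utt Ui Uti Uij -> @C2d n V Vt Vtt Vi Vti Vij ->
  C2d (fun t x => U t x + V t x) (fun t x => Ut t x + Vt t x) (fun t x => Utt t x + Vtt t x)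
    (fun i t x => Ui i t x + Vi i t x) (fun i t x => Uti i t x + Vti i t x)
    (fun i j t x => Uij i j t x + Vij i j t x).
Proof.
move=> [[a1 [a2 a3]] b [d1 d2] e] [[a1' [a2' a3']] b' [d1' d2'] e'].
split.
- by split=> [p|]; [|split=> p]; apply: cR_plus.
- move=> i; have [b1 [b2 b3]] := b i; have [b1' [b2' b3']] := b' i.
  by split=> [p|]; [|split=> [p|j p]]; apply: cR_plus; try apply: b3; try apply: b3'.
- by split=> t x ht; apply: dR_plus; [apply: d1|apply: d1'|apply: d2|apply: d2'].
move=> i; have [e1 e2 e3 e4] := e i; have [e1' e2' e3' e4'] := e' i.
split=> [t x ht|t x|t x|j t x]; apply: dR_plus;
  by [apply: e1|apply: e1'|apply: e2|apply: e2'|apply: e3|apply: e3'|apply: e4|apply: e4'].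
Qed.

Lemma C2d_time (n : nat) U Ut Utt Ui Uti Uij (g g1 g2 : R -> R) :
  @C2d n U Ut Utt Ui Uti Uij ->
  (forall t, continuous g t) -> (forall t, continuous g1 t) -> (forall t, continuous g2 t) ->
  (forall t, 0 < t -> is_derive g t (g1 t)) -> (forall t, 0 < t -> is_derive g1 t (g2 t)) ->
  C2d (fun t x => g t * U t x) (fun t x => g1 t * U t x + g t * Ut t x)
    (fun t x => g2 t * U t x + 2 * g1 t * Ut t x + g t * Utt t x)
    (fun i t x => g t * Ui i t x) (fun i t x => g1 t * Ui i t x + g t * Uti i t x)
    (fun i j t x => g t * Uij i j t x).
Proof.
move=> [[a1 [a2 a3]] b [d1 d2] e] c0 c1 c2 h1 h2.
have k (f : R -> R) : (forall t, continuous f t) -> forall p : R * ('I_n -> R), continuous (fun p : R * ('I_n -> R) => f p.1) p.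
  by move=> hf p; apply: (continuous_comp fst f); [exact: c_fst0|exact: hf].
have k0 := k g c0. have k1 := k g1 c1. have k2 := k g2 c2.
split.
- split=> [p|]; first by apply: cR_mult.
  split=> p; first by apply: cR_plus; apply: cR_mult.
  apply: cR_plus; last by apply: cR_mult.
  by apply: cR_plus; apply: cR_mult => //; apply: cR_mult => //; exact: cR_const.
- move=> i; have [b1 [b2 b3]] := b i.
  split=> [p|]; first by apply: cR_mult.
  by split=> [p|j p]; [apply: cR_plus|]; apply: cR_mult => //; exact: b3.
- split=> t x ht; first by apply: dR_mult; [exact: h1|exact: d1].
  apply: dR_eq; first by apply: dR_plus; apply: dR_mult; [exact: h2|exact: d1|exact: h1|exact: d2].
  by rewrite /=; ring.
move=> i; have [e1 e2 e3 e4] := e i; split=> [t x ht|t x|t x|j t x].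
- by apply: dR_mult; [exact: h1|exact: e1].
- by apply: dR_scal; exact: e2.
- by apply: dR_plus; apply: dR_scal; [exact: e2|exact: e3].
by apply: dR_scal; exact: e4.
Qed.

(** * Superposition of free waves with a wave kernel *)

Definition J (X : Type) (W : R -> R -> X -> R) (K : R -> R -> R -> R) (t b : R) (x : X) : R :=
  RInt (fun s => W b s x * K t b s) 0 (t - b).

Notation cont3 X F := (forall p : R * R * X, continuous (fun p : R * R * X => F p.1.1 p.1.2 p.2) p).

Lemma J_slice (X : UniformSpace) (W : R -> R -> X -> R) (K : R -> R -> R -> R) (t b : R) (x : X) (s : R) :
  cont3 X W -> cont3 R_UniformSpace K -> continuous (fun s => W b s x * K t b s) s.
Proof.
move=> hW hK; apply: cR_mult; first by apply: (c_comp3 (h := W)) => //; cont.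
by apply: (c_comp3 (h := K)) => //; cont.
Qed.

Lemma J_continuous (X : UniformSpace) (W : R -> R -> X -> R) (K : R -> R -> R -> R) :
  cont3 X W -> cont3 R_UniformSpace K -> cont3 X (J W K).
Proof.
move=> hW hK p.
apply: (continuous_RInt_var (T := prod_UniformSpace (prod_UniformSpace R_UniformSpace R_UniformSpace) X)
  (F := fun p s => W p.1.2 s p.2 * K p.1.1 p.1.2 s) (c := fun p => p.1.1 - p.1.2)) => q; last by cont.
by apply: cR_mult; [apply: (c_comp3 (h := W))|apply: (c_comp3 (h := K))] => //; cont.
Qed.

Lemma J_diag (X : Type) (W : R -> R -> X -> R) (K : R -> R -> R -> R) (t : R) (x : X) : J W K t t x = 0.
Proof. by rewrite /J Rminus_diag RInt_point. Qed.

Lemma is_derive_J_t (X : UniformSpace) (W : R -> R -> X -> R) (K Kt : R -> R -> R -> R) (t b : R) (x : X) :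
  cont3 X W -> cont3 R_UniformSpace K -> cont3 R_UniformSpace Kt -> 0 < t ->
  (forall t b s, 0 < t -> is_derive (fun t => K t b s) t (Kt t b s)) ->
  is_derive (fun t => J W K t b x) t (W b (t - b) x * K t b (t - b) + J W Kt t b x).
Proof.
move=> hW hK hKt ht hd; apply: dR_eq.
  apply: (is_derive_RInt_var (f := fun t s => W b s x * K t b s)
    (df := fun t s => W b s x * Kt t b s) (c := fun t => t - b) (dc := 1)).
  - by apply: filter_imp (open_gt 0 t ht) => u hu s; apply: dR_scal; exact: hd.
  - by move=> p; apply: cR_mult; [apply: (c_comp3 (h := W))|apply: (c_comp3 (h := Kt))] => //; cont.
  - by move=> u s; exact: J_slice.
  - apply: dR_eq; first by apply: dR_minus; [exact: dR_id|exact: dR_const].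
    ring.
by rewrite Rmult_1_r.
Qed.

Lemma is_derive_J_x (n : nat) (W Wi : R -> R -> ('I_n -> R) -> R) (K : R -> R -> R -> R)
    (t b : R) (x : 'I_n -> R) (i : 'I_n) :
  let X := fct_UniformSpace 'I_n R_UniformSpace in
  cont3 X W -> cont3 X Wi -> cont3 R_UniformSpace K ->
  (forall b s x, is_derive (fun h => W b s (shift x i h)) 0 (Wi b s x)) ->
  is_derive (fun h => J W K t b (shift x i h)) 0 (J Wi K t b x).
Proof.
move=> X hW hWi hK hd; rewrite -[in X in is_derive _ _ X](shift0 x i).
apply: (is_derive_RInt_fixed (f := fun h s => W b s (shift x i h) * K t b s)
    (df := fun h s => Wi b s (shift x i h) * K t b s)).
- apply: filter_forall => h s.
  apply: dR_eq; first apply: dR_mult; [|exact: dR_const|].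
    by apply: (is_derive_shift (g := W b s)) => y; exact: hd.
  rewrite /=; ring.
- move=> p; apply: cR_mult; last by apply: (c_comp3 (h := K)) => //; cont.
  by apply: (c_comp3 (h := Wi)) => //; cont; apply: c_shift; cont.
by move=> h s; exact: J_slice.
Qed.

Lemma J_by_parts (X : UniformSpace) (V W : R -> R -> X -> R) (K Ks : R -> R -> R -> R) (t b : R) (x : X) :
  cont3 X V -> cont3 X W -> cont3 R_UniformSpace K -> cont3 R_UniformSpace Ks ->
  (forall s, is_derive (fun s => V b s x) s (W b s x)) ->
  (forall s, is_derive (fun s => K t b s) s (Ks t b s)) ->
  J W K t b x = V b (t - b) x * K t b (t - b) - V b 0 x * K t b 0 - J V Ks t b x.
Proof.
move=> hV hW hK hKs dV dK.
have e : RInt (fun s => W b s x * K t b s + V b s x * Ks t b s) 0 (t - b) =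
   V b (t - b) x * K t b (t - b) - V b 0 x * K t b 0 :> R.
  apply: (RInt_derive (f := fun s => V b s x * K t b s)) => s; first exact: dR_mult.
  by apply: cR_plus; exact: J_slice.
rewrite -e cR_RInt_plus; try by move=> s; exact: J_slice.
by rewrite /J Rplus_minus_r.
Qed.

#[local] Opaque vop wop.

Lemma PD_big (n : nat) (i : 'I_n) (f : 'I_n -> ('I_n -> R) -> R) (x : 'I_n -> R) :
  (forall j, ck 1 (f j)) -> PD i (fun x => \rsum_(j < n) f j x) x = \rsum_(j < n) PD i (f j) x.
Proof.
move=> h; apply: is_derive_unique; apply: dR_big => j; exact: (Ck_derive i 0 x (h j)).
Qed.

Lemma PD_lap (n : nat) (i : 'I_n) (phi : ('I_n -> R) -> R) : ck 3 phi -> PD i (lap phi) = lap (PD i phi).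
Proof.
move=> h; apply: functional_extensionality => x; rewrite /lap PD_big; last first.
  by move=> j; exact: (Ck_PD j (Ck_PD j h)).
apply: eq_bigr => j _; rewrite (PD_comm i j (Ck_PD j h)) (PD_comm i j) //; exact: Ck_S.
Qed.

Lemma wop_lap (k : nat) (phi : ('I_k.*2.+3 -> R) -> R) (r : R) (x : 'I_k.*2.+3 -> R) :
  ck k.+3 phi -> wop (lap phi) r x = \rsum_(i < k.*2.+3) wop (PD i (PD i phi)) r x.
Proof.
move=> h.
apply: (is_derive_unique_eq (f := fun r => vop (lap phi) r x) (x := r)).
  by apply: is_derive_vop; exact: ck_lap.
apply: (dR_ext (f := fun r => \rsum_(i < k.*2.+3) vop (PD i (PD i phi)) r x)).
  by move=> t; rewrite vop_lap //; exact: Ck_S.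
by apply: dR_big => i; apply: is_derive_vop; exact: (Ck_PD i (Ck_PD i h)).
Qed.

Lemma vop_cont3 (k : nat) (Phi : R -> ('I_k.*2.+3 -> R) -> R) :
  Ck k Phi -> cont3 (fct_UniformSpace 'I_k.*2.+3 R_UniformSpace) (fun b s x => vop (Phi b) s x).
Proof. move=> h p; apply: vop_continuous => // q; cont. Qed.

Lemma wop_cont3 (k : nat) (Phi : R -> ('I_k.*2.+3 -> R) -> R) :
  Ck k.+1 Phi -> cont3 (fct_UniformSpace 'I_k.*2.+3 R_UniformSpace) (fun b s x => wop (Phi b) s x).
Proof. move=> h p; apply: wop_continuous => // q; cont. Qed.

Definition Zop (k : nat) (Phi : R -> ('I_k.*2.+3 -> R) -> R) (K : R -> R -> R -> R) :=
  J (fun b s x => wop (Phi b) s x) K.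

Definition Zop_t (k : nat) (Phi : R -> ('I_k.*2.+3 -> R) -> R) (K Kt : R -> R -> R -> R)
    (t b : R) (x : 'I_k.*2.+3 -> R) : R :=
  wop (Phi b) (t - b) x * K t b (t - b) + Zop Phi Kt t b x.

Definition Zop_tt (k : nat) (Phi : R -> ('I_k.*2.+3 -> R) -> R) (K Kt Ks Ktt : R -> R -> R -> R)
    (t b : R) (x : 'I_k.*2.+3 -> R) : R :=
  vop (lap (Phi b)) (t - b) x * K t b (t - b)
  + wop (Phi b) (t - b) x * (2 * Kt t b (t - b) + Ks t b (t - b)) + Zop Phi Ktt t b x.

(** Integrating by parts in [s] turns [w[d_i Phi]], which may fail to be
    differentiable in [x], into [v[d_i Phi]] with [v] the time primitive of [w]. *)
Definition Zop_ij (k : nat) (Phi : R -> ('I_k.*2.+3 -> R) -> R) (K Ks : R -> R -> R -> R)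
    (i j : 'I_k.*2.+3) (t b : R) (x : 'I_k.*2.+3 -> R) : R :=
  vop (PD j (PD i (Phi b))) (t - b) x * K t b (t - b)
  - J (fun b s x => vop (PD j (PD i (Phi b))) s x) Ks t b x.

Lemma lap_continuous (n : nat) (Phi : R -> ('I_n -> R) -> R) (k : nat) :
  Ck k.+2 Phi -> Ck k (fun b => lap (Phi b)).
Proof.
move=> h; rewrite /lap; elim: (index_enum _) => [|i s IH].
  by apply: (Ck_ext (Phi := fun _ _ => 0)) => [b x|]; [rewrite big_nil|exact: Ck_0].
apply: (Ck_ext (Phi := fun b x => PD i (PD i (Phi b)) x + \big[Rplus/0]_(j <- s) PD j (PD j (Phi b)) x)).
  by move=> b x; rewrite big_cons.
by apply: Ck_plus => //; exact: (Ck_PD i (Ck_PD i h)).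
Qed.

Lemma Z_cont3 (k : nat) (Phi : R -> ('I_k.*2.+3 -> R) -> R) (K : R -> R -> R -> R) :
  Ck k.+1 Phi -> cont3 R_UniformSpace K -> cont3 (fct_UniformSpace 'I_k.*2.+3 R_UniformSpace) (Zop Phi K).
Proof. by move=> h hK; apply: J_continuous => //; exact: wop_cont3. Qed.

Lemma diag_continuous (X : UniformSpace) (K : R -> R -> R -> R) :
  cont3 R_UniformSpace K ->
  forall p : R * R * X, continuous (fun p : R * R * X => K p.1.1 p.1.2 (p.1.1 - p.1.2)) p.
Proof. by move=> h p; apply: (c_comp3 (h := K)) => //; cont. Qed.

Lemma diag_continuous_x (X : UniformSpace) (W : R -> R -> X -> R) :
  cont3 X W -> forall p : R * R * X, continuous (fun p : R * R * X => W p.1.2 (p.1.1 - p.1.2) p.2) p.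
Proof. by move=> h p; apply: (c_comp3 (h := W)) => //; cont. Qed.

Lemma Zt_cont3 (k : nat) (Phi : R -> ('I_k.*2.+3 -> R) -> R) (K Kt : R -> R -> R -> R) :
  Ck k.+1 Phi -> cont3 R_UniformSpace K -> cont3 R_UniformSpace Kt ->
  cont3 (fct_UniformSpace 'I_k.*2.+3 R_UniformSpace) (Zop_t Phi K Kt).
Proof.
move=> h hK hKt p; apply: cR_plus; last exact: Z_cont3.
by apply: cR_mult; [exact: (diag_continuous_x (wop_cont3 h))|exact: diag_continuous].
Qed.

Lemma Ztt_cont3 (k : nat) (Phi : R -> ('I_k.*2.+3 -> R) -> R) (K Kt Ks Ktt : R -> R -> R -> R) :
  Ck k.+2 Phi -> cont3 R_UniformSpace K -> cont3 R_UniformSpace Kt -> cont3 R_UniformSpace Ks ->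
  cont3 R_UniformSpace Ktt ->
  cont3 (fct_UniformSpace 'I_k.*2.+3 R_UniformSpace) (Zop_tt Phi K Kt Ks Ktt).
Proof.
move=> h hK hKt hKs hKtt p; apply: cR_plus; last by apply: Z_cont3 => //; exact: Ck_S.
apply: cR_plus; apply: cR_mult; first exact: (diag_continuous_x (vop_cont3 (lap_continuous h))).
- exact: diag_continuous.
- exact: (diag_continuous_x (wop_cont3 (Ck_S h))).
by cont; exact: diag_continuous.
Qed.

Lemma Zij_cont3 (k : nat) (Phi : R -> ('I_k.*2.+3 -> R) -> R) (K Ks : R -> R -> R -> R) (i j : 'I_k.*2.+3) :
  Ck k.+2 Phi -> cont3 R_UniformSpace K -> cont3 R_UniformSpace Ks ->
  cont3 (fct_UniformSpace 'I_k.*2.+3 R_UniformSpace) (Zop_ij Phi K Ks i j).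
Proof.
move=> h hK hKs p.
have hv : cont3 (fct_UniformSpace 'I_k.*2.+3 R_UniformSpace)
  (fun b s x => vop (PD j (PD i (Phi b))) s x) := vop_cont3 (Ck_PD j (Ck_PD i h)).
apply: cR_minus; last exact: J_continuous.
by apply: cR_mult; [exact: (@diag_continuous_x _ (fun b s x => vop (PD j (PD i (Phi b))) s x) hv p)|exact: diag_continuous].
Qed.

Lemma is_derive_Z_t (k : nat) (Phi : R -> ('I_k.*2.+3 -> R) -> R) (K Kt : R -> R -> R -> R)
    (t b : R) (x : 'I_k.*2.+3 -> R) :
  Ck k.+1 Phi -> cont3 R_UniformSpace K -> cont3 R_UniformSpace Kt ->
  (forall t b s, 0 < t -> is_derive (fun t => K t b s) t (Kt t b s)) -> 0 < t ->
  is_derive (fun t => Zop Phi K t b x) t (Zop_t Phi K Kt t b x).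
Proof.
move=> h hK hKt hd ht.
exact: (@is_derive_J_t (fct_UniformSpace 'I_k.*2.+3 R_UniformSpace) _ _ _ _ _ _ (wop_cont3 h)).
Qed.

Lemma is_derive_diag (K Kt Ks : R -> R -> R -> R) (t b : R) :
  cont3 R_UniformSpace Ks -> is_derive (fun u => K u b (t - b)) t (Kt t b (t - b)) ->
  (forall t b s, is_derive (fun s => K t b s) s (Ks t b s)) ->
  is_derive (fun t => K t b (t - b)) t (Ks t b (t - b) + Kt t b (t - b)).
Proof.
move=> hKs h1 h2; apply: dR_eq.
  apply: (dR_comp2 (F := fun s t => K t b s) (dF := fun s t => Ks t b s) (f := fun t => t - b) (df := 1)).
  - by move=> s u; exact: h2.
  - by apply: (c_comp3 (h := Ks)) => //; cont.
  - exact: h1.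
  - by apply: dR_eq; [apply: dR_minus; [exact: dR_id|exact: dR_const]|ring].
  - exact: dR_id.
by rewrite !Rmult_1_l.
Qed.

Lemma is_derive_Zt_t (k : nat) (Phi : R -> ('I_k.*2.+3 -> R) -> R) (K Kt Ks Ktt : R -> R -> R -> R)
    (t b : R) (x : 'I_k.*2.+3 -> R) :
  Ck k.+2 Phi -> cont3 R_UniformSpace K -> cont3 R_UniformSpace Kt -> cont3 R_UniformSpace Ks ->
  cont3 R_UniformSpace Ktt ->
  (forall t b s, 0 < t -> is_derive (fun t => K t b s) t (Kt t b s)) ->
  (forall t b s, 0 < t -> is_derive (fun t => Kt t b s) t (Ktt t b s)) ->
  (forall t b s, is_derive (fun s => K t b s) s (Ks t b s)) -> 0 < t ->
  is_derive (fun t => Zop_t Phi K Kt t b x) t (Zop_tt Phi K Kt Ks Ktt t b x).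
Proof.
move=> h hK hKt hKs hKtt d1 d2 d3 ht; apply: dR_eq.
  apply: dR_plus; last exact: (is_derive_Z_t _ _ (Ck_S h) hKt hKtt d2 ht).
  apply: dR_mult; last exact: (@is_derive_diag K Kt Ks t b hKs (d1 t b (t - b) ht) d3).
  apply: (dR_comp (f := fun r => wop (Phi b) r x) (g := fun t => t - b)).
    by apply: is_derive_wop; exact: Ck_slice.
  by apply: dR_minus; [exact: dR_id|exact: dR_const].
rewrite /Zop_tt /Zop_t /=; ring.
Qed.

Lemma is_derive_Z_x (k : nat) (Phi : R -> ('I_k.*2.+3 -> R) -> R) (K : R -> R -> R -> R)
    (t b : R) (x : 'I_k.*2.+3 -> R) (i : 'I_k.*2.+3) :
  Ck k.+2 Phi -> cont3 R_UniformSpace K ->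
  is_derive (fun h => Zop Phi K t b (shift x i h)) 0 (Zop (fun b => PD i (Phi b)) K t b x).
Proof.
move=> h hK; apply: is_derive_J_x => //.
- exact: wop_cont3 (Ck_S h).
- exact: wop_cont3 (Ck_PD i h).
by move=> c s y; apply: is_derive_wop_shift; exact: Ck_slice.
Qed.

Lemma is_derive_Zt_x (k : nat) (Phi : R -> ('I_k.*2.+3 -> R) -> R) (K Kt : R -> R -> R -> R)
    (t b : R) (x : 'I_k.*2.+3 -> R) (i : 'I_k.*2.+3) :
  Ck k.+2 Phi -> cont3 R_UniformSpace Kt ->
  is_derive (fun h => Zop_t Phi K Kt t b (shift x i h)) 0 (Zop_t (fun b => PD i (Phi b)) K Kt t b x).
Proof.
move=> h hK; apply: dR_plus; last exact: is_derive_Z_x.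
apply: dR_eq; first apply: dR_mult; [|exact: dR_const|].
  by apply: is_derive_wop_shift; exact: (Ck_slice b h).
by rewrite /=; ring.
Qed.

(** v[Phi] is a primitive of w[Phi] that vanishes at s = 0, so the only boundary term sits on s = t
    - b. *)
Lemma Z_by_parts (k : nat) (Phi : R -> ('I_k.*2.+3 -> R) -> R) (K Ks : R -> R -> R -> R)
    (t b : R) (x : 'I_k.*2.+3 -> R) :
  Ck k.+1 Phi -> cont3 R_UniformSpace K -> cont3 R_UniformSpace Ks ->
  (forall t b s, is_derive (fun s => K t b s) s (Ks t b s)) ->
  Zop Phi K t b x = vop (Phi b) (t - b) x * K t b (t - b) - J (fun b s x => vop (Phi b) s x) Ks t b x.
Proof.
move=> h hK hKs hd.
have dv s : is_derive (fun s => vop (Phi b) s x) s (wop (Phi b) s x).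
  by apply: is_derive_vop; exact: (Ck_slice b h).
have E := @J_by_parts (fct_UniformSpace 'I_k.*2.+3 R_UniformSpace) (fun b s x => vop (Phi b) s x)
  (fun b s x => wop (Phi b) s x) K Ks t b x (vop_cont3 (Ck_S h)) (wop_cont3 h) hK hKs dv (hd t b).
by rewrite /Zop E vop_0 Rmult_0_l Rminus_0_r.
Qed.

Lemma is_derive_Z_xx (k : nat) (Phi : R -> ('I_k.*2.+3 -> R) -> R) (K Ks : R -> R -> R -> R)
    (t b : R) (x : 'I_k.*2.+3 -> R) (i j : 'I_k.*2.+3) :
  Ck k.+2 Phi -> cont3 R_UniformSpace K -> cont3 R_UniformSpace Ks ->
  (forall t b s, is_derive (fun s => K t b s) s (Ks t b s)) ->
  is_derive (fun h => Zop (fun b => PD i (Phi b)) K t b (shift x j h)) 0 (Zop_ij Phi K Ks i j t b x).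
Proof.
move=> h hK hKs hd.
apply: (dR_ext (f := fun h => vop (PD i (Phi b)) (t - b) (shift x j h) * K t b (t - b)
   - J (fun b s x => vop (PD i (Phi b)) s x) Ks t b (shift x j h))).
  by move=> u; rewrite (Z_by_parts _ _ _ (Ck_PD i h) hK hKs hd).
apply: dR_minus.
  apply: dR_eq; first apply: dR_mult; [|exact: dR_const|].
    by apply: is_derive_vop_shift; exact: (Ck_slice b (Ck_PD i h)).
  by rewrite /=; ring.
apply: is_derive_J_x => //.
- exact: vop_cont3 (Ck_S (Ck_PD i h)).
- exact: vop_cont3 (Ck_PD j (Ck_PD i h)).
by move=> c s y; apply: is_derive_vop_shift; exact: (Ck_slice c (Ck_PD i h)).
Qed.

#[local] Opaque PD lap RInt.

Lemma cR_RInt_big (n : nat) (f : 'I_n -> R -> R) (a b : R) :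
  (forall i s, continuous (f i) s) ->
  RInt (fun s => \rsum_(i < n) f i s) a b = \rsum_(i < n) RInt (f i) a b.
Proof.
move=> h; elim: (index_enum _) => [|i s IH].
  rewrite big_nil (cR_RInt_ext (g := fun _ => 0)); last by move=> s _; rewrite big_nil.
  by rewrite RInt_const /scal /= /mult /= Rmult_0_r.
rewrite big_cons -IH -cR_RInt_plus //.
  by apply: cR_RInt_ext => u _; rewrite big_cons.
move=> u; elim: s {IH} => [|j s IH].
  by apply: (continuous_ext (fun _ => 0)) => [v|]; [rewrite big_nil|exact: cR_const].
apply: (continuous_ext (fun v => f j v + \big[Rplus/0]_(l <- s) f l v)).
  by move=> v; rewrite big_cons.
exact: cR_plus.
Qed.

Lemma cont3_slice (X : UniformSpace) (F : R -> R -> X -> R) (b : R) :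
  cont3 X F -> forall p : R * X, continuous (fun p : R * X => F p.1 b p.2) p.
Proof. by move=> h p; apply: (c_comp3 (h := F)) => //; cont. Qed.

Lemma cont3_mid (X : UniformSpace) (F : R -> R -> X -> R) (t : R) (x : X) (b : R) :
  cont3 X F -> continuous (fun b => F t b x) b.
Proof. by move=> h; apply: (c_comp3 (h := F)) => //; cont. Qed.

Lemma C2d_Z (k : nat) (Phi : R -> ('I_k.*2.+3 -> R) -> R) (lam : R) (K Kt Ks Ktt Kss : R -> R -> R -> R) (b : R) :
  wave_kernel lam K Kt Ks Ktt Kss -> Ck k.+2 Phi ->
  C2d (fun t => Zop Phi K t b) (fun t => Zop_t Phi K Kt t b) (fun t => Zop_tt Phi K Kt Ks Ktt t b)
    (fun i t => Zop (fun b => PD i (Phi b)) K t b) (fun i t => Zop_t (fun b => PD i (Phi b)) K Kt t b)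
    (fun i j t => Zop_ij Phi K Ks i j t b).
Proof.
move=> [[c0 c1 c2 c3 c4] dt ds _ _] h.
have h1 i := Ck_PD i h.
have dt1 t b' s ht := (dt t b' s ht).1. have dt2 t b' s ht := (dt t b' s ht).2.
have ds1 t b' s := (ds t b' s).1.
split.
- split; first by apply: cont3_slice; exact: Z_cont3 (Ck_S h) c0.
  split; first by apply: cont3_slice; exact: Zt_cont3 (Ck_S h) c0 c1.
  by apply: cont3_slice; exact: Ztt_cont3 h c0 c1 c2 c3.
- move=> i; split; first by apply: cont3_slice; exact: (Z_cont3 (h1 i) c0).
  split; first by apply: cont3_slice; exact: (Zt_cont3 (h1 i) c0 c1).
  by move=> j; apply: cont3_slice; exact: Zij_cont3 h c0 c2.
- split=> t x ht; first exact: (is_derive_Z_t b x (Ck_S h) c0 c1 dt1 ht).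
  exact: (is_derive_Zt_t b x h c0 c1 c2 c3 dt1 dt2 ds1 ht).
move=> i; split=> [t x ht|t x|t x|j t x].
- exact: (is_derive_Z_t b x (h1 i) c0 c1 dt1 ht).
- exact: is_derive_Z_x.
- exact: is_derive_Zt_x.
- exact: is_derive_Z_xx.
Qed.

(** One integration by parts is already built into [Zop_ij]; a second one takes v[lap Phi] back to
    w[Phi] and puts [Kss] under the integral. There the kernel's equation cancels everything, and
    what survives is twice the derivative of K along s = t - b. *)
Lemma Z_residual (k : nat) (Phi : R -> ('I_k.*2.+3 -> R) -> R) (lam : R) (K Kt Ks Ktt Kss : R -> R -> R -> R)
    (t b : R) (x : 'I_k.*2.+3 -> R) :
  wave_kernel lam K Kt Ks Ktt Kss -> Ck k.+2 Phi -> 0 < t -> 0 <= b <= t ->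
  Zop_tt Phi K Kt Ks Ktt t b x - \rsum_(i < k.*2.+3) Zop_ij Phi K Ks i i t b x + lam / (1 + t) ^ 2 * Zop Phi K t b x
  = 2 * (Kt t b (t - b) + Ks t b (t - b)) * wop (Phi b) (t - b) x.
Proof.
move=> [[c0 c1 c2 c3 c4] dt ds ks0 pde] h ht hb.
set X := fct_UniformSpace 'I_k.*2.+3 R_UniformSpace.
have hl : cont3 X (fun b s x => vop (lap (Phi b)) s x) := vop_cont3 (lap_continuous h).
have hw : cont3 X (fun b s x => wop (Phi b) s x) := wop_cont3 (Ck_S h).
have hv i : cont3 X (fun b s x => vop (PD i (PD i (Phi b))) s x) := vop_cont3 (Ck_PD i (Ck_PD i h)).
have e0 : J (fun b s x => vop (lap (Phi b)) s x) Ks t b x =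
    \rsum_(i < k.*2.+3) J (fun b s x => vop (PD i (PD i (Phi b))) s x) Ks t b x.
  rewrite -(@cR_RInt_big _ (fun i s => vop (PD i (PD i (Phi b))) s x * Ks t b s)); last first.
    by move=> i s; exact: (@J_slice X (fun b s x => vop (PD i (PD i (Phi b))) s x) Ks t b x s (hv i) c2).
  apply: cR_RInt_ext => s _; rewrite (vop_lap _ _ (Ck_slice b h)) Rmult_comm big_scal.
  by apply: eq_bigr => i _; rewrite Rmult_comm.
have e1 : \rsum_(i < k.*2.+3) Zop_ij Phi K Ks i i t b x =
    vop (lap (Phi b)) (t - b) x * K t b (t - b) - J (fun b s x => vop (lap (Phi b)) s x) Ks t b x.
  rewrite e0 (vop_lap _ _ (Ck_slice b h)).
  have -> A B : A * B - \rsum_(i < k.*2.+3) J (fun b s x => vop (PD i (PD i (Phi b))) s x) Ks t b x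
      = B * A + -1 * \rsum_(i < k.*2.+3) J (fun b s x => vop (PD i (PD i (Phi b))) s x) Ks t b x by ring.
  rewrite !big_scal -big_split /=; apply: eq_bigr => i _; rewrite /Zop_ij; ring.
have e2 : J (fun b s x => vop (lap (Phi b)) s x) Ks t b x =
    wop (Phi b) (t - b) x * Ks t b (t - b) - Zop Phi Kss t b x.
  have E := @J_by_parts X (fun b s x => wop (Phi b) s x) (fun b s x => vop (lap (Phi b)) s x) Ks Kss t b x
    hw hl c2 c4.
  rewrite E ?ks0 ?Rmult_0_r ?Rminus_0_r //.
    by move=> s; apply: is_derive_wop; exact: (Ck_slice b h).
  by move=> s; exact: (ds t b s).2.
have e3 : Zop Phi Ktt t b x - Zop Phi Kss t b x + lam / (1 + t) ^ 2 * Zop Phi K t b x = 0.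
  have cs K' : cont3 R_UniformSpace K' -> forall s, continuous (fun s => wop (Phi b) s x * K' t b s) s.
    by move=> hK' s; exact: (@J_slice X (fun b s x => wop (Phi b) s x) K' t b x s hw hK').
  rewrite /Zop /J -cR_RInt_scal; last exact: cs.
  rewrite -cR_RInt_minus; try exact: cs.
  rewrite -cR_RInt_plus; last first.
  - by move=> s; apply: cR_mult; [exact: cR_const|exact: cs].
  - by move=> s; apply: cR_minus; exact: cs.
  rewrite (cR_RInt_ext (g := fun _ => 0)).
    by rewrite RInt_const /scal /= /mult /= Rmult_0_r.
  move=> s; rewrite Rmin_left ?Rmax_right; try lra.
  move=> hs; have := pde t b s ht (proj1 hb); move=> p.
  have {}p := p (conj (Rlt_le _ _ (proj1 hs)) (Rlt_le _ _ (proj2 hs))).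
  transitivity (wop (Phi b) s x * (Ktt t b s - Kss t b s + lam / (1 + t) ^ 2 * K t b s)); first by ring.
  by rewrite p Rmult_0_r.
rewrite e1 e2 /Zop_tt; move: e3; move: (Zop _ Ktt _ _ _) (Zop _ Kss _ _ _) (Zop _ K _ _ _) (lam / _) => A B D l e3.
have -> : A = B - l * D by lra.
ring.
Qed.

(** * Duhamel's integral over the starting time b *)

Definition Duhamel (X : Type) (F : R -> R -> X -> R) (t : R) (x : X) : R := RInt (fun b => F t b x) 0 t.

Lemma Duhamel_continuous (X : UniformSpace) (F : R -> R -> X -> R) :
  cont3 X F -> forall p : R * X, continuous (fun p : R * X => Duhamel F p.1 p.2) p.
Proof.
move=> h p.
apply: (continuous_RInt_var (T := prod_UniformSpace R_UniformSpace X)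
  (F := fun p b => F p.1 b p.2) (c := fun p => p.1)) => q; last by cont.
by apply: (c_comp3 (h := F)) => //; cont.
Qed.

Lemma is_derive_Duhamel_t (X : UniformSpace) (F Ft : R -> R -> X -> R) (t : R) (x : X) :
  cont3 X F -> cont3 X Ft -> 0 < t ->
  (forall t b, 0 < t -> is_derive (fun t => F t b x) t (Ft t b x)) ->
  is_derive (fun t => Duhamel F t x) t (F t t x + Duhamel Ft t x).
Proof.
move=> hF hFt ht hd; apply: dR_eq.
  apply: (is_derive_RInt_var (f := fun t b => F t b x) (df := fun t b => Ft t b x) (c := fun t => t) (dc := 1)).
  - by apply: filter_imp (open_gt 0 t ht) => u hu s; exact: hd.
  - by move=> p; apply: (c_comp3 (h := Ft)) => //; cont.
  - by move=> u s; exact: cont3_mid.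
  - exact: dR_id.
by rewrite Rmult_1_r.
Qed.

Lemma is_derive_Duhamel_x (n : nat) (F Fi : R -> R -> ('I_n -> R) -> R) (t : R) (x : 'I_n -> R) (i : 'I_n) :
  let X := fct_UniformSpace 'I_n R_UniformSpace in
  cont3 X F -> cont3 X Fi ->
  (forall t b x, is_derive (fun h => F t b (shift x i h)) 0 (Fi t b x)) ->
  is_derive (fun h => Duhamel F t (shift x i h)) 0 (Duhamel Fi t x).
Proof.
move=> X hF hFi hd; rewrite -[in X in is_derive _ _ X](shift0 x i).
apply: (is_derive_RInt_fixed (f := fun h b => F t b (shift x i h)) (df := fun h b => Fi t b (shift x i h))).
- apply: filter_forall => h s; apply: (is_derive_shift (g := F t s)) => y; exact: hd.
- move=> p; apply: (c_comp3 (h := Fi)) => //; cont; apply: c_shift; cont.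
by move=> h s; exact: (@cont3_mid X).
Qed.

Lemma C2d_Duhamel (k : nat) (Phi : R -> ('I_k.*2.+3 -> R) -> R) (lam : R) (K Kt Ks Ktt Kss : R -> R -> R -> R) :
  wave_kernel lam K Kt Ks Ktt Kss -> Ck k.+2 Phi ->
  C2d (Duhamel (Zop Phi K)) (Duhamel (Zop_t Phi K Kt))
    (fun t x => Zop_t Phi K Kt t t x + Duhamel (Zop_tt Phi K Kt Ks Ktt) t x)
    (fun i => Duhamel (Zop (fun b => PD i (Phi b)) K)) (fun i => Duhamel (Zop_t (fun b => PD i (Phi b)) K Kt))
    (fun i j => Duhamel (Zop_ij Phi K Ks i j)).
Proof.
move=> hK h; have [[c0 c1 c2 c3 c4] dt ds _ _] := hK.
set X := fct_UniformSpace 'I_k.*2.+3 R_UniformSpace.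
have h1 i := Ck_PD i h.
have dt1 t b' s ht := (dt t b' s ht).1. have dt2 t b' s ht := (dt t b' s ht).2.
have ds1 t b' s := (ds t b' s).1.
have z0 : cont3 X (Zop Phi K) := Z_cont3 (Ck_S h) c0.
have z1 : cont3 X (Zop_t Phi K Kt) := Zt_cont3 (Ck_S h) c0 c1.
have z2 : cont3 X (Zop_tt Phi K Kt Ks Ktt) := Ztt_cont3 h c0 c1 c2 c3.
have zi i : cont3 X (Zop (fun b => PD i (Phi b)) K) := Z_cont3 (h1 i) c0.
have zti i : cont3 X (Zop_t (fun b => PD i (Phi b)) K Kt) := Zt_cont3 (h1 i) c0 c1.
have zij i j : cont3 X (Zop_ij Phi K Ks i j) := Zij_cont3 h c0 c2.
(* At b = t the inner integral runs over a single point, so first time derivatives carry no endpoint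
   term; the second time derivative does, and it is kept explicitly. *)
have d0 (F Ft : R -> R -> X -> R) t x : cont3 X F -> cont3 X Ft -> 0 < t ->
    (forall t, F t t x = 0) ->
    (forall t b, 0 < t -> is_derive (fun t => F t b x) t (Ft t b x)) ->
    is_derive (fun t => Duhamel F t x) t (Duhamel Ft t x).
  move=> hF hFt ht hz hd; apply: dR_eq; first exact: (is_derive_Duhamel_t hF hFt ht hd).
  by rewrite hz Rplus_0_l.
split.
- split; first exact: (Duhamel_continuous z0).
  split; first exact: (Duhamel_continuous z1).
  move=> p; apply: cR_plus; last exact: (Duhamel_continuous z2).
  by apply: (c_comp3 (h := Zop_t Phi K Kt)) => //; cont.
- move=> i; split; first exact: (Duhamel_continuous (zi i)).
  split; first exact: (Duhamel_continuous (zti i)).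
  move=> j; exact: (Duhamel_continuous (zij i j)).
- split=> t x ht.
    apply: (d0 _ _ t x z0 z1 ht) => [u|u b hu]; first by rewrite /Zop J_diag.
    exact: (is_derive_Z_t b x (Ck_S h) c0 c1 dt1 hu).
  apply: (is_derive_Duhamel_t z1 z2 ht) => u b hu.
  exact: (is_derive_Zt_t b x h c0 c1 c2 c3 dt1 dt2 ds1 hu).
move=> i; split=> [t x ht|t x|t x|j t x].
- apply: (d0 _ _ t x (zi i) (zti i) ht) => [u|u b hu]; first by rewrite /Zop J_diag.
  exact: (is_derive_Z_t b x (h1 i) c0 c1 dt1 hu).
- by apply: (is_derive_Duhamel_x t x z0 (zi i)) => u b y; exact: is_derive_Z_x.
- by apply: (is_derive_Duhamel_x t x z1 (zti i)) => u b y; exact: is_derive_Zt_x.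
- by apply: (is_derive_Duhamel_x t x (zi i) (zij i j)) => u b y; exact: is_derive_Z_xx.
Qed.

(** A constant value of K along the characteristics makes every interior residual vanish; the source
    comes from the endpoint b = t, where [Zop_t] reduces to w[Phi] at time 0 times K. *)
Lemma Duhamel_residual (k : nat) (Phi : R -> ('I_k.*2.+3 -> R) -> R) (lam : R) (K Kt Ks Ktt Kss : R -> R -> R -> R)
    (t : R) (x : 'I_k.*2.+3 -> R) :
  wave_kernel lam K Kt Ks Ktt Kss -> Ck k.+2 Phi -> 0 < t ->
  (forall b, 0 <= b <= t -> Kt t b (t - b) + Ks t b (t - b) = 0) ->
  Zop_t Phi K Kt t t x + Duhamel (Zop_tt Phi K Kt Ks Ktt) t x
  - \rsum_(i < k.*2.+3) Duhamel (Zop_ij Phi K Ks i i) t x + lam / (1 + t) ^ 2 * Duhamel (Zop Phi K) t x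
  = Phi t x * K t t 0.
Proof.
move=> hK h ht hdiag; have [[c0 c1 c2 c3 c4] _ _ _ _] := hK.
set X := fct_UniformSpace 'I_k.*2.+3 R_UniformSpace.
have z0 : cont3 X (Zop Phi K) := Z_cont3 (Ck_S h) c0.
have z2 : cont3 X (Zop_tt Phi K Kt Ks Ktt) := Ztt_cont3 h c0 c1 c2 c3.
have zij i : cont3 X (Zop_ij Phi K Ks i i) := Zij_cont3 h c0 c2.
have e0 : Zop_t Phi K Kt t t x = Phi t x * K t t 0 by rewrite /Zop_t /Zop J_diag Rminus_diag wop_0 Rplus_0_r.
have sl (F : R -> R -> X -> R) (b : R) : cont3 X F -> continuous (fun b => F t b x) b by exact: cont3_mid.
have csum s : continuous (fun b => \rsum_(i < k.*2.+3) Zop_ij Phi K Ks i i t b x) s.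
  by apply: c_big => i; exact: sl.
have e : Duhamel (Zop_tt Phi K Kt Ks Ktt) t x - \rsum_(i < k.*2.+3) Duhamel (Zop_ij Phi K Ks i i) t x
   + lam / (1 + t) ^ 2 * Duhamel (Zop Phi K) t x = 0.
  rewrite /Duhamel -(@cR_RInt_big _ (fun i b => Zop_ij Phi K Ks i i t b x)); last by move=> i s; exact: sl.
  rewrite -cR_RInt_scal; last by move=> s; exact: sl.
  rewrite -cR_RInt_minus //; last by move=> s; exact: sl.
  rewrite -cR_RInt_plus; last first.
  - by move=> s; apply: cR_mult; [exact: cR_const|exact: sl].
  - by move=> s; apply: cR_minus => //; exact: sl.
  rewrite (cR_RInt_ext (g := fun _ => 0)).
    by rewrite RInt_const /scal /= /mult /= Rmult_0_r.
  move=> b; rewrite Rmin_left ?Rmax_right; try lra.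
  move=> hb; rewrite (Z_residual x hK h ht); last lra.
  by rewrite hdiag; [ring|lra].
rewrite e0; lra.
Qed.

Lemma C2d_wop (k : nat) (phi : ('I_k.*2.+3 -> R) -> R) (c : R) : ck k.+3 phi ->
  C2d (fun t x => c * wop phi t x) (fun t x => c * vop (lap phi) t x) (fun t x => c * wop (lap phi) t x)
    (fun i t x => c * wop (PD i phi) t x) (fun i t x => c * vop (PD i (lap phi)) t x)
    (fun i j t x => c * wop (PD j (PD i phi)) t x).
Proof.
move=> h.
have cw psi : ck k.+1 psi -> forall p : R * ('I_k.*2.+3 -> R), continuous (fun p => c * wop psi p.1 p.2) p.
  move=> hp p; apply: cR_mult; first exact: cR_const.
  by apply: (wop_continuous (Phi := fun _ => psi) (b := fun _ => 0)) => // q; cont.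
have cv psi : ck k psi -> forall p : R * ('I_k.*2.+3 -> R), continuous (fun p => c * vop psi p.1 p.2) p.
  move=> hp p; apply: cR_mult; first exact: cR_const.
  by apply: (vop_continuous (Phi := fun _ => psi) (b := fun _ => 0)) => // q; cont.
have hl : ck k.+1 (lap phi) by exact: ck_lap.
have hi i : ck k.+2 (PD i phi) := Ck_PD i h.
have hij i j : ck k.+1 (PD j (PD i phi)) := Ck_PD j (Ck_PD i h).
split.
- split; first exact: (cw _ (Ck_S (Ck_S h))).
  by split; [exact: (cv _ (Ck_S hl))|exact: (cw _ hl)].
- move=> i; split; first exact: (cw _ (Ck_S (hi i))).
  split; first exact: (cv _ (Ck_PD i hl)).
  move=> j; exact: (cw _ (hij i j)).
- split=> t x _; apply: dR_scal; first exact: (is_derive_wop t x (Ck_S h)).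
  exact: (is_derive_vop t x hl).
move=> i; split=> [t x _|t x|t x|j t x]; apply: dR_scal.
- by rewrite PD_lap; [exact: (is_derive_wop t x (hi i))|exact: (Ck_le (k := k.+3) (l := 3) isT h)].
- exact: (is_derive_wop_shift t x i (Ck_S h)).
- exact: (is_derive_vop_shift t x i hl).
exact: (is_derive_wop_shift t x j (hi i)).
Qed.

(** The solution built on one real profile. The value kappa = P(1) multiplies source and data alike,
    so the real part of the complex profile (kappa = 1) carries the given problem and the imaginary
    part (kappa = 0) the homogeneous one. *)
Definition sol (k : nat) (kappa : R) (P : nat -> R -> R) (u0 U1 : ('I_k.*2.+3 -> R) -> R)
    (F : R -> ('I_k.*2.+3 -> R) -> R) (t : R) (x : 'I_k.*2.+3 -> R) : R :=
  kappa * wop u0 t x + Zop (fun _ => u0) (DK P) t 0 x + Zop (fun _ => U1) (GK P) t 0 x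
  + Duhamel (Zop F (GK P)) t x.

Lemma Zop_diag (k : nat) (Phi : R -> ('I_k.*2.+3 -> R) -> R) (K : R -> R -> R -> R) (t : R)
    (x : 'I_k.*2.+3 -> R) : Zop Phi K t t x = 0.
Proof. exact: J_diag. Qed.

Lemma Duhamel_0 (X : Type) (F : R -> R -> X -> R) (x : X) : Duhamel F 0 x = 0.
Proof. by rewrite /Duhamel RInt_point. Qed.

Lemma sol_spec (k : nat) (lam kappa : R) (P : nat -> R -> R) (u0 U1 : ('I_k.*2.+3 -> R) -> R)
    (F : R -> ('I_k.*2.+3 -> R) -> R) :
  legendre lam kappa P -> ck k.+3 u0 -> ck k.+2 U1 -> Ck k.+2 F ->
  exists Ut Utt Ui Uti Uij, [/\ C2d (sol kappa P u0 U1 F) Ut Utt Ui Uti Uij,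
    forall t x, 0 < t -> Utt t x - \rsum_(i < k.*2.+3) Uij i i t x
       + lam / (1 + t) ^ 2 * sol kappa P u0 U1 F t x = kappa * F t x,
    forall x, sol kappa P u0 U1 F 0 x = kappa * u0 x
    & forall x, Ut 0 x = kappa * U1 x].
Proof.
move=> hP h0 h1 hF.
have kD := DK_wave_kernel hP. have kG := GK_wave_kernel hP.
have h0' : Ck k.+2 (fun _ => u0) := Ck_S h0.
have A := C2d_plus (C2d_plus (C2d_plus (C2d_wop kappa h0) (C2d_Z 0 kD h0')) (C2d_Z 0 kG h1)) (C2d_Duhamel kG hF).
do 5 eexists; split; first exact: A.
- move=> t x ht; rewrite 3!big_split /= /sol.
  have hb : 0 <= 0 <= t by lra.
  have r1 := Z_residual x kD h0' ht hb.
  have r2 := Z_residual x kG h1 ht hb.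
  have r3 := Duhamel_residual x kG hF ht (fun b hb => (GK_diag hP hb).2).
  have ht0 : 0 <= t by lra.
  have [d1 _] := GK_diag hP (conj ht0 (Rle_refl t)).
  have [_ d2] := GK_diag hP hb.
  have [_ d3] := DK_diag 0 hP ht0.
  have r0 := wop_lap t x h0.
  rewrite Rminus_diag in d1; rewrite !Rminus_0_r in r1 r2 d2.
  rewrite d3 in r1; rewrite d2 Rmult_0_r Rmult_0_l in r2; rewrite d1 in r3.
  rewrite -big_scal -r0.
  set l := lam / (1 + t) ^ 2 in r1 r2 r3 *.
  (* kappa w[u0] solves the free equation, hence fails the equation with potential by l * (kappa
     w[u0]); the residual of the [DK] term is exactly the opposite. *)
  have e : 2 * (- (lam * kappa / 2) / (1 + t) ^ 2) * wop u0 t x = - (l * (kappa * wop u0 t x)).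
    by rewrite /l; field; lra.
  rewrite e in r1.
  have r := f_equal2 Rplus (f_equal2 Rplus r1 r2) r3.
  (* The sum of the three residuals, plus the potential term of the free wave. *)
  by apply: eq_trans (eq_trans _ (f_equal (fun z => z + l * (kappa * wop u0 t x)) r)) _; rewrite /=; ring.
- by move=> x; rewrite /sol wop_0 !Zop_diag Duhamel_0; ring.
move=> x; rewrite /Zop_t !Zop_diag Duhamel_0 !Rminus_diag vop_0 !wop_0.
have z : 0 <= 0 by lra.
have [d1 _] := DK_diag 0 hP z.
have := GK_diag hP (conj z z); rewrite Rminus_diag => -[d2 _].
by rewrite d1 d2; field.
Qed.

(** * Return to the damped equation *)

Definition source (n : nat) (mu : R) (f : R -> ('I_n -> R) -> R) (b : R) (x : 'I_n -> R) : R :=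
  Rpower (pc b) (mu / 2) * f (Rmax b 0) x.

Lemma pc_gt0 (t : R) : 0 < pc t.
Proof. have := pc_ge1 t; lra. Qed.

Lemma Rpower_pc_continuous (a t : R) : continuous (fun t => Rpower (pc t) a) t.
Proof.
rewrite /Rpower; apply: (cR_comp (g := exp)); last exact: continuous_exp.
apply: cR_mult; first exact: cR_const.
apply: (continuous_comp pc ln); first by apply: cR_pc; cont.
exact: dR_cont (is_derive_ln _ (pc_gt0 t)).
Qed.

Lemma is_derive_Rpower_pc (a t : R) : 0 < t ->
  is_derive (fun t => Rpower (pc t) a) t (a * Rpower (pc t) a / pc t).
Proof.
move=> ht; apply: (dR_pc (f := fun p => Rpower p a)) => //.
have e : pc t = 1 + t by rewrite pc_eq //; lra.
rewrite e /Rpower; apply: dR_eq.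
  by apply: (dR_comp (f := exp)); [exact: is_derive_exp|apply: dR_scal; apply: is_derive_ln; lra].
rewrite /=; field; lra.
Qed.

Lemma inv_pc_continuous (t : R) : continuous (fun t => / pc t) t.
Proof. by apply: cR_inv; [apply: cR_pc; cont|have := pc_gt0 t; lra]. Qed.

(* The factor [(1 + t)^(-mu/2)] removes the damping term (Liouville transformation). *)
Lemma damped_sol_spec (k : nat) (mu nu2 kappa : R) (P : nat -> R -> R) (u0 u1 : ('I_k.*2.+3 -> R) -> R)
    (f : R -> ('I_k.*2.+3 -> R) -> R) :
  let lam := (1 - delta mu nu2) / 4 in
  let u t x := Rpower (pc t) (- mu / 2) * sol kappa P u0 (fun x => mu / 2 * u0 x + u1 x) (source mu f) t x in
  legendre lam kappa P -> ck k.+3 u0 -> ck k.+2 u1 -> Ck k.+2 (fun b => f (Rmax b 0)) ->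
  exists ut utt ui uti uij, [/\ C2d u ut utt ui uti uij,
    forall t x, 0 < t -> utt t x - \rsum_(i < k.*2.+3) uij i i t x
       + mu / (1 + t) * ut t x + nu2 / (1 + t) ^ 2 * u t x = kappa * f t x,
    forall x, u 0 x = kappa * u0 x
    & forall x, ut 0 x = kappa * u1 x].
Proof.
move=> lam u hP h0 h1 hf.
have hU1 : ck k.+2 (fun x => mu / 2 * u0 x + u1 x).
  by apply: Ck_plus => //; apply: Ck_scal; [move=> b; exact: cR_const|exact: Ck_S].
have hF : Ck k.+2 (source mu f) by apply: Ck_scal => // b; exact: Rpower_pc_continuous.
have [Ut [Utt [Ui [Uti [Uij [hU pde i0 i1]]]]]] := sol_spec hP h0 hU1 hF.
set a := - mu / 2.
pose g t := Rpower (pc t) a.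
pose g1 t := a * Rpower (pc t) a * / pc t.
pose g2 t := a * (a - 1) * Rpower (pc t) a * (/ pc t) ^ 2.
have cg t : continuous g t by exact: Rpower_pc_continuous.
have ci := inv_pc_continuous.
have cg1 t : continuous g1 t by rewrite /g1; cont; exact: cg.
have cg2 t : continuous g2 t by rewrite /g2; cont; exact: cg.
have dg t : 0 < t -> is_derive g t (g1 t) by exact: is_derive_Rpower_pc.
have dg1 t : 0 < t -> is_derive g1 t (g2 t).
  move=> ht; have hi : is_derive (fun t => / pc t) t (- (/ pc t) ^ 2).
    apply: (dR_pc (f := fun p => / p)) => //.
    have -> : pc t = 1 + t by rewrite pc_eq //; lra.
    by apply: dR_eq; [apply: (is_derive_inv (fun p => p)); [exact: dR_id|lra]|rewrite /=; field; lra].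
  apply: dR_eq.
    by apply: dR_mult; [apply: dR_scal; exact: is_derive_Rpower_pc|exact: hi].
  by rewrite /g2 /=; field; have := pc_gt0 t; lra.
do 5 eexists; split; first exact: (C2d_time hU cg cg1 cg2 dg dg1).
- move=> t x ht; have := pde t x ht; rewrite -big_scal /u -/a -/(g t).
  have e : pc t = 1 + t by rewrite pc_eq //; lra.
  set U := sol _ _ _ _ _ t x; move: (Utt t x) (\big[_/_]_(i < _) _) (Ut t x) => A B D.
  have hs : g t * source mu f t x = f t x.
    rewrite /source /g -Rmult_assoc -Rpower_plus (_ : a + mu / 2 = 0) ?Rpower_O; try exact: pc_gt0.
      by rewrite Rmult_1_l Rmax_left //; lra.
    by rewrite /a; field.
  move=> h.
  have -> : kappa * f t x = g t * (kappa * source mu f t x) by rewrite -hs; ring.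
  (* The powers of 1 + t match because a (a - 1) + mu a + nu2 with a = - mu / 2 equals nu2 + mu / 2
     - mu^2 / 4, which is (1 - delta) / 4. *)
  rewrite -h /g1 /g2 -/(g t) e /lam /delta /a; field; lra.
- move=> x; rewrite /u i0 (_ : pc 0 = 1); last by rewrite pc_eq; lra.
  by rewrite /Rpower ln_1 Rmult_0_r exp_0; ring.
move=> x; cbv beta; rewrite i0 i1 /g /g1 (_ : pc 0 = 1); last by rewrite pc_eq; lra.
by rewrite /Rpower ln_1 Rmult_0_r exp_0 /a; field.
Qed.

(** * Uniqueness *)

(** As [C2d], without the assertion that the two mixed derivatives agree. *)
Definition C2w (n : nat) (U Ut Utt : R -> ('I_n -> R) -> R) (Ui Uti : 'I_n -> R -> ('I_n -> R) -> R)
    (Uij : 'I_n -> 'I_n -> R -> ('I_n -> R) -> R) : Prop :=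
  let c (F : R -> ('I_n -> R) -> R) := forall p : R * ('I_n -> R), continuous (fun p => F p.1 p.2) p in
  let dt (F G : R -> ('I_n -> R) -> R) := forall t x, 0 < t -> is_derive (F^~ x) t (G t x) in
  let dx (F : R -> ('I_n -> R) -> R) i (G : R -> ('I_n -> R) -> R) :=
    forall t x, is_derive (fun h => F t (shift x i h)) 0 (G t x) in
  [/\ c U /\ c Ut /\ c Utt,
      forall i, c (Ui i) /\ c (Uti i) /\ (forall j, c (Uij i j)),
      dt U Ut /\ dt Ut Utt
    & forall i, [/\ dt (Ui i) (Uti i), dx U i (Ui i) & forall j, dx (Ui i) j (Uij i j)]].

(** exp (- c t) e(t) does not increase. The mean value theorem takes the derivative in the open
    interval only, so t = 0 needs no more than continuity. *)
Lemma gronwall_le0 (e de : R -> R) (c T : R) :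
  (forall t, continuous e t) -> e 0 = 0 ->
  (forall t, 0 < t < T -> is_derive e t (de t) /\ de t <= c * e t) -> 0 < T -> e T <= 0.
Proof.
move=> ce e0 he hT.
pose g t := exp (- c * t) * e t.
have dexp t : is_derive (fun t => exp (- c * t)) t (exp (- c * t) * (- c)).
  apply: (dR_comp (f := exp)); first exact: is_derive_exp.
  by apply: dR_eq; [apply: dR_scal; exact: dR_id|ring].
have hg t : 0 < t < T -> is_derive g t (exp (- c * t) * (de t - c * e t)).
  move=> ht; apply: dR_eq; first by apply: dR_mult; [exact: dexp|exact: (he t ht).1].
  by rewrite /=; ring.
have cg t : continuous g t by apply: cR_mult => //; exact: dR_cont (dexp t).
have hle : g T <= g 0.
  have hpr t : 0 < t < T -> derivable_pt g t.
    by move=> ht; exists (exp (- c * t) * (de t - c * e t)); apply/is_derive_Reals; exact: hg.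
  have [x [hx ->]] : exists x, 0 < x < T /\ g T = g 0 + exp (- c * x) * (de x - c * e x) * T.
    have hid t : 0 < t < T -> derivable_pt id t by move=> _; exact: derivable_pt_id.
    have [x [hx hm]] := MVT g id 0 T hpr hid hT (fun t _ => proj2 (continuity_pt_filterlim g t) (cg t))
      (fun t _ => derivable_continuous_pt _ _ (derivable_pt_id t)).
    exists x; split=> //; move: hm.
    have -> : derive_pt id x (hid x hx) = 1.
      by apply: derive_pt_eq_0; exact: derivable_pt_lim_id.
    have -> : derive_pt g x (hpr x hx) = exp (- c * x) * (de x - c * e x).
      by apply: derive_pt_eq_0; apply/is_derive_Reals; exact: hg.
    rewrite /id; lra.
  have [_ h2] := he x hx; have h1 := exp_pos (- c * x).
  have h3 : 0 <= exp (- c * x) * (c * e x - de x) * T.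
    by apply: Rmult_le_pos; [apply: Rmult_le_pos; lra|lra].
  lra.
rewrite {2}/g e0 Rmult_0_r /g in hle.
have h1 := exp_pos (- c * T).
by apply: (Rmult_le_reg_l (exp (- c * T))) => //; lra.
Qed.

Lemma usi_mean_continuous (n : nat) (F : R -> ('I_n -> R) -> ('I_n -> R) -> R) (x0 : 'I_n -> R) :
  (forall p : R * ('I_n -> R) * ('I_n -> R), continuous (fun p => F p.1.1 p.1.2 p.2) p) ->
  forall p : R * R, continuous (fun p : R * R => usi (fun w => F p.1 w (ray x0 p.2 w))) p.
Proof.
move=> h p; apply: (usi_continuous (T := prod_UniformSpace R_UniformSpace R_UniformSpace)
  (F := fun p w => F p.1 w (ray x0 p.2 w))) => q.
by apply: (c_comp3 (h := F)) => //; cont; apply: c_ray; cont.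
Qed.

Lemma usi_mean_dt (n : nat) (F G : R -> ('I_n -> R) -> ('I_n -> R) -> R) (x0 : 'I_n -> R) (t r : R) :
  (forall p : R * ('I_n -> R) * ('I_n -> R), continuous (fun p => F p.1.1 p.1.2 p.2) p) ->
  (forall p : R * ('I_n -> R) * ('I_n -> R), continuous (fun p => G p.1.1 p.1.2 p.2) p) ->
  (forall t w z, 0 < t -> is_derive (fun t => F t w z) t (G t w z)) -> 0 < t ->
  is_derive (fun t => usi (fun w => F t w (ray x0 r w))) t (usi (fun w => G t w (ray x0 r w))).
Proof.
move=> hF hG hd ht.
apply: (is_derive_usi (f := fun t w => F t w (ray x0 r w)) (df := fun t w => G t w (ray x0 r w))).
- by apply: filter_imp (open_gt 0 t ht) => u hu w; exact: hd.
- by move=> p; apply: (c_comp3 (h := G)) => //; cont; apply: c_ray; cont.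
by move=> u w; apply: (c_comp3 (h := F)) => //; cont; apply: c_ray; cont.
Qed.

Lemma usi_mean_dr (n : nat) (F : R -> ('I_n -> R) -> ('I_n -> R) -> R)
    (G : R -> 'I_n -> ('I_n -> R) -> ('I_n -> R) -> R) (x0 : 'I_n -> R) (t r : R) :
  (forall p : R * ('I_n -> R) * ('I_n -> R), continuous (fun p => F p.1.1 p.1.2 p.2) p) ->
  (forall j (p : R * ('I_n -> R) * ('I_n -> R)), continuous (fun p => G p.1.1 j p.1.2 p.2) p) ->
  (forall t w j z, is_derive (fun h => F t w (shift z j h)) 0 (G t j w z)) ->
  is_derive (fun r => usi (fun w => F t w (ray x0 r w))) r
    (usi (fun w => \rsum_(j < n) (w j * G t j w (ray x0 r w)))).
Proof.
move=> hF hG hd.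
apply: (is_derive_usi (f := fun r w => F t w (ray x0 r w))
  (df := fun r w => \rsum_(j < n) (w j * G t j w (ray x0 r w)))).
- apply: filter_forall => s w.
  apply: (chain_curve (g := F t w) (dg := fun j => G t j w) (z := fun r => ray x0 r w)) => //.
    by move=> j z; apply: (c_comp3 (h := fun t => G t j)); [exact: (hG j)|cont|cont|cont].
  move=> j; rewrite /ray; apply: dR_eq.
    by apply: dR_plus; [exact: dR_const|apply: dR_mult; [exact: dR_id|exact: dR_const]].
  by rewrite /=; ring.
- move=> p; apply: c_big => j; apply: cR_mult; first by apply: (c_coord (f := snd)); cont.
  by apply: (c_comp3 (h := fun t => G t j)); [exact: (hG j)|cont|cont|apply: c_ray; cont].
by move=> u w; apply: (c_comp3 (h := F)) => //; cont; apply: c_ray; cont.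
Qed.

(* Spherical means reduce the energy estimate on backward light cones to one space variable. *)
Lemma radial_energy (n : nat) (mu nu2 : R) (M Mt Mtt Mr Mrr ML N : R -> R -> R) (t0 rho0 : R) :
  let c (F : R -> R -> R) := forall p : R * R, continuous (fun p => F p.1 p.2) p in
  c M -> c Mt -> c Mtt -> c Mr -> c ML -> c N ->
  (forall t r, 0 < t -> is_derive (M^~ r) t (Mt t r)) ->
  (forall t r, 0 < t -> is_derive (Mt^~ r) t (Mtt t r)) ->
  (forall t r, 0 < t -> is_derive (Mr^~ r) t (N t r)) ->
  (forall t r, is_derive (M t) r (Mr t r)) ->
  (forall t r, is_derive (Mr t) r (Mrr t r)) ->
  (forall t r, r * Mrr t r + INR n.+1 * Mr t r = r * ML t r) ->
  (forall t r, 0 < t -> Mtt t r - ML t r + mu / (1 + t) * Mt t r + nu2 / (1 + t) ^ 2 * M t r = 0) ->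
  0 <= mu -> 0 <= nu2 ->
  (forall r, M 0 r = 0) -> (forall r, Mt 0 r = 0) -> (forall r, Mr 0 r = 0) ->
  0 < t0 -> 0 < rho0 ->
  RInt (fun r => r ^ n.+1 * (Mt t0 r ^ 2 + Mr t0 r ^ 2 + M t0 r ^ 2)) 0 rho0 <= 0.
Proof.
move=> c cM cMt cMtt cMr cML cN dM dMt dMr rM rMr darb pde hmu hnu i0 i1 i2 ht0 hr0.
(* The backward cone r <= T - t has radius rho0 at time t0. *)
pose T := t0 + rho0.
pose D t r := r ^ n.+1 * (Mt t r ^ 2 + Mr t r ^ 2 + M t r ^ 2).
pose Dt t r := 2 * r ^ n.+1 * (Mt t r * Mtt t r + Mr t r * N t r + M t r * Mt t r).
(* By Darboux's equation this is the r-derivative of the flux 2 r^(n+1) Mt Mr; the weight r^(n+1)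
   absorbs the first-order term (n+1) Mr / r. *)
pose B t r := 2 * r ^ n.+1 * (N t r * Mr t r + Mt t r * ML t r).
pose e t := RInt (D t) 0 (T - t).
have cs (F : R -> R -> R) t r : c F -> continuous (F t) r by move=> h; exact: c_slice.
have cD : c D by move=> p; rewrite /D; cont; [exact: cMt|exact: cMr|exact: cM].
have cDt : c Dt.
  by move=> p; rewrite /Dt; cont; [exact: cMt|exact: cMtt|exact: cMr|exact: cN|exact: cM|exact: cMt].
have cB t r : continuous (B t) r.
  by rewrite /B; cont; apply: cs.
have ce t : continuous e t.
  by apply: (continuous_RInt_var (F := D) (c := fun t => T - t)) => // u; cont.
have e0 : e 0 = 0.
  rewrite /e (cR_RInt_ext (g := fun _ => 0)); last by move=> r _; rewrite /D i0 i1 i2; ring.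
  by rewrite RInt_const /scal /= /mult /= Rmult_0_r.
have de t : 0 < t -> is_derive e t (D t (T - t) * -1 + RInt (Dt t) 0 (T - t)).
  move=> ht; apply: (is_derive_RInt_var (f := D) (df := Dt) (c := fun t => T - t)) => //.
  - apply: filter_imp (open_gt 0 t ht) => u hu r; apply: dR_eq.
      by apply: dR_scal; apply: dR_plus; [apply: dR_plus|]; apply: dR_pow; [exact: dMt|exact: dMr|exact: dM].
    by rewrite /Dt /=; ring.
  - by move=> u r; exact: cs.
  - by apply: dR_eq; [apply: dR_minus; [exact: dR_const|exact: dR_id]|ring].
have dB t r : 0 < t -> is_derive (fun r => 2 * (r ^ n.+1 * (Mt t r * Mr t r))) r (B t r).
  move=> ht.
  (* [N] is known as the time derivative of [Mr]; the interchange lemma makes it the r-derivative of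
     [Mt] as well. *)
  have dN : is_derive (Mt t) r (N t r).
    apply: (schwarz (f := M) (fh := Mr)) => //.
    - by apply: filter_imp (open_gt 0 t ht) => u hu s; exact: dM.
    - by apply: filter_forall.
    - by apply: filter_imp (open_gt 0 t ht) => u hu s; exact: dMr.
    - by move=> u s; exact: cs.
  apply: dR_eq.
    by apply: dR_scal; apply: dR_mult; [apply: dR_pow; exact: dR_id|apply: dR_mult; [exact: dN|exact: rMr]].
  rewrite /B -[n.+1.-1]/n.
  have -> : r ^ n.+1 = r ^ n * r by rewrite /=; ring.
  have := darb t r; move: (INR n.+1) (r ^ n) (Mrr t r) (Mr t r) (ML t r) => x y a b d h.
  have -> : 2 * (y * r) * (N t r * b + Mt t r * d) = 2 * y * (r * N t r * b + Mt t r * (r * d)) by ring.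
  by rewrite -h; ring.
have point t r : 0 < t -> 0 <= r -> Dt t r - B t r <= (1 + nu2) * D t r.
  move=> ht hr; have := pde t r ht; rewrite /Dt /B /D.
  have hq : 0 <= nu2 / (1 + t) ^ 2 <= nu2.
    have h1 : 1 <= (1 + t) ^ 2 by nra.
    split; first by apply: Rdiv_le_0_compat => //; lra.
    apply: (Rmult_le_reg_r ((1 + t) ^ 2)); first lra.
    by rewrite /Rdiv Rmult_assoc Rinv_l; [nra|lra].
  have hm : 0 <= mu / (1 + t) by apply: Rdiv_le_0_compat => //; lra.
  have hp : 0 <= r ^ n.+1 by exact: pow_le.
  move: hq hm hp; move: (nu2 / _) (mu / _) (r ^ n.+1) => q m y hq hm hp.
  move: (Mtt t r) (ML t r) (Mt t r) (Mr t r) (M t r) (N t r) => a b v d w z h.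
  (* After insertion of the equation the damping contributes - 2 m v^2 <= 0, and the rest is 2 (1 -
     q) w v with |1 - q| <= 1 + nu2 because 0 <= q <= nu2. This fixes the Gronwall constant and
     explains the term M^2 in the energy. *)
  have key : 2 * (v * (a - b) + w * v) <= (1 + nu2) * (v ^ 2 + d ^ 2 + w ^ 2).
    have -> : a - b = - (m * v) - q * w by lra.
    have h1 : 0 <= m * v ^ 2 by apply: Rmult_le_pos => //; exact: pow2_ge_0.
    have h2 : 2 * (1 - q) * (w * v) <= (1 + nu2) * (v ^ 2 + w ^ 2).
      have g1 : 0 <= (1 + nu2 - (1 - q)) * (v + w) ^ 2 by apply: Rmult_le_pos; [lra|exact: pow2_ge_0].
      have g2 : 0 <= (1 + nu2 + (1 - q)) * (v - w) ^ 2 by apply: Rmult_le_pos; [lra|exact: pow2_ge_0].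
      nra.
    have h3 : 0 <= (1 + nu2) * d ^ 2 by apply: Rmult_le_pos; [lra|exact: pow2_ge_0].
    nra.
  have -> : 2 * y * (v * a + d * z + w * v) - 2 * y * (z * d + v * b) = y * (2 * (v * (a - b) + w * v)) by ring.
  have -> : (1 + nu2) * (y * (v ^ 2 + d ^ 2 + w ^ 2)) = y * ((1 + nu2) * (v ^ 2 + d ^ 2 + w ^ 2)) by ring.
  exact: Rmult_le_compat_l.
have -> : rho0 = T - t0 by rewrite /T; ring.
apply: (gronwall_le0 (e := e) (de := fun t => D t (T - t) * -1 + RInt (Dt t) 0 (T - t)) (c := 1 + nu2)
  (T := t0)) => // t ht.
split; first by apply: de; lra.
have ht' : 0 < t by lra.
have hT : 0 < T - t by rewrite /T; lra.
have cDtB s : continuous (fun r => Dt t r - B t r) s by apply: cR_minus; [exact: cs|exact: cB].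
have e1 : RInt (Dt t) 0 (T - t) = RInt (fun r => Dt t r - B t r) 0 (T - t) + RInt (B t) 0 (T - t).
  rewrite -cR_RInt_plus //; try by move=> s; exact: cs.
  by apply: cR_RInt_ext => r _; ring.
have e2 : RInt (B t) 0 (T - t) = 2 * ((T - t) ^ n.+1 * (Mt t (T - t) * Mr t (T - t))).
  rewrite (RInt_derive 0 (T - t) (fun r => dB t r ht')) //.
  by rewrite pow_i; [rewrite /=; ring|exact/ltP].
have e3 : RInt (fun r => Dt t r - B t r) 0 (T - t) <= (1 + nu2) * e t.
  rewrite /e -cR_RInt_scal; last by move=> s; exact: cs.
  apply: RInt_le; first lra.
  - exact: cR_ex_RInt.
  - by apply: cR_ex_RInt => s; apply: cR_mult; [exact: cR_const|exact: cs].
  by move=> r hr; apply: point => //; lra.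
rewrite e1 e2 /=.
(* The cone shrinks with speed 1, so the loss of the energy density at its edge dominates the flux,
   by 2 u v <= u^2 + v^2. *)
suff : 2 * ((T - t) ^ n.+1 * (Mt t (T - t) * Mr t (T - t))) <= D t (T - t) by move: e3; rewrite /=; lra.
rewrite /D; have hp : 0 <= (T - t) ^ n.+1 by apply: pow_le; lra.
move: hp; move: ((T - t) ^ n.+1) (Mt _ _) (Mr _ _) (M _ _) => y u v w hp.
have -> : 2 * (y * (u * v)) = y * (2 * (u * v)) by ring.
apply: Rmult_le_compat_l => //.
have := pow2_ge_0 (u - v); have := pow2_ge_0 w; nra.
Qed.

(** The primitive of D is both nonnegative and nonpositive for positive radii, hence zero there, and
    D is its derivative. *)
Lemma zero_of_RInt_le0 (D : R -> R) (r : R) :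
  (forall s, continuous D s) -> (forall s, 0 < s -> 0 <= D s) ->
  (forall rho, 0 < rho -> RInt D 0 rho <= 0) -> 0 < r -> D r = 0.
Proof.
move=> cD D0 h hr.
apply: (is_derive_unique_eq (is_derive_RInt_upper r cD)).
apply: (is_derive_ext_loc (fun _ => 0)); last exact: dR_const.
apply: filter_imp (open_gt 0 r hr) => s hs; apply: Rle_antisym; last exact: h.
by apply: RInt_ge_0; [lra|exact: cR_ex_RInt|move=> u hu; apply: D0; lra].
Qed.

Lemma zero_at_0 (f : R -> R) : continuous f 0 -> (forall r, 0 < r -> f r = 0) -> f 0 = 0.
Proof.
move=> hf h; case: (Req_dec (f 0) 0) => // h0.
have hp : 0 < Rabs (f 0) by exact: Rabs_pos_lt.
have /filterlim_locally /(_ (mkposreal _ hp)) [d hd] := hf.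
have hdp := cond_pos d.
have := hd (d / 2); rewrite (h (d / 2)); last lra.
rewrite /ball /= /AbsRing_ball /= /abs /minus /plus /opp /= => H.
have h1 : Rabs (d / 2 + - 0) < d by rewrite Ropp_0 Rplus_0_r Rabs_pos_eq; lra.
by have := H h1; rewrite Rplus_0_l Rabs_Ropp; lra.
Qed.

(** The integrals over spheres about an arbitrary centre [x0] satisfy the radial problem with zero
    data, hence vanish for r > 0; by continuity so does the one of radius 0, which is W t x0 times
    the area of the unit sphere. *)
Lemma wave_unique (n : nat) (mu nu2 : R) W Wt Wtt Wi Wti Wij :
  @C2w n.+2 W Wt Wtt Wi Wti Wij -> 0 <= mu -> 0 <= nu2 ->
  (forall t x, 0 < t -> Wtt t x - \rsum_(i < n.+2) Wij i i t x + mu / (1 + t) * Wt t x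
      + nu2 / (1 + t) ^ 2 * W t x = 0) ->
  (forall x, W 0 x = 0) -> (forall x, Wt 0 x = 0) ->
  forall t x, 0 <= t -> W t x = 0.
Proof.
move=> [[c0 [c1 c2]] ci [d0 d1] hi] hmu hnu pde w0 w1 t x0 ht.
case: (Rle_lt_or_eq_dec _ _ ht) => [{}ht|<-]; last exact: w0.
pose Y := 'I_n.+2 -> R.
have lift0 (F : R -> Y -> R) : (forall p : R * Y, continuous (fun p => F p.1 p.2) p) ->
    forall p : R * Y * Y, continuous (fun p : R * Y * Y => F p.1.1 p.2) p.
  by move=> h p; apply: (c_comp2 (h := F)) => //; cont.
pose F0 (F : R -> Y -> R) (t : R) (w z : Y) := F t z.
pose F1 (G : 'I_n.+2 -> R -> Y -> R) (t : R) (w z : Y) := \rsum_(i < n.+2) (w i * G i t z).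
have cF1 G : (forall i (p : R * Y), continuous (fun p : R * Y => G i p.1 p.2) p) ->
    forall p : R * Y * Y, continuous (fun p : R * Y * Y => F1 G p.1.1 p.1.2 p.2) p.
  move=> h p; apply: c_big => i; apply: cR_mult.
    by apply: (c_coord (f := fun p : R * Y * Y => p.1.2)); cont.
  exact: (lift0 (G i) (h i)).
pose S (F : R -> Y -> Y -> R) (t r : R) := usi (fun w => F t w (ray x0 r w)).
have cWi i := (ci i).1. have cWti i := (ci i).2.1. have cWij i j := (ci i).2.2 j.
have k0 := lift0 W c0. have k1 := lift0 Wt c1. have k2 := lift0 Wtt c2.
have ki i := lift0 (Wi i) (cWi i). have kti i := lift0 (Wti i) (cWti i).
have kij i j := lift0 (Wij i j) (cWij i j).
pose L t z := \rsum_(i < n.+2) Wij i i t z.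
have cL (p : R * Y) : continuous (fun p : R * Y => L p.1 p.2) p.
  by apply: c_big => i; exact: cWij.
have kL := lift0 L cL.
pose F2 t (w z : Y) := \rsum_(j < n.+2) (w j * \rsum_(i < n.+2) (w i * Wij i j t z)).
have cF2 (p : R * Y * Y) : continuous (fun p : R * Y * Y => F2 p.1.1 p.1.2 p.2) p.
  apply: c_big => j; apply: cR_mult; first by apply: (c_coord (f := fun p : R * Y * Y => p.1.2)); cont.
  apply: c_big => i; apply: cR_mult; first by apply: (c_coord (f := fun p : R * Y * Y => p.1.2)); cont.
  exact: kij.
have darb s r : r * S F2 s r + INR n.+1 * S (F1 Wi) s r = r * S (F0 L) s r.
  have H := @darboux_sphere n.+1 (fun i v => Wi i s (fun l => x0 l + v l))
    (fun i j v => Wij i j s (fun l => x0 l + v l)) r.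
  have -> : S F2 s r = usi (fun w => \rsum_(i < n.+2) (w i * \rsum_(j < n.+2) (w j * Wij i j s (fun l => x0 l + r * w l)))).
    rewrite /S /F2; congr usi; apply: functional_extensionality => w.
    rewrite (eq_bigr (fun j => \rsum_(i < n.+2) (w j * (w i * Wij i j s (ray x0 r w)))));
      last by move=> j _; rewrite big_scal.
    rewrite exchange_big /=; apply: eq_bigr => i _; rewrite big_scal; apply: eq_bigr => j _.
    by rewrite /ray; ring.
  apply: H.
  - move=> i v; apply: (c_comp2 (h := Wi i)) => //; first exact: cR_const.
    by apply: c_coords => l; cont; apply: (c_coord (f := id)); cont.
  - move=> i j v; apply: (c_comp2 (h := Wij i j)) => //; first exact: cR_const.
    by apply: c_coords => l; cont; apply: (c_coord (f := id)); cont.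
  move=> i j v; have [_ _ h] := hi i.
  apply: (dR_ext (f := fun h => Wi i s (shift (fun l => x0 l + v l) j h))); last exact: h.
  move=> u; congr (Wi _ _ _); apply: functional_extensionality => l.
  by rewrite /shift; case: eqP => _ //; ring.
have pdeM s r : 0 < s -> S (F0 Wtt) s r - S (F0 L) s r + mu / (1 + s) * S (F0 Wt) s r
    + nu2 / (1 + s) ^ 2 * S (F0 W) s r = 0.
  move=> hs.
  have cc (F : R -> Y -> R) : (forall p : R * Y, continuous (fun p : R * Y => F p.1 p.2) p) ->
      forall w : Y, continuous (fun w : Y => F s (ray x0 r w)) w.
    by move=> h w; apply: (c_comp2 (h := F)) => //; [exact: cR_const|apply: c_ray; cont].
  have -> : S (F0 Wtt) s r = S (fun t w z => 1 * L t z + -1 * (mu / (1 + s) * Wt t z + nu2 / (1 + s) ^ 2 * W t z)) s r.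
    rewrite /S /F0; congr usi; apply: functional_extensionality => w.
    by have := pde s (ray x0 r w) hs; rewrite -/(L s _); lra.
  rewrite /S /F0 usi_lin2; first last.
  - by move=> w; cont; [exact: (cc Wt)|exact: (cc W)].
  - exact: (cc L).
  rewrite (@usi_lin2 _ _ _ (fun w => Wt s (ray x0 r w)) (fun w => W s (ray x0 r w))); first ring.
  - exact: (cc Wt).
  - exact: (cc W).
have wi0 i z : Wi i 0 z = 0.
  have [_ h _] := hi i.
  apply: (is_derive_unique_eq (h 0 z)); apply: (dR_ext (f := fun _ => 0)); last exact: dR_const.
  by move=> u; rewrite w0.
have usi0 : usi (fun _ : Y => 0) = 0.
  have h : usi (fun _ : Y => 0 * 0) = 0 * usi (fun _ : Y => 0).
    by apply: usi_scal => z; exact: cR_const.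
  by rewrite !Rmult_0_l in h.
have E rho (hr : 0 < rho) : RInt (fun r => r ^ n.+1 * (S (F0 Wt) t r ^ 2 + S (F1 Wi) t r ^ 2 + S (F0 W) t r ^ 2)) 0 rho <= 0.
  apply: (@radial_energy n mu nu2 (S (F0 W)) (S (F0 Wt)) (S (F0 Wtt)) (S (F1 Wi)) (S F2) (S (F0 L)) (S (F1 Wti))) => //.
  - exact: (@usi_mean_continuous _ (F0 W) x0 k0).
  - exact: (@usi_mean_continuous _ (F0 Wt) x0 k1).
  - exact: (@usi_mean_continuous _ (F0 Wtt) x0 k2).
  - exact: (@usi_mean_continuous _ (F1 Wi) x0 (cF1 _ cWi)).
  - exact: (@usi_mean_continuous _ (F0 L) x0 kL).
  - exact: (@usi_mean_continuous _ (F1 Wti) x0 (cF1 _ cWti)).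
  - move=> s r hs; exact: (@usi_mean_dt _ (F0 W) (F0 Wt) x0 s r k0 k1 (fun u w z hu => d0 u z hu) hs).
  - move=> s r hs; exact: (@usi_mean_dt _ (F0 Wt) (F0 Wtt) x0 s r k1 k2 (fun u w z hu => d1 u z hu) hs).
  - move=> s r hs; apply: (@usi_mean_dt _ (F1 Wi) (F1 Wti) x0 s r (cF1 _ cWi) (cF1 _ cWti) _ hs) => u w z hu.
    by apply: dR_big => i; apply: dR_scal; have [h _ _] := hi i; exact: h.
  - move=> s r; apply: (@usi_mean_dr _ (F0 W) (fun t j w z => Wi j t z) x0 s r k0 ki) => u w j z.
    by have [_ h _] := hi j; exact: h.
  - move=> s r; apply: (@usi_mean_dr _ (F1 Wi) (fun t j w z => \rsum_(i < n.+2) (w i * Wij i j t z)) x0 s r (cF1 _ cWi)).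
      move=> j; exact: (cF1 (fun i => Wij i j) (fun i => cWij i j)).
    by move=> u w j z; apply: dR_big => i; apply: dR_scal; have [_ _ h] := hi i; exact: h.
  - by move=> r; rewrite -[RHS]usi0; congr usi; apply: functional_extensionality => w; exact: w0.
  - by move=> r; rewrite -[RHS]usi0; congr usi; apply: functional_extensionality => w; exact: w1.
  move=> r; rewrite -[RHS]usi0; congr usi; apply: functional_extensionality => w.
  by rewrite /F1 big1 // => i _; rewrite wi0 Rmult_0_r.
have cS (F : R -> Y -> Y -> R) r : (forall p : R * Y * Y, continuous (fun p : R * Y * Y => F p.1.1 p.1.2 p.2) p) -> continuous (S F t) r.
  by move=> h; apply: c_slice => p; exact: (@usi_mean_continuous _ F x0 h).
have M0 r : 0 < r -> S (F0 W) t r = 0.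
  move=> hr.
  have := @zero_of_RInt_le0 (fun r => r ^ n.+1 * (S (F0 Wt) t r ^ 2 + S (F1 Wi) t r ^ 2 + S (F0 W) t r ^ 2)) r.
  move=> H; have hp : 0 < r ^ n.+1 by exact: pow_lt.
  have : r ^ n.+1 * (S (F0 Wt) t r ^ 2 + S (F1 Wi) t r ^ 2 + S (F0 W) t r ^ 2) = 0.
    apply: H => // s.
      by cont; apply: cS => //; exact: cF1.
    move=> hs; apply: Rmult_le_pos; first by apply: pow_le; lra.
    have := pow2_ge_0 (S (F0 Wt) t s); have := pow2_ge_0 (S (F1 Wi) t s); have := pow2_ge_0 (S (F0 W) t s); lra.
  move=> /Rmult_integral [|]; first by move=> h; exfalso; lra.
  have := pow2_ge_0 (S (F0 Wt) t r); have := pow2_ge_0 (S (F1 Wi) t r); have := pow2_ge_0 (S (F0 W) t r).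
  move: (S (F0 W) t r) => u h1 h2 h3 h4.
  have : u ^ 2 = 0 by lra.
  by move=> hu; apply: Rsqr_0_uniq; rewrite /Rsqr; lra.
have : S (F0 W) t 0 = 0 by apply: zero_at_0 => //; exact: cS.
have -> : S (F0 W) t 0 = W t x0 * usi (fun _ : Y => 1).
  rewrite -usi_scal; last by move=> w; exact: cR_const.
  rewrite /S /F0; congr usi; apply: functional_extensionality => w; rewrite Rmult_1_r; congr W.
  by apply: functional_extensionality => i; rewrite /ray; ring.
by move=> /Rmult_integral [//|]; have := @usi_1_neq0 n.+1.
Qed.

(** * Complex-valued solutions and their components *)

Notation diffR f F a :=
  (filterdiff (K := R_AbsRing) (U := R_NormedModule) (V := R_NormedModule) f F (fun h => scal h (a : R_NormedModule))).
Notation diffC f F a :=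
  (filterdiff (K := R_AbsRing) (U := R_NormedModule) (V := C_R_NormedModule) f F (fun h => scal h (a : C_R_NormedModule))).

Lemma filterdiff_pair (F : (R -> Prop) -> Prop) {FF : Filter F} (f g : R -> R) (a b : R) :
  diffR f F a -> diffR g F b -> diffC (fun s => (f s, g s)) F (a, b).
Proof.
move=> [_ hf] [_ hg]; split; first exact: is_linear_scal_l.
move=> x hx e.
(* The norm of a pair is at most sqrt 2 <= 2 times the larger of the two component norms. *)
have he : 0 < e / 2 by have := cond_pos e; lra.
have h1 := hf x hx (mkposreal _ he); have h2 := hg x hx (mkposreal _ he).
apply: filter_imp (filter_and _ _ h1 h2) => y /= [k1 k2].
have [_] := norm_prod (K := R_AbsRing) (U := R_NormedModule) (V := R_NormedModule)
  (minus (minus (f y) (f x)) (scal (minus y x) (a : R_NormedModule)))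
  (minus (minus (g y) (g x)) (scal (minus y x) (b : R_NormedModule))).
move=> h; apply: Rle_trans h _.
have hs : sqrt 2 <= 2.
  by rewrite -[X in _ <= X](sqrt_square 2); [apply: sqrt_le_1; lra|lra].
move: k1 k2; set u := norm _; set v := norm (minus (minus (g y) _) _); set w := norm _ => k1 k2.
have hm : Rmax u v <= e / 2 * w by apply: Rmax_lub.
have h0 : 0 <= Rmax u v by apply: Rle_trans (Rmax_l _ _); exact: norm_ge_0.
have h2' : sqrt 2 * Rmax u v <= 2 * Rmax u v by apply: Rmult_le_compat_r.
lra.
Qed.

Lemma filterdiff_components (F : (R -> Prop) -> Prop) {FF : Filter F} (u : R -> C) (l : C) :
  diffC u F l -> diffR (fun s => Re (u s)) F (Re l) /\ diffR (fun s => Im (u s)) F (Im l).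
Proof.
move=> [_ h]; split; (split; first exact: is_linear_scal_l); move=> x hx e;
  apply: filter_imp (h x hx e) => y hy; apply: Rle_trans hy;
  have [hm _] := norm_prod (K := R_AbsRing) (U := R_NormedModule) (V := R_NormedModule)
   (minus (minus (Re (u y)) (Re (u x))) (scal (minus y x) (Re l : R_NormedModule)))
   (minus (minus (Im (u y)) (Im (u x))) (scal (minus y x) (Im l : R_NormedModule)));
  apply: Rle_trans hm; [exact: Rmax_l|exact: Rmax_r].
Qed.

Lemma is_derive_C_pair (f g : R -> R) (t a b : R) :
  is_derive f t a -> is_derive g t b ->
  is_derive (V := C_R_NormedModule) (fun s => (f s, g s) : C) t (a, b).
Proof. by move=> hf hg; apply: filterdiff_pair. Qed.

Lemma is_derive_C_components (u : R -> C) (t : R) (l : C) :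
  is_derive (V := C_R_NormedModule) u t l ->
  is_derive (fun s => Re (u s)) t (Re l) /\ is_derive (fun s => Im (u s)) t (Im l).
Proof. exact: filterdiff_components. Qed.

(** * One-sided derivatives at t = 0 *)

Notation half t := (within (Rle 0) (locally t)).

Lemma half_proper (t : R) : 0 <= t -> ProperFilter (half t).
Proof.
move=> ht; constructor; last by apply within_filter; apply locally_filter.
by move=> P hP; exists t; exact: (locally_singleton _ _ hP).
Qed.

Lemma half_lim (t : R) : is_filter_lim (half t) t.
Proof. by move=> P hP; apply: filter_imp hP => y. Qed.

Lemma half_lim_unique (t x : R) : 0 <= t -> is_filter_lim (half t) x -> x = t.
Proof.
move=> ht hx; have hp := half_proper ht.
exact: (@is_filter_lim_unique R_AbsRing R_NormedModule _ (@Proper_StrongProper _ _ hp) x t hx (@half_lim t)).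
Qed.

Lemma is_derive_ge0_interior (V : NormedModule R_AbsRing) (f : R -> V) (t : R) (l : V) :
  0 < t -> is_derive_ge0 f t l -> is_derive f t l.
Proof.
move=> ht [hl h]; split=> // x hx e.
have <- : t = x := is_filter_lim_locally_unique (V := R_NormedModule) _ _ hx.
have h1 := h t (@half_lim t) e; unfold within in h1.
apply: filter_imp (filter_and _ _ h1 (open_gt 0 t ht)) => y [k1 k2]; apply: k1; lra.
Qed.

(** By the mean value theorem a difference quotient at the boundary is a value of [df] at a nearby
    interior point, so continuity of [df] supplies the one-sided derivative. *)
Lemma is_derive_ge0_real (f df : R -> R) (t : R) :
  0 <= t -> (forall s, continuous f s) -> (forall s, continuous df s) ->
  (forall s, 0 < s -> is_derive f s (df s)) ->
  is_derive_ge0 (V := R_NormedModule) f t (df t).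
Proof.
move=> ht cf cdf hd; split; first exact: is_linear_scal_l.
move=> x hx e; rewrite (half_lim_unique ht hx).
have /filterlim_locally /(_ e) [d hdd] := cdf t.
exists d => s hs hs0.
have [y [hy hm]] : exists y, Rmin t s <= y <= Rmax t s /\ f s - f t = df y * (s - t).
  have h0 : 0 <= Rmin t s by apply: Rmin_glb.
  apply: MVT_gen => y hy; last by apply/continuity_pt_filterlim; exact: cf.
  by apply: hd; lra.
rewrite /norm /= /abs /= /minus /plus /opp /scal /= /mult /=.
have -> : f s + - f t + - ((s + - t) * df t) = (df y - df t) * (s + - t).
  have -> : f s + - f t = df y * (s - t) by rewrite -hm; ring.
  ring.
rewrite Rabs_mult; apply: Rmult_le_compat_r; first exact: Rabs_pos.
apply: Rlt_le; apply: (hdd y).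
move: hs; rewrite /ball /= /AbsRing_ball /= /abs /minus /plus /opp /= => hs.
apply: Rle_lt_trans hs.
move: hy; rewrite /Rmin /Rmax; case: Rle_dec => h hy.
  by rewrite !Rabs_pos_eq; lra.
by rewrite !Rabs_left1; lra.
Qed.

Lemma is_derive_ge0_0_unique (f : R -> R) (a b : R) :
  is_derive_ge0 (V := R_NormedModule) f 0 a -> is_derive_ge0 (V := R_NormedModule) f 0 b -> a = b.
Proof.
move=> [_ ha] [_ hb]; case: (Req_dec a b) => // hab.
(* With this tolerance the two linear approximations at d / 2 would differ by at most half of |a -
   b| * d / 2, whereas they differ by all of it. *)
have he : 0 < Rabs (a - b) / 4 by have := Rabs_pos_lt (a - b); lra.
have h1 := ha 0 (@half_lim 0) (mkposreal _ he); have h2 := hb 0 (@half_lim 0) (mkposreal _ he).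
have [d hd] := filter_and _ _ h1 h2.
have hdp := cond_pos d.
have hball : ball (0 : R_UniformSpace) d (d / 2).
  by rewrite /ball /= /AbsRing_ball /= /abs /minus /plus /opp /= Ropp_0 Rplus_0_r Rabs_pos_eq; lra.
have hle : 0 <= d / 2 by lra.
have [k1 k2] := hd _ hball hle; move: k1 k2.
rewrite /norm /= /abs /= /minus /plus /opp /scal /= /mult /= Ropp_0 Rplus_0_r (Rabs_pos_eq (d / 2)) //.
set z := f (d / 2) + _ => g1 g2.
have h3 : Rabs (d / 2 * (a - b)) <= Rabs (z + - (d / 2 * a)) + Rabs (z + - (d / 2 * b)).
  rewrite -(Rabs_Ropp (z + - (d / 2 * a))).
  have -> : d / 2 * (a - b) = - (z + - (d / 2 * a)) + (z + - (d / 2 * b)) by ring.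
  exact: Rabs_triang.
rewrite Rabs_mult (Rabs_pos_eq (d / 2)) // in h3.
have h5 : 0 < Rabs (a - b) by lra.
nra.
Qed.

Lemma CDerive_cder (g : R -> C) (t : R) (l : C) :
  is_derive (fun s => Re (g s)) t (Re l) -> is_derive (fun s => Im (g s)) t (Im l) -> CDerive g t = l.
Proof. by move=> h1 h2; rewrite /CDerive (is_derive_unique _ _ _ h1) (is_derive_unique _ _ _ h2); case: l h1 h2. Qed.

Lemma CDerive_ext_loc (g h : R -> C) (t : R) : locally t (fun s => g s = h s) -> CDerive g t = CDerive h t.
Proof.
by move=> e; rewrite /CDerive; congr pair; apply: Derive_ext_loc; apply: filter_imp e => s ->.
Qed.

Lemma CDerive2 (g g1 : R -> C) (t : R) (l : C) :
  locally t (fun s => is_derive (fun s => Re (g s)) s (Re (g1 s)) /\ is_derive (fun s => Im (g s)) s (Im (g1 s))) ->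
  is_derive (fun s => Re (g1 s)) t (Re l) -> is_derive (fun s => Im (g1 s)) t (Im l) ->
  CDerive (CDerive g) t = l.
Proof.
move=> h h1 h2; rewrite (CDerive_ext_loc (h := g1)); first exact: CDerive_cder.
by apply: filter_imp h => s [k1 k2]; exact: CDerive_cder.
Qed.

Lemma big_Re (I : finType) (F : I -> C) : Re (\big[Cplus/RtoC 0]_(i : I) F i) = \big[Rplus/0]_(i : I) Re (F i).
Proof. by elim/big_rec2: _ => // i x y _ <-. Qed.

Lemma big_Im (I : finType) (F : I -> C) : Im (\big[Cplus/RtoC 0]_(i : I) F i) = \big[Rplus/0]_(i : I) Im (F i).
Proof. by elim/big_rec2: _ => // i x y _ <-. Qed.

Lemma ge0_filterlim (n : nat) (u : R -> ('I_n -> R) -> C) (A B : R -> ('I_n -> R) -> R) :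
  (forall p : R * ('I_n -> R), continuous (fun p => A p.1 p.2) p) ->
  (forall p : R * ('I_n -> R), continuous (fun p => B p.1 p.2) p) ->
  (forall t x, 0 <= t -> u t x = (A t x, B t x)) ->
  forall t x, 0 <= t -> filterlim (fun p : R * ('I_n -> R) => u p.1 p.2)
    (within (fun p => 0 <= p.1) (locally (t, x))) (locally (u t x : C_R_NormedModule)).
Proof.
move=> hA hB hu t x ht.
apply: (filterlim_within_ext (fun p : R * ('I_n -> R) => 0 <= p.1) (fun p => (A p.1 p.2, B p.1 p.2))).
  by move=> [s y] /= hs; rewrite hu.
rewrite hu //; apply: (@filterlim_filter_le_1 _ _ (locally (t, x))); first exact: filter_le_within.
exact: (c_pair (hA (t, x)) (hB (t, x))).
Qed.

Lemma ge0_derive_pair (u : R -> C) (A At B Bt : R -> R) (t : R) :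
  0 <= t -> (forall s, continuous A s) -> (forall s, continuous At s) ->
  (forall s, continuous B s) -> (forall s, continuous Bt s) ->
  (forall s, 0 < s -> is_derive A s (At s)) -> (forall s, 0 < s -> is_derive B s (Bt s)) ->
  (forall s, 0 <= s -> u s = (A s, B s)) ->
  is_derive_ge0 (V := C_R_NormedModule) u t (At t, Bt t).
Proof.
move=> ht cA cAt cB cBt dA dB hu.
have hp := half_proper ht.
have H : diffC (fun s => (A s, B s)) (half t) (At t, Bt t).
  by apply: filterdiff_pair; exact: is_derive_ge0_real.
apply: (filterdiff_ext_loc (fun s => (A s, B s)) u) H => [|x hx].
  by exists (mkposreal 1 Rlt_0_1) => s _ hs; rewrite hu.
by rewrite (half_lim_unique ht hx) hu.
Qed.

(** * From pairs of real solutions to complex classical solutions, and back *)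

Lemma C2d_Ck_spacetime (n : nat) (u : R -> ('I_n -> R) -> C) A At Att Ai Ati Aij B Bt Btt Bi Bti Bij :
  @C2d n A At Att Ai Ati Aij -> @C2d n B Bt Btt Bi Bti Bij ->
  (forall t x, 0 <= t -> u t x = (A t x, B t x)) ->
  Ck_spacetime (V := C_R_NormedModule) 2 u.
Proof.
move=> [[a0 [a1 a2]] ai [da0 da1] dai] [[b0 [b1 b2]] bi [db0 db1] dbi] hu.
have sl (F : R -> ('I_n -> R) -> R) (x : 'I_n -> R) :
    (forall p : R * ('I_n -> R), continuous (fun p => F p.1 p.2) p) -> forall s, continuous (F^~ x) s.
  by move=> h s; exact: (c_slice_l (F := F)).
have dt u' F Ft G Gt (x : 'I_n -> R) t :
    (forall p : R * ('I_n -> R), continuous (fun p => F p.1 p.2) p) ->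
    (forall p : R * ('I_n -> R), continuous (fun p => Ft p.1 p.2) p) ->
    (forall p : R * ('I_n -> R), continuous (fun p => G p.1 p.2) p) ->
    (forall p : R * ('I_n -> R), continuous (fun p => Gt p.1 p.2) p) ->
    (forall t x, 0 < t -> is_derive (F^~ x) t (Ft t x)) -> (forall t x, 0 < t -> is_derive (G^~ x) t (Gt t x)) ->
    (forall t x, 0 <= t -> u' t x = (F t x, G t x) :> C) -> 0 <= t ->
    is_derive_ge0 (V := C_R_NormedModule) (fun s => u' s x) t (Ft t x, Gt t x).
  move=> f0 f1 g0 g1 dF dG hu' ht.
  apply: (@ge0_derive_pair (fun s => u' s x) (F^~ x) (Ft^~ x) (G^~ x) (Gt^~ x)) => //.
  - exact: sl.
  - exact: sl.
  - exact: sl.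
  - exact: sl.
  - by move=> s hs; exact: dF.
  - by move=> s hs; exact: dG.
  by move=> s hs; exact: hu'.
have triv (F G : R -> ('I_n -> R) -> R) : forall t x, 0 <= t -> (F t x, G t x) = (F t x, G t x) :> C by [].
split; first exact: (ge0_filterlim a0 b0 hu).
split.
  exists (fun t x => (At t x, Bt t x)); split; first by move=> t x ht; exact: (dt u A At B Bt).
  split; first exact: (ge0_filterlim a1 b1).
  split.
    exists (fun t x => (Att t x, Btt t x)); split.
      by move=> t x ht; exact: (dt (fun t x => (At t x, Bt t x)) At Att Bt Btt).
    by split=> //; exact: (ge0_filterlim a2 b2).
  move=> i; exists (fun t x => (Ati i t x, Bti i t x)); split.
    by move=> t x _; have [_ _ k _] := dai i; have [_ _ k' _] := dbi i; exact: is_derive_C_pair.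
  by split=> //; exact: (ge0_filterlim (ai i).2.1 (bi i).2.1).
move=> i; have [k1 k2 k3 k4] := dai i; have [l1 l2 l3 l4] := dbi i.
have [c1 [c2 c3]] := ai i; have [e1 [e2 e3]] := bi i.
exists (fun t x => (Ai i t x, Bi i t x)); split.
  move=> t x ht; apply: (is_derive_ext (fun h => (A t (shift x i h), B t (shift x i h)) : C_R_NormedModule)).
    by move=> h; rewrite hu.
  exact: is_derive_C_pair.
split; first exact: (ge0_filterlim c1 e1).
split.
  exists (fun t x => (Ati i t x, Bti i t x)); split.
    by move=> t x ht; exact: (dt (fun t x => (Ai i t x, Bi i t x)) (Ai i) (Ati i) (Bi i) (Bti i)).
  by split=> //; exact: (ge0_filterlim c2 e2).
move=> j; exists (fun t x => (Aij i j t x, Bij i j t x)); split.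
  by move=> t x _; exact: is_derive_C_pair.
by split=> //; exact: (ge0_filterlim (c3 j) (e3 j)).
Qed.

Lemma C2d_classical (n : nat) (mu nu2 : R) (f : R -> ('I_n -> R) -> R) (u0 u1 : ('I_n -> R) -> R)
    (u : R -> ('I_n -> R) -> C) A At Att Ai Ati Aij B Bt Btt Bi Bti Bij :
  @C2d n A At Att Ai Ati Aij -> @C2d n B Bt Btt Bi Bti Bij ->
  (forall t x, 0 <= t -> u t x = (A t x, B t x)) ->
  (forall t x, 0 < t -> Att t x - \rsum_(i < n) Aij i i t x + mu / (1 + t) * At t x
      + nu2 / (1 + t) ^ 2 * A t x = f t x) ->
  (forall t x, 0 < t -> Btt t x - \rsum_(i < n) Bij i i t x + mu / (1 + t) * Bt t x
      + nu2 / (1 + t) ^ 2 * B t x = 0) ->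
  (forall x, A 0 x = u0 x) -> (forall x, B 0 x = 0) ->
  (forall x, At 0 x = u1 x) -> (forall x, Bt 0 x = 0) ->
  classical_solution mu nu2 f u0 u1 u.
Proof.
move=> hA hB hu pA pB A0 B0 A1 B1.
have [[a0 [a1 a2]] ai [da0 da1] dai] := hA. have [[b0 [b1 b2]] bi [db0 db1] dbi] := hB.
split.
- exact: C2d_Ck_spacetime hA hB hu.
- move=> t x ht.
  have loc s : 0 < s -> is_derive (fun s => Re (u s x)) s (Re (At s x, Bt s x)) /\
      is_derive (fun s => Im (u s x)) s (Im (At s x, Bt s x)).
    move=> hs; split.
      apply: (is_derive_ext_loc (A^~ x)); last exact: da0.
      by apply: filter_imp (open_gt 0 s hs) => r hr; rewrite hu //; lra.
    apply: (is_derive_ext_loc (B^~ x)); last exact: db0.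
    by apply: filter_imp (open_gt 0 s hs) => r hr; rewrite hu //; lra.
  have e1 : CDerive (fun s => u s x) t = (At t x, Bt t x).
    by apply: CDerive_cder; have [] := loc t ht.
  have e2 : CDerive (CDerive (fun s => u s x)) t = (Att t x, Btt t x).
    apply: (CDerive2 (g1 := fun s => (At s x, Bt s x))); [|exact: da1|exact: db1].
    by apply: filter_imp (open_gt 0 t ht) => s hs; exact: loc.
  have e3 : laplacian (u t) x = (\rsum_(i < n) Aij i i t x, \rsum_(i < n) Bij i i t x).
    have ei i : CDerive (CDerive (fun h => u t (shift x i h))) 0 = (Aij i i t x, Bij i i t x).
      have [k1 k2 k3 k4] := dai i; have [l1 l2 l3 l4] := dbi i.
      have ht' : 0 <= t by lra.
      apply: (CDerive2 (g1 := fun h => (Ai i t (shift x i h), Bi i t (shift x i h)))).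
      + apply: filter_forall => h; split.
          apply: (dR_ext (f := fun h => A t (shift x i h))); first by move=> r; rewrite hu.
          exact: is_derive_shift.
        apply: (dR_ext (f := fun h => B t (shift x i h))); first by move=> r; rewrite hu.
        exact: is_derive_shift.
      + exact: k4.
      + exact: l4.
    rewrite /laplacian (eq_bigr (fun i => (Aij i i t x, Bij i i t x) : C) (fun i _ => ei i)).
    by apply: C_ext; [exact: big_Re|exact: big_Im].
  rewrite e1 e2 e3 hu; last lra.
  have := pA t x ht; have := pB t x ht.
  move: (\rsum_(i < n) Aij i i t x) (\rsum_(i < n) Bij i i t x) (mu / (1 + t)) (nu2 / (1 + t) ^ 2).
  move=> SA SB m q q1 q2.
  by apply: C_ext; rewrite /Cmult /Cminus /Cplus /Copp /RtoC /Re /Im /=; lra.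
- by move=> x; rewrite hu ?A0 ?B0 //; lra.
move=> x.
have z : 0 <= 0 by lra.
have -> : RtoC (u1 x) = (At 0 x, Bt 0 x) by rewrite A1 B1.
have sl (F : R -> ('I_n -> R) -> R) :
    (forall p : R * ('I_n -> R), continuous (fun p => F p.1 p.2) p) -> forall s, continuous (F^~ x) s.
  by move=> h s; exact: (c_slice_l (F := F)).
apply: (@ge0_derive_pair (fun s => u s x) (A^~ x) (At^~ x) (B^~ x) (Bt^~ x)) => //.
- exact: sl.
- exact: sl.
- exact: sl.
- exact: sl.
- by move=> s hs; exact: da0.
- by move=> s hs; exact: db0.
by move=> s hs; exact: hu.
Qed.

Lemma fun_choice (A B : Type) (Q : A -> B -> Prop) :
  (forall a, exists b, Q a b) -> exists f : A -> B, forall a, Q a (f a).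
Proof.
move=> h; exists (fun a => proj1_sig (constructive_indefinite_description _ (h a))) => a.
exact: proj2_sig (constructive_indefinite_description _ (h a)).
Qed.

Lemma CDerive_is_derive (g : R -> C) (t : R) (l : C) :
  is_derive (V := C_R_NormedModule) g t l -> CDerive g t = l.
Proof. by move=> /is_derive_C_components [h1 h2]; exact: CDerive_cder. Qed.

Lemma component_linear (pi : C -> R) (l m : C) (a : R) :
  pi = Re \/ pi = Im ->
  [/\ pi (l + m)%C = pi l + pi m, pi (l - m)%C = pi l - pi m & pi (RtoC a * l)%C = a * pi l].
Proof.
by case=> ->; case: l => l1 l2; case: m => m1 m2; rewrite /Cplus /Cminus /Cmult /Copp /RtoC /Re /Im /=;
  split; ring.
Qed.

Lemma component_big (pi : C -> R) (I : finType) (F : I -> C) :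
  pi = Re \/ pi = Im -> pi (\big[Cplus/RtoC 0]_(i : I) F i) = \big[Rplus/0]_(i : I) pi (F i).
Proof. by case=> ->; [exact: big_Re|exact: big_Im]. Qed.

Lemma component_derive (pi : C -> R) (F : (R -> Prop) -> Prop) {FF : Filter F} (u : R -> C) (l : C) :
  pi = Re \/ pi = Im -> diffC u F l -> diffR (fun s => pi (u s)) F (pi l).
Proof. by move=> hpi /filterdiff_components [h1 h2]; case: hpi => ->. Qed.

(** Values at negative times are arbitrary, so t is replaced by max(t, 0); this extends u from t >=
    0 to a function continuous everywhere, the form that the integral lemmas take. *)
Lemma clamp_continuous (V : NormedModule R_AbsRing) (n : nat) (u : R -> ('I_n -> R) -> V) :
  (forall t x, 0 <= t -> filterlim (fun p : R * ('I_n -> R) => u p.1 p.2)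
    (within (fun p => 0 <= p.1) (locally (t, x))) (locally (u t x))) ->
  forall p : R * ('I_n -> R), continuous (fun p => u (Rmax p.1 0) p.2) p.
Proof.
move=> h [t x].
apply: (filterlim_comp _ _ _ (fun p : R * ('I_n -> R) => (Rmax p.1 0, p.2)) (fun p => u p.1 p.2)
  _ _ _ _ (h (Rmax t 0) x (Rmax_r t 0))).
move=> Q hQ.
have hcl : continuous (fun p : R * ('I_n -> R) => (Rmax p.1 0, p.2)) (t, x).
  by apply: (c_pair (f := fun p : R * ('I_n -> R) => Rmax p.1 0)); cont.
have H : locally (t, x) (fun p => 0 <= Rmax p.1 0 -> Q (Rmax p.1 0, p.2)) := hcl _ hQ.
have : locally (t, x) (fun p => Q (Rmax p.1 0, p.2)) by apply: filter_imp H => q; apply; exact: Rmax_r.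
by [].
Qed.

Lemma component_clamp (pi : C -> R) (n : nat) (u : R -> ('I_n -> R) -> C) :
  pi = Re \/ pi = Im ->
  (forall t x, 0 <= t -> filterlim (fun p : R * ('I_n -> R) => u p.1 p.2)
    (within (fun p => 0 <= p.1) (locally (t, x))) (locally (u t x : C_R_NormedModule))) ->
  forall p : R * ('I_n -> R), continuous (fun p => pi (u (Rmax p.1 0) p.2)) p.
Proof.
move=> hpi h p; have hc := @clamp_continuous C_R_NormedModule n u h p.
by case: hpi => ->; [exact: (c_fst hc)|exact: (c_snd hc)].
Qed.

(** Only [C2w] comes out: a classical solution provides the time derivative of each space
    derivative, with no identification with the space derivative of the time derivative. *)
Lemma classical_component (n : nat) (mu nu2 : R) (f : R -> ('I_n -> R) -> R) (u0 u1 : ('I_n -> R) -> R)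
    (u : R -> ('I_n -> R) -> C) (pi : C -> R) :
  pi = Re \/ pi = Im -> classical_solution mu nu2 f u0 u1 u ->
  exists Wt Wtt Wi Wti Wij, [/\ C2w (fun t x => pi (u (Rmax t 0) x)) Wt Wtt Wi Wti Wij,
    forall t x, 0 < t -> Wtt t x - \rsum_(i < n) Wij i i t x + mu / (1 + t) * Wt t x
      + nu2 / (1 + t) ^ 2 * pi (u (Rmax t 0) x) = pi (RtoC (f t x)),
    forall x, pi (u (Rmax 0 0) x) = pi (RtoC (u0 x))
    & forall x, Wt 0 x = pi (RtoC (u1 x))].
Proof.
move=> hpi [[cu [[ut [dut [cut [[utt [dutt [cutt _]]] _]]]] hui]] pde i0 i1].
have [ui Hui] := fun_choice hui.
have [uti Huti] := fun_choice (fun i => proj1 (proj2 (proj2 (Hui i)))).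
have [uij Huij] := fun_choice (fun i => fun_choice (proj2 (proj2 (proj2 (Hui i))))).
have m0 t : 0 <= Rmax t 0 := Rmax_r t 0.
have dt (g gt : R -> ('I_n -> R) -> C) t x : 0 < t ->
    (forall t x, 0 <= t -> is_derive_ge0 (V := C_R_NormedModule) (fun s => g s x) t (gt t x)) ->
    is_derive (fun t => pi (g (Rmax t 0) x)) t (pi (gt (Rmax t 0) x)).
  move=> ht hd; have ht0 : 0 <= t by lra.
  rewrite (Rmax_left t 0) //.
  apply: (is_derive_ext_loc (fun s => pi (g s x))).
    by apply: filter_imp (open_gt 0 t ht) => s hs; rewrite Rmax_left //; lra.
  exact: (component_derive hpi (is_derive_ge0_interior ht (hd t x ht0))).
exists (fun t x => pi (ut (Rmax t 0) x)), (fun t x => pi (utt (Rmax t 0) x)),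
  (fun i t x => pi (ui i (Rmax t 0) x)), (fun i t x => pi (uti i (Rmax t 0) x)),
  (fun i j t x => pi (uij i j (Rmax t 0) x)).
split.
- split.
  + by split; [exact: (component_clamp hpi cu)|split; [exact: (component_clamp hpi cut)|exact: (component_clamp hpi cutt)]].
  + move=> i; split; first exact: (component_clamp hpi (proj1 (proj2 (Hui i)))).
    split; first exact: (component_clamp hpi (proj1 (proj2 (Huti i)))).
    by move=> j; exact: (component_clamp hpi (proj1 (proj2 (Huij i j)))).
  + by split=> t x ht; apply: dt.
  + move=> i; split=> [t x ht|t x|j t x].
    * by apply: dt => //; exact: (proj1 (Huti i)).
    * exact: (component_derive hpi (proj1 (Hui i) _ x (m0 t))).
    * exact: (component_derive hpi (proj1 (Huij i j) _ x (m0 t))).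
- move=> t x ht; have ht0 : 0 <= t by lra.
  rewrite (Rmax_left t 0) // -(pde t x ht).
  have du s : 0 < s -> CDerive (fun s => u s x) s = ut s x.
    by move=> hs; apply: CDerive_is_derive; apply: is_derive_ge0_interior => //; apply: dut; lra.
  have e2 : CDerive (CDerive (fun s => u s x)) t = utt t x.
    rewrite (CDerive_ext_loc (h := fun s => ut s x)).
      by apply: CDerive_is_derive; apply: is_derive_ge0_interior => //; exact: dutt.
    by apply: filter_imp (open_gt 0 t ht) => s hs; exact: du.
  have e3 i : CDerive (CDerive (fun h => u t (shift x i h))) 0 = uij i i t x.
    rewrite (CDerive_ext_loc (h := fun h => ui i t (shift x i h))).
      by apply: CDerive_is_derive; exact: (proj1 (Huij i i) t x ht0).
    apply: filter_forall => h; have k := proj1 (Hui i) t.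
    apply: CDerive_cder.
      apply: (is_derive_shift (g := fun x => Re (u t x)) (dg := fun x => Re (ui i t x))) => y.
      exact: (is_derive_C_components (k y ht0)).1.
    apply: (is_derive_shift (g := fun x => Im (u t x)) (dg := fun x => Im (ui i t x))) => y.
    exact: (is_derive_C_components (k y ht0)).2.
  rewrite e2 du // /laplacian (eq_bigr (fun i => uij i i t x) (fun i _ => e3 i)).
  set S := \big[Cplus/_]_(i < n) _.
  have [-> _ _] := component_linear (utt t x - S + RtoC (mu / (1 + t)) * ut t x) (RtoC (nu2 / (1 + t) ^ 2) * u t x) 0 hpi.
  have [-> _ _] := component_linear (utt t x - S) (RtoC (mu / (1 + t)) * ut t x) 0 hpi.
  have [_ -> _] := component_linear (utt t x) S 0 hpi.
  have [_ _ ->] := component_linear (ut t x) 0 (mu / (1 + t)) hpi.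
  have [_ _ ->] := component_linear (u t x) 0 (nu2 / (1 + t) ^ 2) hpi.
  by rewrite (component_big _ hpi).
- by move=> x; rewrite Rmax_left ?i0 //; lra.
move=> x; rewrite Rmax_left; last lra.
apply: (is_derive_ge0_0_unique (f := fun t => pi (u t x))).
  have h0 : 0 <= 0 by lra.
  have hp := half_proper h0.
  exact: (component_derive hpi (dut 0 x h0)).
have h0 : 0 <= 0 by lra.
have hp := half_proper h0.
exact: (component_derive hpi (i1 x)).
Qed.

Lemma C2w_minus (n : nat) U Ut Utt Ui Uti Uij V Vt Vtt Vi Vti Vij :
  @C2w n U Ut Utt Ui Uti Uij -> @C2w n V Vt Vtt Vi Vti Vij ->
  C2w (fun t x => U t x - V t x) (fun t x => Ut t x - Vt t x) (fun t x => Utt t x - Vtt t x)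
    (fun i t x => Ui i t x - Vi i t x) (fun i t x => Uti i t x - Vti i t x)
    (fun i j t x => Uij i j t x - Vij i j t x).
Proof.
move=> [[a1 [a2 a3]] b [d1 d2] e] [[a1' [a2' a3']] b' [d1' d2'] e'].
split.
- by split=> [p|]; [|split=> p]; apply: cR_minus.
- move=> i; have [b1 [b2 b3]] := b i; have [b1' [b2' b3']] := b' i.
  by split=> [p|]; [|split=> [p|j p]]; apply: cR_minus; try apply: b3; try apply: b3'.
- by split=> t x ht; apply: dR_minus; [apply: d1|apply: d1'|apply: d2|apply: d2'].
move=> i; have [e1 e2 e4] := e i; have [e1' e2' e4'] := e' i.
split=> [t x ht|t x|j t x]; apply: dR_minus;
  by [apply: e1|apply: e1'|apply: e2|apply: e2'|apply: e4|apply: e4'].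
Qed.

Lemma C2d_C2w (n : nat) U Ut Utt Ui Uti Uij : @C2d n U Ut Utt Ui Uti Uij -> C2w U Ut Utt Ui Uti Uij.
Proof. by move=> [a b c d]; split=> // i; have [d1 d2 _ d4] := d i. Qed.

Lemma classical_component_unique (n : nat) (mu nu2 : R) (f : R -> ('I_n.+2 -> R) -> R)
    (u0 u1 : ('I_n.+2 -> R) -> R) (u : R -> ('I_n.+2 -> R) -> C) (pi : C -> R) A At Att Ai Ati Aij :
  0 <= mu -> 0 <= nu2 -> pi = Re \/ pi = Im -> classical_solution mu nu2 f u0 u1 u ->
  @C2d n.+2 A At Att Ai Ati Aij ->
  (forall t x, 0 < t -> Att t x - \rsum_(i < n.+2) Aij i i t x + mu / (1 + t) * At t x
      + nu2 / (1 + t) ^ 2 * A t x = pi (RtoC (f t x))) ->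
  (forall x, A 0 x = pi (RtoC (u0 x))) -> (forall x, At 0 x = pi (RtoC (u1 x))) ->
  forall t x, 0 <= t -> pi (u t x) = A t x.
Proof.
move=> hmu hnu hpi hu hA pA A0 A1 t x ht.
have [Wt [Wtt [Wi [Wti [Wij [hW pW W0 W1]]]]]] := classical_component hpi hu.
have := wave_unique (C2w_minus hW (C2d_C2w hA)) hmu hnu.
move=> H; have : pi (u (Rmax t 0) x) - A t x = 0.
  apply: H => //.
  - move=> s y hs; have := pA s y hs; have := pW s y hs.
    have -> : \rsum_(i < n.+2) (Wij i i s y - Aij i i s y) =
        \rsum_(i < n.+2) Wij i i s y + -1 * \rsum_(i < n.+2) Aij i i s y.
      by rewrite big_scal -big_split /=; apply: eq_bigr => i _; ring.
    move: (\rsum_(i < n.+2) Wij i i s y) (\rsum_(i < n.+2) Aij i i s y) (mu / _) (nu2 / _) => a b c d; lra.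
  - by move=> y; rewrite W0 A0; ring.
  by move=> y; rewrite W1 A1; ring.
rewrite Rmax_left //; lra.
Qed.

(** * The representation formula *)

(** With p = 1 + t and q = 1 + b one has (t+b+2)^2 - s^2 = 2 (y+1) p q and (t-b)^2 - s^2 = 2 (y-1) p
    q. So the hypergeometric argument is (y-1)/(y+1), and the powers of p and q with exponents a and
    - a cancel. *)
Lemma kernelE_profile (mu nu2 t b s : R) :
  0 < 1 + t -> 0 < 1 + b -> 1 <= yv (1 + t) (1 + b) s ->
  let sd := csqrt (delta mu nu2) in
  let c := (/ cpower 2 (sd - 1))%C in
  (c * kernelE t 0 b s mu nu2 = RtoC (Rpower (1 + t) (- mu / 2) * Rpower (1 + b) (mu / 2))
     * profile c ((1 - sd) / 2) 0 (yv (1 + t) (1 + b) s))%C.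
Proof.
move=> hp hq hy sd c; rewrite /kernelE -/sd /profile /hypH -hypergeom_hyp.
set a := ((1 - sd) / 2)%C.
set y := yv _ _ _ in hy *.
have hpq : 0 < (1 + t) * (1 + b) by exact: Rmult_lt_0_compat.
have h2 : RtoC 2 <> 0 by apply: RtoC_neq0; lra.
have eQ : (t + b + 2) ^ 2 - (s - 0) ^ 2 = 2 * (1 + y) * ((1 + t) * (1 + b)).
  by rewrite /y /yv; field; lra.
have ez : ((t - b) ^ 2 - (s - 0) ^ 2) / ((t + b + 2) ^ 2 - (s - 0) ^ 2) = argz y.
  rewrite eQ /argz.
  have -> : (t - b) ^ 2 - (s - 0) ^ 2 = 2 * (y - 1) * ((1 + t) * (1 + b)).
    by rewrite /y /yv; field; lra.
  by field; lra.
rewrite ez eQ.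
have ea : ((sd - 1) / 2 = - a)%C by rewrite /a; field.
rewrite ea cpower_mult //; last lra.
rewrite (cpower_mult _ hp hq).
have e1 : (- RtoC mu / 2 = RtoC (- mu / 2))%C by rewrite RtoC_div ?RtoC_opp //; lra.
have e2 : (RtoC mu / 2 = RtoC (mu / 2))%C by rewrite RtoC_div //; lra.
rewrite e1 e2 !cpower_plus !cpower_RtoC -/(Rpower _ _) -/(Rpower _ _) RtoC_mult.
have i1 : (cpower (1 + t) a * cpower (1 + t) (- a) = 1)%C.
  by rewrite -cpower_plus (_ : a + - a = 0)%C ?cpower_0 //; ring.
have i2 : (cpower (1 + b) a * cpower (1 + b) (- a) = 1)%C.
  by rewrite -cpower_plus (_ : a + - a = 0)%C ?cpower_0 //; ring.
transitivity (c * RtoC (Rpower (1 + t) (- mu / 2)) * RtoC (Rpower (1 + b) (mu / 2))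
  * cpower (2 * (1 + y)) (- a) * hypergeom a a 1 (argz y)
  * (cpower (1 + t) a * cpower (1 + t) (- a)) * (cpower (1 + b) a * cpower (1 + b) (- a)))%C; first by ring.
by rewrite i1 i2; ring.
Qed.

Lemma cpower_factor_neq0 (z : C) : (/ cpower 2 z)%C <> 0.
Proof.
move=> h; have h0 := @cpower_neq0 2 z.
have : (cpower 2 z * / cpower 2 z = 1)%C by field.
by rewrite h Cmult_0_r => /(f_equal fst) /= h1; lra.
Qed.

Lemma CRInt_pair (g : R -> C) (A B : R -> R) (a b : R) :
  (forall s, continuous A s) -> (forall s, continuous B s) ->
  (forall s, Rmin a b < s < Rmax a b -> g s = (A s, B s)) -> CRInt g a b = (RInt A a b, RInt B a b).
Proof.
move=> hA hB h; rewrite /CRInt; apply: (is_RInt_unique (V := C_R_CompleteNormedModule)).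
apply: (is_RInt_ext (fun s => (A s, B s) : C_R_NormedModule)).
  by move=> s hs; rewrite h.
by apply: (is_RInt_fct_extend_pair (U := R_NormedModule) (V := R_NormedModule));
  apply: (RInt_correct (V := R_CompleteNormedModule)); exact: cR_ex_RInt.
Qed.

(** The normalised kernel c * g is the one known through real components; since c is nonzero, g is
    recovered from it as a pair of continuous functions, for which the integral splits. *)
Lemma CRInt_scaled (c : C) (g : R -> C) (A B : R -> R) (a b : R) :
  c <> 0 -> (forall s, continuous A s) -> (forall s, continuous B s) ->
  (forall s, Rmin a b < s < Rmax a b -> (c * g s)%C = (A s, B s)) ->
  (c * CRInt g a b)%C = (RInt A a b, RInt B a b).
Proof.
move=> hc hA hB h.
case e : (/ c)%C => [d1 d2].
have hg s : Rmin a b < s < Rmax a b -> g s = (d1 * A s + - d2 * B s, d1 * B s + d2 * A s).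
  move=> hs; have -> : g s = (/ c * (c * g s))%C by field.
  rewrite h // e; apply: C_ext; rewrite /Cmult /Re /Im /=; ring.
rewrite (CRInt_pair (A := fun s => d1 * A s + - d2 * B s) (B := fun s => d1 * B s + d2 * A s)) //; first last.
- by move=> s; cont.
- by move=> s; cont.
rewrite !cR_RInt_plus ?cR_RInt_scal //; try by move=> s; cont.
have -> : (d1 * RInt A a b + - d2 * RInt B a b, d1 * RInt B a b + d2 * RInt A a b)
   = (/ c * (RInt A a b, RInt B a b))%C.
  rewrite e; apply: C_ext; rewrite /Cmult /Re /Im /=; ring.
by field.
Qed.

Lemma kernelK0_profile (mu nu2 t s : R) (P Q : nat -> R -> R) :
  let sd := csqrt (delta mu nu2) in
  let c := (/ cpower 2 (sd - 1))%C in
  let lam := (1 - delta mu nu2) / 4 in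
  legendre lam 1 P -> legendre lam 0 Q ->
  (forall y, 1 <= y -> profile c ((1 - sd) / 2) 0 y = (P 0%N y, Q 0%N y)) ->
  0 < s < t ->
  (c * kernelK0 t 0 s mu nu2)%C =
   (Rpower (1 + t) (- mu / 2) * (DK P t 0 s - mu / 2 * GK P t 0 s),
    Rpower (1 + t) (- mu / 2) * (DK Q t 0 s - mu / 2 * GK Q t 0 s)).
Proof.
move=> sd c lam hP hQ hprof hs.
have hc : c <> 0 by exact: cpower_factor_neq0.
have hp : 0 < 1 + t by lra.
pose g := Rpower (1 + t) (- mu / 2).
pose h (X : nat -> R -> R) b := g * (Rpower (1 + b) (mu / 2) * X 0%N (yv (1 + t) (1 + b) s)).
have hd X kappa : legendre lam kappa X ->
    is_derive (h X) 0 (- (g * (DK X t 0 s - mu / 2 * GK X t 0 s))).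
  move=> hX; have [hder _ _ _ _] := hX.
  have hq : 0 < 1 + 0 by lra.
  have d1 : is_derive (fun b => Rpower (1 + b) (mu / 2)) 0 (mu / 2).
    rewrite /Rpower; apply: dR_eq.
      apply: (dR_comp (f := exp)); first exact: is_derive_exp.
      apply: dR_scal; apply: (dR_comp (f := ln)); first by apply: is_derive_ln; lra.
      by apply: dR_plus; [exact: dR_const|exact: dR_id].
    by rewrite /= Rplus_0_r ln_1 Rmult_0_r exp_0; field.
  have d2 : is_derive (fun b => yv (1 + t) (1 + b) s) 0 (yq (1 + t) (1 + 0) s).
    apply: dR_eq.
      apply: (dR_comp (f := fun q => yv (1 + t) q s) (g := fun b => 1 + b)).
        exact: d_yv_q.
      by apply: dR_plus; [exact: dR_const|exact: dR_id].
    by rewrite Rplus_0_l Rmult_1_r.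
  apply: dR_eq.
    apply: dR_scal; apply: dR_mult; first exact: d1.
    by apply: (dR_comp (f := X 0%N)); [exact: hder|exact: d2].
  rewrite /= /DK /GK !pc_eq; try lra.
  have -> : Rpower (1 + 0) (mu / 2) = 1 by rewrite /Rpower Rplus_0_r ln_1 Rmult_0_r exp_0.
  by rewrite -/g (Rplus_0_r 1); ring.
have loc : locally 0 (fun b => kernelE t 0 b s mu nu2 = (/ c * (h P b, h Q b))%C).
  (* For |b| < min(1, t - s) the base 1 + b is positive and s <= t - b keeps y >= 1, where the
     profile is known. Negative b occur as well, because the derivative at b = 0 is two-sided. *)
  have hts : 0 < Rmin 1 (t - s) by apply: Rmin_glb_lt; lra.
  exists (mkposreal _ hts) => b hb.
  have {hb} : Rabs b < Rmin 1 (t - s).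
    by move: hb; rewrite /ball /= /AbsRing_ball /= /abs /minus /plus /opp /= Ropp_0 Rplus_0_r.
  move=> hb; have h1 := Rmin_l 1 (t - s); have h2 := Rmin_r 1 (t - s).
  have [h3 h4] := Rabs_def2 _ _ hb.
  have hq : 0 < 1 + b by lra.
  have hy : 1 <= yv (1 + t) (1 + b) s by apply: yv_ge1 => //; lra.
  have e := kernelE_profile mu nu2 hp hq hy; cbv zeta in e.
  rewrite -/sd -/c hprof // in e.
  have -> : kernelE t 0 b s mu nu2 = (/ c * (c * kernelE t 0 b s mu nu2))%C by field.
  rewrite e; congr (_ * _)%C.
  by apply: C_ext; rewrite /Cmult /RtoC /Re /Im /h /g /=; ring.
have hh : cder (fun b => (h P b, h Q b)) 0
   (- (g * (DK P t 0 s - mu / 2 * GK P t 0 s)), - (g * (DK Q t 0 s - mu / 2 * GK Q t 0 s))).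
  by split; [exact: (hd P 1)|exact: (hd Q 0)].
pose v : C := (- (g * (DK P t 0 s - mu / 2 * GK P t 0 s)), - (g * (DK Q t 0 s - mu / 2 * GK Q t 0 s))).
have e : CDerive (fun b => kernelE t 0 b s mu nu2) 0 = (/ c * v)%C.
  rewrite (CDerive_ext_loc loc).
  by have [k1 k2] := cder_scal (/ c)%C hh; exact: CDerive_cder.
rewrite /kernelK0 e -/g.
transitivity (- v)%C; first by field.
by apply: C_ext; rewrite /Copp /Re /Im /=; ring.
Qed.

Lemma wop_scal (k : nat) (a : R) (phi : ('I_k.*2.+3 -> R) -> R) (r : R) (x : 'I_k.*2.+3 -> R) :
  ck k.+1 phi -> wop (fun x => a * phi x) r x = a * wop phi r x.
Proof.
move=> h; have := wop_lin (a - 1) r x h h.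
have -> : (fun x => (a - 1) * phi x + phi x) = (fun x => a * phi x).
  by apply: functional_extensionality => y; ring.
by move=> ->; ring.
Qed.

Lemma representation_sol (k : nat) (mu nu2 : R) (f : R -> ('I_k.*2.+3 -> R) -> R)
    (u0 u1 : ('I_k.*2.+3 -> R) -> R) (P Q : nat -> R -> R) (t : R) (x : 'I_k.*2.+3 -> R) :
  let sd := csqrt (delta mu nu2) in
  let c := (/ cpower 2 (sd - 1))%C in
  let lam := (1 - delta mu nu2) / 4 in
  let u kappa X := Rpower (pc t) (- mu / 2) *
     sol kappa X u0 (fun x => mu / 2 * u0 x + u1 x) (source mu f) t x in
  legendre lam 1 P -> legendre lam 0 Q ->
  (forall y, 1 <= y -> profile c ((1 - sd) / 2) 0 y = (P 0%N y, Q 0%N y)) ->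
  ck k.+3 u0 -> ck k.+2 u1 -> Ck k.+2 (fun b => f (Rmax b 0)) -> 0 <= t ->
  representation mu nu2 f u0 u1 t x = (u 1 P, u 0 Q).
Proof.
move=> sd c lam u hP hQ hprof h0 h1 hf ht.
set X := fct_UniformSpace 'I_k.*2.+3 R_UniformSpace.
have hc : c <> 0 by exact: cpower_factor_neq0.
have [[cGP _ _ _ _] _ _ _ _] := GK_wave_kernel hP. have [[cGQ _ _ _ _] _ _ _ _] := GK_wave_kernel hQ.
have [[cDP _ _ _ _] _ _ _ _] := DK_wave_kernel hP. have [[cDQ _ _ _ _] _ _ _ _] := DK_wave_kernel hQ.
have w0 : ck k.+1 u0 := Ck_S (Ck_S h0). have w1 : ck k.+1 u1 := Ck_S h1.
have hU1 : ck k.+1 (fun x => mu / 2 * u0 x + u1 x).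
  by apply: Ck_plus => //; apply: Ck_scal => // b; exact: cR_const.
have hv1 : ck k.+1 (fun z => u1 z + mu * u0 z).
  by apply: Ck_plus => //; apply: Ck_scal => // b; exact: cR_const.
have hF : Ck k.+2 (source mu f) by apply: Ck_scal => // b; exact: Rpower_pc_continuous.
set g := Rpower (1 + t) (- mu / 2).
have eu kappa Y : u kappa Y = g * sol kappa Y u0 (fun x => mu / 2 * u0 x + u1 x) (source mu f) t x.
  by rewrite /u pc_eq.
have cK (K : R -> R -> R -> R) b s : cont3 R_UniformSpace K -> continuous (fun s => K t b s) s.
  by move=> hK; apply: (c_comp3 (h := K)) => //; cont.
have cw phi s : ck k.+1 phi -> continuous (fun s => wop phi s x) s.
  by move=> hp; apply: (wop_continuous (Phi := fun _ => phi) (b := fun _ => 0)) => // q; cont.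
pose KD Y s := g * (DK Y t 0 s - mu / 2 * GK Y t 0 s).
have cD Y s : cont3 R_UniformSpace (GK Y) -> cont3 R_UniformSpace (DK Y) ->
    continuous (fun s => wop u0 s x * KD Y s) s.
  move=> hG hD; apply: cR_mult; first exact: cw.
  apply: cR_mult; first exact: cR_const.
  apply: cR_minus; first exact: (cK _ 0 s hD).
  by apply: cR_mult; [exact: cR_const|exact: (cK _ 0 s hG)].
have cG Y phi s : ck k.+1 phi -> cont3 R_UniformSpace (GK Y) ->
    continuous (fun s => wop phi s x * (g * GK Y t 0 s)) s.
  move=> hphi hG; apply: cR_mult; first exact: cw.
  by apply: cR_mult; [exact: cR_const|exact: (cK _ 0 s hG)].
have I1 : (c * CRInt (fun s => RtoC (free_wave u0 s x) * kernelK0 t 0 s mu nu2) 0 t)%C =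
    (RInt (fun s => wop u0 s x * KD P s) 0 t, RInt (fun s => wop u0 s x * KD Q s) 0 t).
  apply: CRInt_scaled => // [s|s|s].
  - exact: cD.
  - exact: cD.
  rewrite Rmin_left // Rmax_right // => hs.
  rewrite free_wave_wop //; last lra.
  have e := kernelK0_profile hP hQ hprof hs; cbv zeta in e; rewrite -/sd -/c -/g in e.
  have -> : (c * (RtoC (wop u0 s x) * kernelK0 t 0 s mu nu2) = RtoC (wop u0 s x) * (c * kernelK0 t 0 s mu nu2))%C by ring.
  by rewrite e; apply: C_ext; rewrite /Cmult /RtoC /Re /Im /KD /=; ring.
have I2 : (c * CRInt (fun s => RtoC (free_wave (fun z => u1 z + mu * u0 z)%R s x) * kernelK1 t 0 s mu nu2) 0 t)%C =
    (RInt (fun s => wop (fun z => u1 z + mu * u0 z) s x * (g * GK P t 0 s)) 0 t,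
     RInt (fun s => wop (fun z => u1 z + mu * u0 z) s x * (g * GK Q t 0 s)) 0 t).
  apply: CRInt_scaled => // [s|s|s].
  - exact: cG.
  - exact: cG.
  rewrite Rmin_left // Rmax_right // => hs.
  rewrite free_wave_wop //; last lra.
  have hp : 0 < 1 + t by lra.
  have hq : 0 < 1 + 0 by lra.
  have hy : 1 <= yv (1 + t) (1 + 0) s by apply: yv_ge1; lra.
  have e := kernelE_profile mu nu2 hp hq hy; cbv zeta in e; rewrite -/sd -/c -/g hprof // in e.
  rewrite /kernelK1.
  have -> : (c * (RtoC (wop (fun z => u1 z + mu * u0 z)%R s x) * kernelE t 0 0 s mu nu2) =
     RtoC (wop (fun z => u1 z + mu * u0 z)%R s x) * (c * kernelE t 0 0 s mu nu2))%C by ring.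
  rewrite e; have -> : Rpower (1 + 0) (mu / 2) = 1.
    by rewrite /Rpower Rplus_0_r ln_1 Rmult_0_r exp_0.
  rewrite /GK !pc_eq; try lra.
  by apply: C_ext; rewrite /Cmult /RtoC /Re /Im /=; ring.
have inner b : 0 <= b <= t ->
    (c * CRInt (fun s => RtoC (free_wave (f b) s x) * kernelE t 0 b s mu nu2) 0 (t - b)%R)%C =
    (g * Zop (source mu f) (GK P) t b x, g * Zop (source mu f) (GK Q) t b x).
  move=> hb; have ck1 : ck k.+1 (f b).
    by have := Ck_S (Ck_slice b hf); rewrite Rmax_left //; lra.
  have ef s : wop (source mu f b) s x = Rpower (1 + b) (mu / 2) * wop (f b) s x.
    have -> : source mu f b = (fun y => Rpower (1 + b) (mu / 2) * f b y).
      by apply: functional_extensionality => y; rewrite /source pc_eq ?Rmax_left //; lra.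
    exact: wop_scal.
  have cs Y s : cont3 R_UniformSpace (GK Y) -> continuous (fun s => wop (source mu f b) s x * GK Y t b s) s.
    by move=> hK; apply: cR_mult; [apply: cw; exact: (Ck_S (Ck_slice b hF))|exact: (cK _ b s hK)].
  rewrite /Zop /J -!cR_RInt_scal; try by move=> s; exact: cs.
  apply: CRInt_scaled => // [s|s|s].
  - by apply: cR_mult; [exact: cR_const|exact: cs].
  - by apply: cR_mult; [exact: cR_const|exact: cs].
  rewrite Rmin_left ?Rmax_right; try lra.
  move=> hs; rewrite free_wave_wop //; last lra.
  have hp : 0 < 1 + t by lra.
  have hq : 0 < 1 + b by lra.
  have hy : 1 <= yv (1 + t) (1 + b) s by apply: yv_ge1; lra.
  have e := kernelE_profile mu nu2 hp hq hy; cbv zeta in e; rewrite -/sd -/c -/g hprof // in e.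
  have -> : (c * (RtoC (wop (f b) s x) * kernelE t 0 b s mu nu2) =
     RtoC (wop (f b) s x) * (c * kernelE t 0 b s mu nu2))%C by ring.
  rewrite e ef /GK !pc_eq; try lra.
  by apply: C_ext; rewrite /Cmult /RtoC /Re /Im /=; ring.
have cZ Y s : cont3 R_UniformSpace (GK Y) -> continuous (fun b => Zop (source mu f) (GK Y) t b x) s.
  by move=> hK; exact: (@cont3_mid X _ t x s (Z_cont3 (Ck_S hF) hK)).
have I3 : (c * CRInt (fun b => CRInt (fun s => RtoC (free_wave (f b) s x) * kernelE t 0 b s mu nu2) 0 (t - b)%R) 0 t)%C =
   (RInt (fun b => g * Zop (source mu f) (GK P) t b x) 0 t, RInt (fun b => g * Zop (source mu f) (GK Q) t b x) 0 t).
  apply: CRInt_scaled => // [s|s|s].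
  - by apply: cR_mult; [exact: cR_const|exact: cZ].
  - by apply: cR_mult; [exact: cR_const|exact: cZ].
  by rewrite Rmin_left // Rmax_right // => hs; apply: inner; lra.
have ew s : wop (fun z => u1 z + mu * u0 z) s x = mu * wop u0 s x + wop u1 s x.
  have -> : (fun z => u1 z + mu * u0 z) = (fun z => mu * u0 z + u1 z).
    by apply: functional_extensionality => y; ring.
  exact: wop_lin.
have ew2 s : wop (fun x => mu / 2 * u0 x + u1 x) s x = mu / 2 * wop u0 s x + wop u1 s x by exact: wop_lin.
(* The derivative of (1 + b)^(mu/2) leaves - mu/2 * GK in K0; against the datum u1 + mu u0 of K1
   this yields mu/2 u0 + u1, the initial velocity after the Liouville substitution. *)
have fin Y : cont3 R_UniformSpace (GK Y) -> cont3 R_UniformSpace (DK Y) ->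
    RInt (fun s => wop u0 s x * KD Y s) 0 t + RInt (fun s => wop (fun z => u1 z + mu * u0 z) s x * (g * GK Y t 0 s)) 0 t
    + RInt (fun b => g * Zop (source mu f) (GK Y) t b x) 0 t =
    g * (Zop (fun _ => u0) (DK Y) t 0 x + Zop (fun _ => fun x => mu / 2 * u0 x + u1 x) (GK Y) t 0 x
      + Duhamel (Zop (source mu f) (GK Y)) t x).
  move=> hG hD.
  rewrite cR_RInt_scal; last by move=> s; exact: cZ.
  rewrite -cR_RInt_plus; last first.
  - by move=> s; exact: cG.
  - by move=> s; exact: cD.
  rewrite [RHS]Rmult_plus_distr_l; congr (_ + _).
  rewrite /Zop /J Rminus_0_r -cR_RInt_plus; last first.
  - by move=> s; apply: cR_mult; [exact: cw|exact: (cK _ 0 s hG)].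
  - by move=> s; apply: cR_mult; [exact: cw|exact: (cK _ 0 s hD)].
  rewrite -cR_RInt_scal.
    by apply: cR_RInt_ext => s _; rewrite /KD ew ew2; field.
  by move=> s; apply: cR_plus; apply: cR_mult; (try exact: cw); [exact: (cK _ 0 s hD)|exact: (cK _ 0 s hG)].
rewrite /representation -/sd -/c I1 I2 I3 !eu /sol free_wave_wop // -/g.
have fP := fin P cGP cDP. have fQ := fin Q cGQ cDQ.
apply: C_ext; rewrite /Cmult /Cplus /RtoC /Re /Im /=.
  have -> : g * (1 * wop u0 t x + Zop (fun _ => u0) (DK P) t 0 x + Zop (fun _ => fun x => mu / 2 * u0 x + u1 x) (GK P) t 0 x
      + Duhamel (Zop (source mu f) (GK P)) t x) = g * wop u0 t x +
    g * (Zop (fun _ => u0) (DK P) t 0 x + Zop (fun _ => fun x => mu / 2 * u0 x + u1 x) (GK P) t 0 x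
      + Duhamel (Zop (source mu f) (GK P)) t x) by ring.
  by rewrite -fP; ring.
have -> : g * (0 * wop u0 t x + Zop (fun _ => u0) (DK Q) t 0 x + Zop (fun _ => fun x => mu / 2 * u0 x + u1 x) (GK Q) t 0 x
      + Duhamel (Zop (source mu f) (GK Q)) t x) =
    g * (Zop (fun _ => u0) (DK Q) t 0 x + Zop (fun _ => fun x => mu / 2 * u0 x + u1 x) (GK Q) t 0 x
      + Duhamel (Zop (source mu f) (GK Q)) t x) by ring.
by rewrite -fQ; ring.
Qed.

(** * The Cauchy problem *)

Lemma Ck_space_ck (n k : nat) (phi : ('I_n -> R) -> R) :
  Ck_space (V := R_NormedModule) k phi -> ck k phi.
Proof.
have ccont psi (p : R * ('I_n -> R)) : (forall x, continuous psi x) -> continuous (fun p => psi p.2) p.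
  by move=> h; apply: (continuous_comp snd psi) => //; cont.
elim: k phi => [|k IH] phi [hc h]; split; try by move=> p; exact: ccont.
  by [].
move=> i; have [dphi [hd hk]] := h i.
have -> : PD i phi = dphi by apply: functional_extensionality => x; exact: is_derive_unique.
by split; [|exact: IH].
Qed.

(** Of the spacetime regularity of f only the space derivatives, jointly continuous in time, are
    retained. *)
Lemma Ck_spacetime_Ck (n k : nat) (f : R -> ('I_n -> R) -> R) :
  Ck_spacetime (V := R_NormedModule) k f -> Ck k (fun b => f (Rmax b 0)).
Proof.
elim: k f => [|k IH] f [hc h]; split; try exact: (@clamp_continuous R_NormedModule n f hc).
  by [].
move=> i; have [ui [hd hk]] := h.2 i.
have e b : PD i (f (Rmax b 0)) = ui (Rmax b 0).
  by apply: functional_extensionality => x; apply: is_derive_unique; apply: hd; exact: Rmax_r.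
split=> [b x|]; first by rewrite e; apply: hd; exact: Rmax_r.
by apply: Ck_ext (IH _ hk) => b x; rewrite e.
Qed.

Theorem theorem1p2 :
  forall (n : nat) (mu nu2 : R)
         (f : R -> ('I_n -> R) -> R) (u0 u1 : ('I_n -> R) -> R),
  (3 <= n)%N -> odd n -> (0 <= mu)%R -> (0 <= nu2)%R ->
  Ck_spacetime (V := R_NormedModule) (n.+1)./2 f ->
  Ck_space (V := R_NormedModule) ((n.+1)./2).+1 u0 ->
  Ck_space (V := R_NormedModule) (n.+1)./2 u1 ->
  classical_solution mu nu2 f u0 u1 (representation mu nu2 f u0 u1) /\
  (forall u : R -> ('I_n -> R) -> C,
     classical_solution mu nu2 f u0 u1 u ->
     forall (t : R) (x : 'I_n -> R), (0 <= t)%R ->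
       u t x = representation mu nu2 f u0 u1 t x).

Proof.
move=> n mu nu2 f u0 u1 hn hodd hmu hnu hf h0 h1.
(* With n = 2 k + 3, k = (n - 3) / 2 counts the radial derivatives of the wave formula, and (n + 1)
   / 2 = k + 2. *)
have [k ek] : exists k, n = k.*2.+3.
  by exists (n - 3)./2; rewrite -[LHS](subnK hn) addn3 -[in LHS](odd_double_half (n - 3)) oddB // hodd.
subst n.
have e : (k.*2.+4)./2 = k.+2 by rewrite /= doubleK.
rewrite e in hf h0 h1.
move: (Ck_spacetime_Ck hf) (Ck_space_ck h0) (Ck_space_ck h1) => {hf h0 h1} hf h0 h1.
have [P [Q [hP hQ hprof]]] := profile_legendre (delta mu nu2).
have hrep t x := representation_sol (t := t) x hP hQ hprof h0 h1 hf.
(* Real part with kappa = 1; the next line treats the imaginary part, where kappa = 0. *)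
have [At [Att [Ai [Ati [Aij [hA pA A0 A1]]]]]] := damped_sol_spec hP h0 h1 hf.
have [Bt [Btt [Bi [Bti [Bij [hB pB B0 B1]]]]]] := damped_sol_spec hQ h0 h1 hf.
split.
  apply: (C2d_classical hA hB hrep).
  - by move=> t x ht; rewrite pA // Rmult_1_l.
  - by move=> t x ht; rewrite pB // Rmult_0_l.
  - by move=> x; rewrite A0 Rmult_1_l.
  - by move=> x; rewrite B0 Rmult_0_l.
  - by move=> x; rewrite A1 Rmult_1_l.
  - by move=> x; rewrite B1 Rmult_0_l.
move=> u hu t x ht; rewrite hrep //; apply: C_ext.
  apply: (classical_component_unique (pi := Re) hmu hnu _ hu hA) => //; first by left.
  - by move=> s y hs; rewrite pA // Rmult_1_l.
  - by move=> y; rewrite A0 Rmult_1_l.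
  - by move=> y; rewrite A1 Rmult_1_l.
apply: (classical_component_unique (pi := Im) hmu hnu _ hu hB) => //; first by right.
- by move=> s y hs; rewrite pB // Rmult_0_l.
- by move=> y; rewrite B0 Rmult_0_l.
- by move=> y; rewrite B1 Rmult_0_l.
Qed.
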